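(* Let $n\ge1$. The $\mathbf F$-linear subspace $\mathcal H_{q,\underline\kappa}\subset\mathcal D_q\rtimes W_0$ of rational $q$-difference-reflection operators cut out by the conditions 1, 2, 3 listed in the context is an algebra isomorphic to the double affine Hecke algebra $H_{q,\underline\kappa}(CC_n^\vee)$ of type $(C_n^\vee,C_n)$ defined in the context.
   Context: **Ground ring.** $\mathbf F:=\mathbf Z[q^{\pm1/2},t^{\pm1/2},t_0^{\pm1/2},t_n^{\pm1/2},u_0^{\pm1/2},u_n^{\pm1/2}]$ (Laurent polynomials in independent variables), $\underline\kappa=(t_0^{1/2},t^{1/2},t_n^{1/2},u_0^{1/2},u_n^{1/2})$. Set $t_1=\dots=t_{n-1}=t$. **DAHA.** Write $Z\sim z$ for $Z-Z^{-1}=z^{1/2}-z^{-1/2}$. $H_{q,\underline\kappa}(CC_n^\vee)$ is the $\mathbf F$-algebra generated by $T_0^{\pm1},\dots,T_n^{\pm1}$ and pairwise commuting $X_1^{\pm1},\dots,X_n^{\pm1}$ subject to: (i) $T_i\sim t_i$ for $0\le i\le n$; (ii) the affine $\widetilde C_n$ braid relations: $T_iT_j=T_jT_i$ for $|i-j|>1$, $T_iT_{i+1}T_i=T_{i+1}T_iT_{i+1}$ for $1\le i\le n-2$, $T_iT_{i+1}T_iT_{i+1}=T_{i+1}T_iT_{i+1}T_i$ for $i=0,n-1$ (no braid relation if $n=1$); (iii) $T_iX_j=X_jT_i$ if $|i-j|>1$ or $(i,j)=(n,n-1)$; (iv) $T_iX_i=X_{i+1}T_i^{-1}$ for $1\le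 i\le n-1$; (v) $X_n^{-1}T_n^{-1}\sim u_n$; (vi) $q^{-1/2}T_0^{-1}X_1\sim u_0$. **Roots.** Let $\varepsilon_1,\dots,\varepsilon_n$ be the standard orthonormal basis of $\mathbf R^n$ with inner product $\langle\,,\rangle$, $\Lambda=\bigoplus\mathbf Z\varepsilon_i$, and $\delta$ a formal symbol. Let $R^+=R(C_n)^+=\{\varepsilon_i\pm\varepsilon_j:i<j\}\cup\{2\varepsilon_i\}$, $R^-=R(C_n)^-=-R^+$, $R=R^+\cup R^-$, $\alpha^\vee=2\alpha/\langle\alpha,\alpha\rangle$ for $\alpha\in R$. $S=\{\bar\alpha+k\delta:\bar\alpha\in R,k\in\mathbf Z\}$ and $S^+_{\mathrm{Real}}=\{\bar\alpha+k\delta:\bar\alpha\in R^+,k\ge0\}\cup\{\bar\alpha+k\delta:\bar\alpha\in R^-,k>0\}$. $W_0$ is the finite Weyl group of type $C_n$ (signed permutations of $\varepsilon_1,\dots,\varepsilon_n$), $s_{\bar\alpha}\in W_0$ the reflection in $\bar\alpha\in R$. **Functions.** For $\mu=\sum\lambda_i\varepsilon_i+\tfrac k2\delta$ ($\lambda_i,k\in\mathbf Z$) put $e^\mu=q^{k/2}X_1^{\lambda_1}\cdots X_n^{\lambda_n}$. $T$ is the torus with character lattice $\Lambda$, $\mathbf F[T]=\mathbf F[X_1^{\pm1},\dots,X_n^{\pm1}]$, $\mathbf F[T]_{\mathrm{loc}}=\mathbf F[T][(1-e^\alpha)^{-1}:\alpha\in S]$; $W_0$ acts by $w(e^\mu)=e^{w\mu}$.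 Put $T_{\alpha,p}=\{e^\alpha=p\}\subset T$. **$q$-difference operators.** For $\mu=\sum m_i\varepsilon_i\in\Lambda$, $D_{q,\mu}=D_{q,\varepsilon_1}^{m_1}\cdots D_{q,\varepsilon_n}^{m_n}$, where $D_{q,\varepsilon_i}f(X_1,\dots,X_n)=f(X_1,\dots,qX_i,\dots,X_n)$, i.e. $D_{q,\varepsilon_i}X_j=q^{\delta_{ij}}X_jD_{q,\varepsilon_i}$. $\mathcal D_q=\bigoplus_{\mu\in\Lambda}\mathbf F[T]_{\mathrm{loc}}D_{q,\mu}$ is the algebra of rational $q$-difference operators on $T$, and $\mathcal D_q\rtimes W_0=\bigoplus_{w\in W_0,\mu\in\Lambda}\mathbf F[T]_{\mathrm{loc}}D_{q,\mu}[w]$ with $[w]f=w(f)[w]$ and $[w]D_{q,\mu}=D_{q,w\mu}[w]$. **The subspace $\mathcal H_{q,\underline\kappa}$** consists of all (finite) sums $D=\sum_{w\in W_0,\mu\in\Lambda}h_{w,\mu}D_{q,\mu}[w]$, $h_{w,\mu}\in\mathbf F[T]_{\mathrm{loc}}$, satisfying: **1.** Each $h_{w,\mu}$ has at most first-order poles along the divisors $T_{\bar\alpha,q^{-k}}=\{e^\alpha=1\}$, where $\alpha=\bar\alpha+k\delta\in S^+_{\mathrm{Real}}$. **2.** For every $\alpha=\bar\alpha+k\delta\in S^+_{\mathrm{Real}}$ and all $w,\mu$: $\operatorname{Res}_{T_{\bar\alpha,q^{-k}}}(h_{w,\mu})+\operatorname{Res}_{T_{\bar\alpha,q^{-k}}}\big(h_{s_{\bar\alpha}w,\;s_{\bar\alpha}\mu-k\bar\alpha^\vee}\big)=0$,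 where the residue of $h$ along $T_{\bar\alpha,q^{-k}}$ can be taken to be the restriction of $(1-e^\alpha)h$ to $T_{\bar\alpha,q^{-k}}$. **3.** For $\alpha\in R(C_n)^+$, $w\in W_0$, $\mu\in\Lambda$ set $m_\alpha=\langle\alpha,\mu\rangle$ and $\epsilon_\alpha(w)=1$ if $w^{-1}\alpha\in R^-$, $\epsilon_\alpha(w)=0$ if $w^{-1}\alpha\in R^+$. If $\alpha=\varepsilon_i\pm\varepsilon_j$ ($i<j$), then $h_{w,\mu}$ vanishes on $T_{\alpha,p}$ for: - $p=q^{-r}t^{-1}$, if $m_\alpha<0$, for $0\le r\le -m_\alpha-1+\epsilon_\alpha(w)$; - $p=t^{-1}$, if $m_\alpha=0$ and $\epsilon_\alpha(w)=1$; - $p=q^rt$, if $m_\alpha>0$, for $1\le r\le m_\alpha-\epsilon_\alpha(w)$. If $\alpha=2\varepsilon_i$, then $h_{w,\mu}$ vanishes on $T_{\alpha/2,p}=\{e^{\alpha/2}=p\}=\{X_i=p\}$ for: - $p\in\{q^{-r}t_n^{-1/2}u_n^{-1/2},\,-q^{-r}t_n^{-1/2}u_n^{1/2}\}$, if $m_\alpha<0$, for $0\le r\le-\frac{m_\alpha}2-1+\epsilon_\alpha(w)$; - $p\in\{q^{-(r+\frac12)}t_0^{-1/2}u_0^{-1/2},\,-q^{-(r+\frac12)}t_0^{-1/2}u_0^{1/2}\}$, if $m_\alpha<0$, for $0\le r\le-\frac{m_\alpha}2-1$; - $p\in\{t_n^{-1/2}u_n^{-1/2},\,-t_n^{-1/2}u_n^{1/2}\}$,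 if $m_\alpha=0$ and $\epsilon_\alpha(w)=1$; - $p\in\{q^rt_n^{1/2}u_n^{1/2},\,-q^rt_n^{1/2}u_n^{-1/2}\}$, if $m_\alpha>0$, for $1\le r\le\frac{m_\alpha}2-\epsilon_\alpha(w)$; - $p\in\{q^{r+\frac12}t_0^{1/2}u_0^{1/2},\,-q^{r+\frac12}t_0^{1/2}u_0^{-1/2}\}$, if $m_\alpha>0$, for $0\le r\le\frac{m_\alpha}2-1$. (Here $r$ ranges over integers.)
   Formalization: In conditions 1–3, h_{w,μ} is taken to be the coefficient of D_{q,-μ}[w] instead of D_{q,μ}[w]; with the stated sign of D_{q,μ} condition 2 is inconsistent and the subspace is not closed under multiplication (already for n=1). *)

(* Defs.v *)
From HB Require Import structures.
From mathcomp Require Import all_boot all_order all_algebra.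
From mathcomp Require Import fingroup perm generic_quotient finmap monalg boolp.
From mathcomp Require Import zify.

Set Implicit Arguments.
Unset Strict Implicit.
Unset Printing Implicit Defensive.

Import Order.TTheory GRing.Theory Num.Theory.

Local Open Scope fset_scope.
Local Open Scope ring_scope.

(* A left action of a monoid on a ring by ring endomorphisms.                 *)
Record ring_action (A : nzRingType) (G : monoidType) := RingAction {
  ract :> G -> {rmorphism A -> A};
  ract1 : forall a, ract 1%g a = a;
  ractM : forall g h a, ract (g * h)%g a = ract g (ract h a)
}.

(* The skew monoid ring A * G: finite sums \sum_g a_g [g], multiplied by      *)
(* (a [g]) (b [h]) = a (g . b) [g h].                                         *)
Definition skew (A : nzRingType) (G : monoidType) (s : ring_action A G) :=
  {malg A[G]}.

Section SkewRing.
Variables (A : nzRingType) (G : monoidType) (s : ring_action A G).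
Implicit Types (x y z : {malg A[G]}) (g h : G) (a b : A).

HB.instance Definition _ := GRing.Zmodule.on (skew s).

Definition skew_one : {malg A[G]} := << 1 *g 1%g >>.

Definition skew_mul_def x y : {malg A[G]} :=
  \sum_(g <- msupp x) \sum_(h <- msupp y) << x@_g * s g y@_h *g (g * h)%g >>.
Fact skew_mul_key : unit. Proof. exact: tt. Qed.
Definition skew_mul := locked_with skew_mul_key skew_mul_def.
Lemma skew_mulE x y : skew_mul x y =
  \sum_(g <- msupp x) \sum_(h <- msupp y) << x@_g * s g y@_h *g (g * h)%g >>.
Proof. by rewrite /skew_mul unlock. Qed.

Lemma skew_mulw (d1 d2 : {fset G}) x y :
  msupp x `<=` d1 -> msupp y `<=` d2 ->
  skew_mul x y =
  \sum_(g <- d1) \sum_(h <- d2) << x@_g * s g y@_h *g (g * h)%g >>.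
Proof.
move=> le_d1 le_d2; rewrite skew_mulE (big_fset_incl _ le_d1) /=.
  apply/eq_bigr=> k1 _; apply/big_fset_incl => // k _ /mcoeff_outdom ->.
  by rewrite rmorph0 mulr0 monalgU0.
move=> k _ /mcoeff_outdom g1k.
by rewrite big1 => // k' _; rewrite g1k mul0r monalgU0.
Qed.

Lemma mcoeff_skew_mul x y k :
  (skew_mul x y)@_k = \sum_(g <- msupp x) \sum_(h <- msupp y)
    (x@_g * s g y@_h) *+ ((g * h)%g == k).
Proof.
rewrite skew_mulE raddf_sum; apply: eq_bigr => g _.
by rewrite raddf_sum; apply: eq_bigr => h _; rewrite /= mcoeffU.
Qed.

Lemma skew_mulUU a b g h :
  skew_mul << a *g g >> << b *g h >> = << a * s g b *g (g * h)%g >>.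
Proof. by rewrite (skew_mulw msuppU_le msuppU_le) !big_seq_fset1 !mcoeffUU. Qed.

Lemma skew_mulDl : left_distributive skew_mul +%R.
Proof.
move=> g1 g2 g.
rewrite (skew_mulw (msuppD_le g1 g2) (fsubset_refl _)).
rewrite (skew_mulw (fsubsetUl (msupp g1) (msupp g2)) (fsubset_refl _)).
rewrite (skew_mulw (fsubsetUr (msupp g1) (msupp g2)) (fsubset_refl _)).
rewrite -big_split /=; apply/eq_bigr=> k1 _.
rewrite -big_split /=; apply/eq_bigr=> k2 _.
by rewrite mcoeffD mulrDl monalgUD.
Qed.

Lemma skew_mulDr : right_distributive skew_mul +%R.
Proof.
move=> g g1 g2.
rewrite (skew_mulw (fsubset_refl _) (msuppD_le g1 g2)).
rewrite (skew_mulw (fsubset_refl _) (fsubsetUl (msupp g1) (msupp g2))).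
rewrite (skew_mulw (fsubset_refl _) (fsubsetUr (msupp g1) (msupp g2))).
rewrite -big_split /=; apply/eq_bigr=> k1 _.
rewrite -big_split /=; apply/eq_bigr=> k2 _.
by rewrite mcoeffD rmorphD mulrDr monalgUD.
Qed.

Lemma skew_mul0l : left_zero 0 skew_mul.
Proof. by move=> g; rewrite skew_mulE msupp0 big_seq_fset0. Qed.

Lemma skew_mul0r : right_zero 0 skew_mul.
Proof.
by move=> g; rewrite skew_mulE big1 // => k _; rewrite msupp0 big_seq_fset0.
Qed.

Let mul_suml (I : Type) (r : seq I) (F : I -> {malg A[G]}) y :
  skew_mul (\sum_(i <- r) F i) y = \sum_(i <- r) skew_mul (F i) y.
Proof.
exact: (big_morph (skew_mul^~ y) (fun u v => skew_mulDl u v y) (skew_mul0l y)).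
Qed.

Let mul_sumr (I : Type) (r : seq I) (F : I -> {malg A[G]}) x :
  skew_mul x (\sum_(i <- r) F i) = \sum_(i <- r) skew_mul x (F i).
Proof.
exact: (big_morph (skew_mul x) (skew_mulDr x) (skew_mul0r x)).
Qed.

Lemma skew_mulA : associative skew_mul.
Proof.
move=> x y z; rewrite [x]monalgE !mul_suml; apply: eq_bigr => g _.
rewrite [y]monalgE !(mul_suml, mul_sumr); apply: eq_bigr => h _.
rewrite [z]monalgE !mul_sumr; apply: eq_bigr => k _.
by rewrite !skew_mulUU rmorphM ractM mulrA mulgA.
Qed.

Lemma skew_mul1l : left_id skew_one skew_mul.
Proof.
move=> x; rewrite [x in LHS]monalgE mul_sumr [RHS]monalgE.
by apply: eq_bigr => g _; rewrite skew_mulUU ract1 mul1r mul1g.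
Qed.

Lemma skew_mul1r : right_id skew_one skew_mul.
Proof.
move=> x; rewrite [x in LHS]monalgE mul_suml [RHS]monalgE.
by apply: eq_bigr => g _; rewrite skew_mulUU rmorph1 mulr1 mulg1.
Qed.

Lemma skew_one_neq0 : skew_one != 0.
Proof. by rewrite /skew_one monalgU_eq0 oner_eq0. Qed.

HB.instance Definition _ := GRing.Zmodule_isNzRing.Build (skew s)
  skew_mulA skew_mul1l skew_mul1r skew_mulDl skew_mulDr skew_one_neq0.

(* The element a [g]. *)
Definition smon a g : skew s := << a *g g >>.

Lemma smonM a b g h : smon a g * smon b h = smon (a * s g b) (g * h)%g.
Proof. exact: skew_mulUU. Qed.

Lemma smon0 g : smon 0 g = 0. Proof. exact: monalgU0. Qed.
Lemma smonD g : {morph smon^~ g : a b / a + b}.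
Proof. by move=> a b; exact: monalgUD. Qed.

Lemma skewE (x : skew s) : x = \sum_(g <- msupp x) smon x@_g g.
Proof. exact: monalgE. Qed.

Lemma skewEw (x : skew s) (d : {fset G}) :
  msupp x `<=` d -> x = \sum_(g <- d) smon x@_g g.
Proof. exact: monalgEw. Qed.

Lemma smon_scale a (x : skew s) : smon a 1%g * x = (a *: (x : {malg A[G]})).
Proof.
rewrite [x]skewE mulr_sumr [RHS]scaler_sumr; apply: eq_bigr => g _.
rewrite smonM ract1 mul1g; apply/malgP => h.
by rewrite mcoeffZ !mcoeffU mulrnAr.
Qed.

Lemma smon_central a (x : skew s) :
  (forall g, s g a = a) -> (forall b, a * b = b * a) ->
  x * smon a 1%g = smon a 1%g * x.
Proof.
move=> sa aC; rewrite [x]skewE mulr_suml mulr_sumr; apply: eq_bigr => g _.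
by rewrite !smonM sa ract1 mul1g mulg1 aC.
Qed.

End SkewRing.

Section SkewCommutative.
Variables (A : comNzRingType) (G : monoidType) (s : ring_action A G).
Hypothesis mulGC : forall g h : G, (g * h = h * g)%g.
Hypothesis s_triv : forall g a, s g a = a.

Lemma skew_mulC : commutative (@skew_mul A G s).
Proof.
suff mulC (x y : skew s) : x * y = y * x by exact: mulC.
rewrite [x]skewE [y]skewE mulr_suml mulr_sumr.
apply: eq_bigr => g _; rewrite mulr_suml mulr_sumr; apply: eq_bigr => h _.
by rewrite !smonM !s_triv mulrC mulGC.
Qed.
End SkewCommutative.

(* Additive maps out of a skew monoid ring. *)
Section SkewSum.
Variables (A : nzRingType) (G : monoidType) (s : ring_action A G).
Variables (V : zmodType) (F : G -> {additive A -> V}).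

Definition skew_sum_def (x : skew s) : V := \sum_(g <- msupp x) F g x@_g.
Fact skew_sum_key : unit. Proof. exact: tt. Qed.
Definition skew_sum := locked_with skew_sum_key skew_sum_def.
Lemma skew_sumE (x : skew s) : skew_sum x = \sum_(g <- msupp x) F g x@_g.
Proof. by rewrite /skew_sum unlock. Qed.

Lemma skew_sumw (x : skew s) (d : {fset G}) :
  msupp x `<=` d -> skew_sum x = \sum_(g <- d) F g x@_g.
Proof.
move=> le_d; rewrite skew_sumE; apply: big_fset_incl => // g _.
by move=> /mcoeff_outdom ->; rewrite raddf0.
Qed.

Lemma skew_sum_additive : zmod_morphism skew_sum.
Proof.
move=> x y.
rewrite (skew_sumw (msuppB_le x y)).
rewrite (skew_sumw (fsubsetUl (msupp x) (msupp y))).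
rewrite (skew_sumw (fsubsetUr (msupp x) (msupp y))).
rewrite -sumrB; apply: eq_bigr => g _.
by rewrite mcoeffB raddfB.
Qed.

HB.instance Definition _ :=
  GRing.isZmodMorphism.Build (skew s) V skew_sum skew_sum_additive.

Lemma skew_sumU a g : skew_sum (smon s a g) = F g a.
Proof.
by rewrite (@skew_sumw _ [fset g]) ?msuppU_le // big_seq_fset1 mcoeffUU.
Qed.

End SkewSum.

Lemma skew_ext (A : nzRingType) (G : monoidType) (s : ring_action A G)
    (V : zmodType) (f1 f2 : {additive skew s -> V}) :
  (forall a g, f1 (smon s a g) = f2 (smon s a g)) -> f1 =1 f2.
Proof.
move=> e x; rewrite [x]skewE !raddf_sum.
by apply: eq_bigr => g _; exact: e.
Qed.

Section SkewSumRing.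
Variables (A : nzRingType) (G : monoidType) (s : ring_action A G).
Variables (B : nzRingType) (F : G -> {additive A -> B}).
Hypothesis F1 : F 1%g 1 = 1.
Hypothesis FM : forall g h a b, F (g * h)%g (a * s g b) = F g a * F h b.

Lemma skew_sum_multiplicative : monoid_morphism (@skew_sum A G s B F).
Proof.
split=> [|x y]; first by rewrite [1]/(smon s 1 1%g) skew_sumU.
rewrite [x]skewE mulr_suml !raddf_sum mulr_suml; apply: eq_bigr => g _ /=.
rewrite [y]skewE mulr_sumr !raddf_sum mulr_sumr; apply: eq_bigr => h _ /=.
by rewrite smonM !skew_sumU FM.
Qed.
End SkewSumRing.

(* Laurent polynomials *)
Definition lexp (n : nat) := 'rV[int]_n.

Section Lexp.
Variable n : nat.
HB.instance Definition _ := GRing.Lmodule.on (lexp n).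
Implicit Types u v : lexp n.
Let addNl : left_inverse (0 : lexp n) -%R +%R. Proof. exact: addNr. Qed.
Let addNR : right_inverse (0 : lexp n) -%R +%R. Proof. exact: addrN. Qed.
HB.instance Definition _ := isGroup.Build (lexp n)
  (@addrA _) (@add0r _) (@addr0 _) addNl addNR.
Lemma lexpM u v : (u * v)%g = u + v. Proof. by []. Qed.
Lemma lexpC u v : (u * v = v * u)%g. Proof. exact: addrC. Qed.
Lemma lexp1 : 1%g = 0 :> lexp n. Proof. by []. Qed.
End Lexp.

Definition trivial_action (A : nzRingType) (G : monoidType) : ring_action A G :=
  @RingAction A G (fun=> idfun) (fun=> erefl) (fun _ _ _ => erefl).

Definition laurent (R : nzRingType) (n : nat) :=
  skew (trivial_action R (lexp n)).

Section LaurentNz.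
Variables (R : nzRingType) (n : nat).
HB.instance Definition _ := GRing.NzRing.on (laurent R n).
Definition lmon (c : R) (v : lexp n) : laurent R n := smon _ c v.
End LaurentNz.

Section Laurent.
Variables (R : comNzRingType) (n : nat).

Lemma laurent_mulC : commutative (@GRing.mul (laurent R n)).
Proof.
exact: (@skew_mulC R (lexp n) (trivial_action R (lexp n)) (@lexpC n)
  (fun _ _ => erefl)).
Qed.

HB.instance Definition _ :=
  GRing.PzRing_hasCommutativeMul.Build (laurent R n) laurent_mulC.

Implicit Type x : laurent R n.
Definition lunit : {pred laurent R n} := fun x => `[< exists y, y * x = 1 >].
Definition linv x : laurent R n :=
  if pselect (exists y, y * x = 1) is left e then projT1 (cid e) else x.

Lemma lmulVx : {in lunit, left_inverse 1 linv *%R}.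
Proof.
move=> x /asboolP e; rewrite /linv; case: pselect => // e'.
by case: (cid e').
Qed.
Lemma lunitPl : forall x y, y * x = 1 -> lunit x.
Proof. by move=> x y yx; apply/asboolP; exists y. Qed.
Lemma linv_out : {in [predC lunit], linv =1 id}.
Proof.
by move=> x /asboolP e; rewrite /linv; case: pselect => // e'.
Qed.

HB.instance Definition _ :=
  GRing.ComNzRing_hasMulInverse.Build (laurent R n) lmulVx lunitPl linv_out.

Lemma lmonM (c d : R) (u v : lexp n) :
  lmon c u * lmon d v = lmon (c * d) (u + v).
Proof. exact: smonM. Qed.
Lemma lmon1 : lmon 1 (0 : lexp n) = 1 :> laurent R n. Proof. by []. Qed.
Lemma lmon_unit (v : lexp n) : lmon (1 : R) v \is a GRing.unit.
Proof.
by apply/unitrPr; exists (lmon 1 (- v)); rewrite lmonM mulr1 subrr.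
Qed.
End Laurent.

Lemma laurent_ext (R : nzRingType) n (V : zmodType)
    (f1 f2 : {additive laurent R n -> V}) :
  (forall c v, f1 (lmon c v) = f2 (lmon c v)) -> f1 =1 f2.
Proof. exact: skew_ext. Qed.

Section LaurentDomain.
Variables (R : idomainType) (n : nat).

(* exponent lattices have the unique product property *)
Lemma unique_sum (ls : seq 'I_n) (s t : seq (lexp n)) :
  s != [::] -> t != [::] ->
  exists u v, [/\ u \in s, v \in t & forall u' v', u' \in s -> v' \in t ->
    u' + v' = u + v -> forall l, l \in ls -> u' 0 l = u 0 l /\ v' 0 l = v 0 l].
Proof.
elim: ls s t => [|l ls IH] s t s0 t0.
  case: s s0 => // u s _; case: t t0 => // v t _.
  by exists u, v; rewrite !mem_head; split.
have maxP (r : seq (lexp n)) : r != [::] ->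
    exists2 m, m \in r & forall u, u \in r -> (u 0 l <= m 0 l)%R.
  elim: r => // a r IHr _; have [->|/IHr[m mr mP]] := eqVneq r [::].
    by exists a; rewrite ?mem_head // => u; rewrite inE => /eqP->.
  have [am|am] := leP (a 0 l) (m 0 l).
    exists m; rewrite ?inE ?mr ?orbT // => u; rewrite inE => /orP[/eqP->//|].
    exact: mP.
  exists a; rewrite ?mem_head // => u; rewrite inE => /orP[/eqP->//|/mP um].
  by apply: le_trans um _; apply: ltW.
have [m ms mP] := maxP _ s0; have [k kt kP] := maxP _ t0.
pose s' := [seq u : lexp n <- s | u 0 l == m 0 l].
pose t' := [seq u : lexp n <- t | u 0 l == k 0 l].
have s'0 : s' != [::].
  by apply/negP=> /eqP s'0; have := in_nil m; rewrite -s'0 mem_filter eqxx ms.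
have t'0 : t' != [::].
  by apply/negP=> /eqP t'0; have := in_nil k; rewrite -t'0 mem_filter eqxx kt.
have [u [v [us vt uvP]]] := IH _ _ s'0 t'0.
move: us vt; rewrite !mem_filter => /andP[/eqP ul us] /andP[/eqP vl vt].
exists u, v; split=> // u' v' u's v't e.
have /andP[/eqP e1 /eqP e2] : (u' 0 l == m 0 l) && (v' 0 l == k 0 l).
  have := congr1 (fun w : 'rV[int]_n => w 0 l) e; rewrite !mxE ul vl => el.
  have := mP _ u's; have := kP _ v't; move: el.
  move: (u' 0 l) (v' 0 l) (m 0 l) (k 0 l) => a b c d; clear; lia.
move=> l'; rewrite inE => /orP[/eqP->|]; first by rewrite e1 e2 ul vl.
by apply: uvP => //; rewrite mem_filter ?e1 ?e2 eqxx.
Qed.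

Lemma laurent_idomain : GRing.integral_domain_axiom (laurent R n).
Proof.
move=> x y xy0; apply/norP => -[x0 y0].
have sup0 (z : laurent R n) : z != 0 -> enum_fset (msupp z) != [::].
  apply: contraNN => /eqP e; apply/eqP/malgP => g; rewrite mcoeff0.
  by apply/eqP; rewrite mcoeff_eq0 -[_ \in _]/(g \in enum_fset _) e.
have [u [v [us vt uvP]]] := unique_sum (enum 'I_n) (sup0 _ x0) (sup0 _ y0).
have : (x * y : {malg R[lexp n]})@_(u + v) = x@_u * y@_v.
  rewrite [LHS]mcoeff_skew_mul (big_fsetD1 u) //= (big_fsetD1 v) //=.
  rewrite lexpM eqxx mulr1n !big1_fset ?addr0 // => [g|h]; last first.
    move=> hy _; case: eqP => // e; move: hy.
    rewrite in_fsetD1 => /andP[/eqP[]].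
    exact: (addrI u e).
  rewrite in_fsetD1 => /andP[gu gx] _; rewrite big1_fset // => h hy _.
  case: eqP => // e; case/eqP: gu.
  apply/rowP => i; have := uvP g h gx hy e i; rewrite mem_enum.
  by case.
rewrite xy0 mcoeff0 => /esym/eqP; rewrite mulf_eq0 !mcoeff_eq0.
by rewrite us vt.
Qed.

HB.instance Definition _ :=
  GRing.ComUnitRing_isIntegral.Build (laurent R n) laurent_idomain.
End LaurentDomain.

Definition baseF := laurent int 6.
HB.instance Definition _ := GRing.IntegralDomain.on baseF.

Definition param (i : nat) : baseF := lmon 1 (delta_mx 0 (inord i)).

Definition qh : baseF := param 0.
Definition th : baseF := param 1.
Definition t0h : baseF := param 2.
Definition tnh : baseF := param 3.
Definition u0h : baseF := param 4.
Definition unh : baseF := param 5.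
Definition q : baseF := qh ^+ 2.
Definition t : baseF := th ^+ 2.

Lemma param_unit i : param i \is a GRing.unit.
Proof. exact: lmon_unit. Qed.
Lemma q_unit : q \is a GRing.unit.
Proof. by rewrite unitrX // param_unit. Qed.

Lemma qexpD (a b : int) : q ^ (a + b) = q ^ a * q ^ b.
Proof. by rewrite exprzDr ?q_unit. Qed.

Definition dot n (u v : lexp n) : int := \sum_i u 0 i * v 0 i.

Definition eps n (i : 'I_n) : lexp n := delta_mx 0 i.

Section Dot.
Variable n : nat.
Implicit Types u v w : lexp n.
Lemma dotC u v : dot u v = dot v u.
Proof. by apply: eq_bigr => i _; rewrite mulrC. Qed.
Lemma dotDr u v w : dot u (v + w) = dot u v + dot u w.
Proof. by rewrite -big_split; apply: eq_bigr => i _; rewrite mxE mulrDr. Qed.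
Lemma dotNr u v : dot u (- v) = - dot u v.
Proof. by rewrite -sumrN; apply: eq_bigr => i _; rewrite mxE mulrN. Qed.
Lemma dotDl u v w : dot (u + v) w = dot u w + dot v w.
Proof. by rewrite dotC dotDr !(dotC w). Qed.
Lemma dot0r u : dot u 0 = 0.
Proof. by rewrite /dot big1 // => i _; rewrite mxE mulr0. Qed.
Lemma dot0l u : dot 0 u = 0. Proof. by rewrite dotC dot0r. Qed.
Lemma dot_eps u i : dot u (eps i) = u 0 i.
Proof.
rewrite /dot (bigD1 i) //= mxE !eqxx mulr1 big1 ?addr0 // => j /negbTE ji.
by rewrite mxE ji andbF mulr0.
Qed.
End Dot.

(* The signed permutation (s, a) maps eps_i to (-1)^(a i) eps_(s i). *)
Definition signed_perm (n : nat) := ('S_n * {ffun 'I_n -> bool})%type.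

Section SignedPerm.
Variable n : nat.
HB.instance Definition _ := Finite.on (signed_perm n).
Implicit Types w v : signed_perm n.

Definition wone : signed_perm n := (1%g, [ffun=> false]).
Definition wmul w v : signed_perm n :=
  ((v.1 * w.1)%g, [ffun i => v.2 i (+) w.2 (v.1 i)]).
Definition winv w : signed_perm n := ((w.1)^-1%g, [ffun i => w.2 ((w.1)^-1%g i)]).

Lemma wmulA : associative wmul.
Proof.
move=> u v w; congr pair; rewrite /=; first by rewrite mulgA.
by apply/ffunP => i; rewrite !ffunE /= permM addbA.
Qed.
Lemma wmul1g : left_id wone wmul.
Proof.
case=> s a; congr pair; rewrite /= ?mulg1 //.
by apply/ffunP => i; rewrite !ffunE addbF.
Qed.
Lemma wmulg1 : right_id wone wmul.
Proof.
case=> s a; congr pair; rewrite /= ?mul1g //.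
by apply/ffunP => i; rewrite !ffunE perm1.
Qed.
Lemma wmulVg : left_inverse wone winv wmul.
Proof.
case=> s a; congr pair; rewrite /= ?mulgV //.
by apply/ffunP => i; rewrite !ffunE permK addbb.
Qed.
Lemma wmulgV : right_inverse wone winv wmul.
Proof.
case=> s a; congr pair; rewrite /= ?mulVg //.
by apply/ffunP => i; rewrite !ffunE addbb.
Qed.
HB.instance Definition _ := isGroup.Build (signed_perm n)
  wmulA wmul1g wmulg1 wmulVg wmulgV.

Definition wact w (u : lexp n) : lexp n :=
  \row_j ((-1) ^+ (w.2 ((w.1)^-1%g j)) * u 0 ((w.1)^-1%g j)).

Lemma wact_eps w i : wact w (eps i) = (-1) ^+ (w.2 i) *: eps (w.1 i).
Proof.
apply/rowP => j; rewrite !mxE !eqxx /=.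
have [->|ji] := eqVneq j (w.1 i); first by rewrite permK eqxx.
have [e|] := eqVneq; last by rewrite !mulr0.
by rewrite -e permKV eqxx in ji.
Qed.

Lemma wact1 u : wact 1%g u = u.
Proof. by apply/rowP => j; rewrite !mxE ffunE mul1r invg1 perm1. Qed.

Lemma wactM w v u : wact (w * v)%g u = wact w (wact v u).
Proof.
apply/rowP => j; rewrite !mxE /= !ffunE invMg permM permKV.
by rewrite signr_addb [_ * (-1) ^+ w.2 _]mulrC mulrA.
Qed.

Lemma wactD w (u u' : lexp n) : wact w (u + u') = wact w u + wact w u'.
Proof. by apply/rowP => j; rewrite !mxE mulrDr. Qed.
Lemma wact0 w : wact w 0 = 0.
Proof. by apply/rowP => j; rewrite !mxE mulr0. Qed.
Lemma wactN w (u : lexp n) : wact w (- u) = - wact w u.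
Proof. by apply/rowP => j; rewrite !mxE mulrN. Qed.
Lemma wactK w : cancel (wact w) (wact w^-1%g).
Proof. by move=> u; rewrite -wactM mulVg wact1. Qed.

Lemma dot_wact w (u u' : lexp n) : dot (wact w u) (wact w u') = dot u u'.
Proof.
rewrite /dot (reindex_perm w.1) /=; apply: eq_bigr => i _.
by rewrite !mxE permK mulrACA -expr2 sqrr_sign mul1r.
Qed.
End SignedPerm.

(* The pair (mu, w) stands for D_{q,mu} [w]. *)
Definition shift_refl (n : nat) := (lexp n * signed_perm n)%type.

Section ShiftRefl.
Variable n : nat.
HB.instance Definition _ := Choice.on (shift_refl n).
Implicit Types g h : shift_refl n.

Definition srone : shift_refl n := (0, 1%g).
Definition srmul g h : shift_refl n := (g.1 + wact g.2 h.1, (g.2 * h.2)%g).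
Definition srinv g : shift_refl n := (- wact (g.2)^-1%g g.1, (g.2)^-1%g).

Lemma srmulA : associative srmul.
Proof. by move=> g h k; rewrite /srmul /= wactD wactM addrA mulgA. Qed.
Lemma srmul1g : left_id srone srmul.
Proof. by case=> u w; rewrite /srmul /= wact1 add0r mul1g. Qed.
Lemma srmulg1 : right_id srone srmul.
Proof. by case=> u w; rewrite /srmul /= wact0 addr0 mulg1. Qed.
Lemma srmulVg : left_inverse srone srinv srmul.
Proof. by case=> u w; rewrite /srmul /= addNr mulVg. Qed.
Lemma srmulgV : right_inverse srone srinv srmul.
Proof.
by case=> u w; rewrite /srmul /= wactN -wactM mulgV wact1 subrr.
Qed.
HB.instance Definition _ := isGroup.Build (shift_refl n)
  srmulA srmul1g srmulg1 srmulVg srmulgV.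
End ShiftRefl.

Definition FT (n : nat) := laurent baseF n.
HB.instance Definition _ n := GRing.IntegralDomain.on (FT n).

(* e^(lambda + k delta) *)
Definition eaff n (lam : lexp n) (k : int) : FT n := lmon (q ^ k) lam.

Definition cst n (c : baseF) : FT n := lmon c 0.

Section ActFT.
Variable n : nat.
Implicit Types g h : shift_refl n.

Definition sr_mon g (lam : lexp n) (c : baseF) : FT n :=
  lmon (c * q ^ dot g.1 (wact g.2 lam)) (wact g.2 lam).

Lemma sr_mon_additive g lam : zmod_morphism (sr_mon g lam).
Proof.
move=> c d; rewrite /sr_mon mulrBl /lmon /smon; exact: monalgUB.
Qed.
HB.instance Definition _ g lam :=
  GRing.isZmodMorphism.Build baseF (FT n) (sr_mon g lam) (sr_mon_additive g lam).

Definition sr_act g : FT n -> FT n :=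
  @skew_sum baseF (lexp n) _ (FT n) (fun lam => sr_mon g lam : {additive baseF -> FT n}).

HB.instance Definition _ g := GRing.Additive.on (sr_act g).

Lemma sr_act_multiplicative g : monoid_morphism (sr_act g).
Proof.
apply: skew_sum_multiplicative => [|lam mu c d] /=.
  by rewrite /sr_mon lexp1 wact0 dot0r mulr1.
rewrite /sr_mon lmonM.
rewrite lexpM.
rewrite wactD dotDr.
rewrite qexpD.
rewrite mulrACA.
by [].
Qed.
HB.instance Definition _ g :=
  GRing.isMonoidMorphism.Build (FT n) (FT n) (sr_act g) (sr_act_multiplicative g).

Lemma sr_actU g c lam : sr_act g (lmon c lam) =
  lmon (c * q ^ dot g.1 (wact g.2 lam)) (wact g.2 lam).
Proof. exact: skew_sumU. Qed.

Lemma sr_act1 x : sr_act 1%g x = x.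
Proof.
apply: (@laurent_ext baseF n (FT n) (sr_act 1%g) idfun) => c lam.
by rewrite /= sr_actU wact1 dot0l mulr1.
Qed.

Lemma sr_actM g h x : sr_act (g * h)%g x = sr_act g (sr_act h x).
Proof.
apply: (@laurent_ext baseF n (FT n) (sr_act (g * h)%g) (sr_act g \o sr_act h)).
move=> c lam; rewrite /= !sr_actU wactM -mulrA -qexpD.
by rewrite [in RHS]addrC dotDl dot_wact.
Qed.

Lemma sr_actK g : cancel (sr_act g) (sr_act g^-1%g).
Proof. by move=> x; rewrite -(sr_actM g^-1%g g x) mulVg sr_act1. Qed.

Lemma sr_act_inj g : injective (sr_act g).
Proof. exact: can_inj (sr_actK g). Qed.

Lemma sr_act_cst g c : sr_act g (cst n c) = cst n c.
Proof. by rewrite sr_actU wact0 dot0r mulr1. Qed.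

Lemma sr_act_eaff g lam k :
  sr_act g (eaff lam k) = eaff (wact g.2 lam) (k + dot g.1 (wact g.2 lam)).
Proof. by rewrite sr_actU -qexpD. Qed.
End ActFT.

Notation tofrac := (@FracField.tofrac _).

Section FracMap.
Variables (R S : idomainType) (f : {rmorphism R -> S}).
Hypothesis f_inj : injective f.

Lemma frac_numden (x : {fraction R}) :
  x = tofrac (generic_quotient.repr x).1 / tofrac (generic_quotient.repr x).2.
Proof.
apply: (canRL (mulfK _)); first by rewrite tofrac_eq0 denom_ratioP.
unlock FracField.tofrac; rewrite -[X in X * _]generic_quotient.reprK.
rewrite -[LHS]FracField.pi_mul; apply/generic_quotient.eqmodP => /=.
rewrite FracField.equivfE /FracField.mulf.
rewrite !numden_Ratio ?mulr1 ?oner_eq0 ?denom_ratioP //=.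
by rewrite mulrC.
Qed.

Definition frac_map_def (x : {fraction R}) : {fraction S} :=
  tofrac (f (generic_quotient.repr x).1) / tofrac (f (generic_quotient.repr x).2).
Fact frac_map_key : unit. Proof. exact: tt. Qed.
Definition frac_map := locked_with frac_map_key frac_map_def.

Let f0 b : (f b == 0) = (b == 0).
Proof. by apply/eqP/eqP => [|->]; rewrite ?rmorph0 // -(rmorph0 f) => /f_inj. Qed.

Lemma frac_map_div (a b : R) : b != 0 ->
  frac_map (tofrac a / tofrac b) = tofrac (f a) / tofrac (f b).
Proof.
move=> b0; rewrite /frac_map unlock /frac_map_def.
set x := (X in generic_quotient.repr X).
have d0 : (generic_quotient.repr x).2 != 0 by exact: denom_ratioP.
have /eqP := frac_numden x; rewrite {1}/x eqr_div ?tofrac_eq0 //.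
rewrite -!tofracM tofrac_eq => /eqP e.
apply/eqP; rewrite eqr_div ?tofrac_eq0 ?f0 // -!tofracM tofrac_eq -!rmorphM.
by apply/eqP; congr (f _); rewrite [in LHS]mulrC -[LHS]mulrC e.
Qed.

Lemma frac_mapE (a : R) : frac_map (tofrac a) = tofrac (f a).
Proof.
have := @frac_map_div a 1 (oner_neq0 _).
by rewrite rmorph1 !tofrac1 !divr1.
Qed.

Lemma fracP (x : {fraction R}) : exists a b, b != 0 /\ x = tofrac a / tofrac b.
Proof.
by exists (generic_quotient.repr x).1, (generic_quotient.repr x).2; split; [exact: denom_ratioP|exact: frac_numden].
Qed.

Lemma frac_map_zmod : zmod_morphism frac_map.
Proof.
move=> x y; have [a [b [b0 ->]]] := fracP x; have [c [d [d0 ->]]] := fracP y.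
rewrite -mulNr -tofracN addf_div ?tofrac_eq0 // -!tofracM -tofracD.
rewrite !frac_map_div ?mulf_neq0 // -mulNr -tofracN addf_div ?tofrac_eq0 ?f0 //.
by rewrite -!tofracM -tofracD rmorphD !rmorphM rmorphN.
Qed.

Lemma frac_map_monoid : monoid_morphism frac_map.
Proof.
split=> [|x y]; first by rewrite -tofrac1 frac_mapE rmorph1 tofrac1.
have [a [b [b0 ->]]] := fracP x; have [c [d [d0 ->]]] := fracP y.
rewrite mulf_div -!tofracM !frac_map_div ?mulf_neq0 // mulf_div -!tofracM.
by rewrite !rmorphM.
Qed.
End FracMap.

Section Roots.
Variable n : nat.
Implicit Types (a : lexp n) (w : signed_perm n).

Definition posroot a : bool :=
  [exists i : 'I_n, exists j : 'I_n, (i < j)%N && ((a == eps i - eps j) || (a == eps i + eps j))]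
  || [exists i, a == eps i *+ 2].

Definition negroot a : bool := posroot (- a).

Definition isroot a : bool := posroot a || negroot a.

Lemma root_short (i j : 'I_n) (b c : bool) : i != j ->
  isroot ((-1) ^+ b *: eps i + (-1) ^+ c *: eps j).
Proof.
wlog ij : i j b c / (i < j)%N.
  move=> H ne; case: (ltngtP i j) => [ij|ji|/val_inj ij].
  - exact: H.
  - by rewrite addrC; apply: H; rewrite // eq_sym.
  - by rewrite ij eqxx in ne.
move=> _; rewrite /isroot /negroot /posroot; apply/orP.
case: b; case: c; rewrite /= ?expr0 ?expr1 ?scale1r ?scaleN1r ?opprD ?opprK;
 [right|right|left|left]; apply/orP; left; apply/existsP; exists i;
 by apply/existsP; exists j; rewrite ij eqxx ?orbT.
Qed.

Lemma root_long (i : 'I_n) (b : bool) : isroot ((-1) ^+ b *: (eps i *+ 2)).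
Proof.
rewrite /isroot /negroot /posroot; apply/orP.
by case: b; rewrite /= ?expr0 ?expr1 ?scale1r ?scaleN1r ?opprK; [right|left];
  apply/orP; right; apply/existsP; exists i.
Qed.

Lemma rootN a : isroot (- a) = isroot a.
Proof. by rewrite /isroot /negroot opprK orbC. Qed.

Variant root_spec : lexp n -> Prop :=
| RootShort (i j : 'I_n) (b c : bool) of i != j : root_spec ((-1) ^+ b *: eps i + (-1) ^+ c *: eps j)
| RootLong (i : 'I_n) (b : bool) : root_spec ((-1) ^+ b *: (eps i *+ 2)).

Lemma rootP a : isroot a -> root_spec a.
Proof.
have pos (c : bool) a' : posroot a' -> root_spec ((-1) ^+ c *: a').
  case/orP=> [/existsP[i /existsP[j /andP[ij ea]]]|/existsP[i /eqP->]]; last first.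
    exact: RootLong.
  have ne : i != j by rewrite neq_ltn ij.
  case/orP: ea => /eqP ->; rewrite scalerDr.
    by rewrite scalerN -scaleNr -signrN; apply: RootShort.
  exact: RootShort.
case/orP=> [/(pos false)|/(pos true)]; first by rewrite scale1r.
by rewrite expr1 scaleN1r opprK.
Qed.

Lemma wactZ w (c : int) a : wact w (c *: a) = c *: wact w a.
Proof. by apply/rowP => j; rewrite !mxE mulrCA. Qed.

Lemma sgnZ (b c : bool) a : (-1) ^+ b *: ((-1) ^+ c *: a) = (-1) ^+ (b (+) c) *: a.
Proof.
by case: b; case: c; rewrite /= ?expr0 ?expr1 ?scale1r ?scaleN1r ?opprK.
Qed.

Lemma root_wact w a : isroot a -> isroot (wact w a).
Proof.
case/rootP => [i j b c ij|i b]; rewrite ?wactZ.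
  rewrite wactD 2!wactZ !wact_eps. rewrite !sgnZ; apply: root_short.
  by rewrite (inj_eq perm_inj).
have -> : wact w (eps i *+ 2) = (-1) ^+ w.2 i *: (eps (w.1 i) *+ 2).
  by rewrite [eps i *+ 2]mulr2n wactD wact_eps -scalerDr -mulr2n.
by rewrite sgnZ root_long.
Qed.

Lemma root_neq0 a : isroot a -> a != 0.
Proof.
case/rootP => [i j b c ij|i b]; apply/eqP => /rowP/(_ i); rewrite !mxE !eqxx.
  by rewrite /= (negbTE ij) mulr0 addr0 mulr1; case: b.
by case: b.
Qed.

End Roots.

Definition FTfrac n := {fraction FT n}.
HB.instance Definition _ n := GRing.Field.on (FTfrac n).

Section Loc.
Variable n : nat.
Implicit Types (s : seq (lexp n * int)).

Definition aroots s : bool := all (fun a => isroot a.1) s.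
Definition den s : FT n := \prod_(a <- s) (1 - eaff a.1 a.2).

Lemma one_eaff_neq0 (a : lexp n) k : a != 0 -> 1 - eaff a k != 0.
Proof.
move=> a0; rewrite subr_eq0; apply/eqP => e.
have := congr1 (fun f : {malg baseF[lexp n]} => f@_(0 : lexp n)) e.
rewrite mcoeffUU mcoeffU (negbTE a0) mulr0n => /eqP.
by rewrite oner_eq0.
Qed.

Lemma den_neq0 s : aroots s -> den s != 0.
Proof.
elim: s => [|a s IH] /=; first by rewrite /den big_nil oner_neq0.
case/andP => ra /IH ds; rewrite /den big_cons mulf_neq0 //.
exact/one_eaff_neq0/root_neq0.
Qed.

Lemma den_cat s s' : den (s ++ s') = den s * den s'.
Proof. by rewrite /den big_cat. Qed.

Definition in_loc : {pred FTfrac n} := fun x =>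
  `[< exists (f : FT n) s, aroots s /\ x = tofrac f / tofrac (den s) >].

Lemma in_loc_subring : subring_closed in_loc.
Proof.
split=> [|x y|x y].
- apply/asboolP; exists 1, [::]; split=> //.
  by rewrite /den big_nil tofrac1 divr1.
- move=> /asboolP[f [s [rs ->]]] /asboolP[g [s' [rs' ->]]]; apply/asboolP.
  exists (f * den s' - g * den s), (s ++ s'); split.
    by rewrite /aroots all_cat -/(aroots s) rs.
  rewrite -mulNr -tofracN addf_div ?tofrac_eq0 ?den_neq0 // -!tofracM.
  by rewrite -tofracD mulNr den_cat.
- move=> /asboolP[f [s [rs ->]]] /asboolP[g [s' [rs' ->]]]; apply/asboolP.
  exists (f * g), (s ++ s'); split.
    by rewrite /aroots all_cat -/(aroots s) rs.
  by rewrite mulf_div -!tofracM den_cat.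
Qed.

HB.instance Definition _ :=
  GRing.isSubringClosed.Build (FTfrac n) in_loc in_loc_subring.

Record floc : predArgType := Floc { floc_val :> FTfrac n; _ : floc_val \in in_loc }.
HB.instance Definition _ := [isSub for floc_val].
HB.instance Definition _ := [Choice of floc by <:].
HB.instance Definition _ := [SubChoice_isSubComNzRing of floc by <:].

Definition sr_K (g : shift_refl n) : FTfrac n -> FTfrac n := frac_map (sr_act g).
HB.instance Definition _ g := GRing.isZmodMorphism.Build (FTfrac n) (FTfrac n) (sr_K g)
  (frac_map_zmod (@sr_act_inj n g)).
HB.instance Definition _ g := GRing.isMonoidMorphism.Build (FTfrac n) (FTfrac n) (sr_K g)
  (frac_map_monoid (@sr_act_inj n g)).

Lemma sr_K_div g (a b : FT n) : b != 0 ->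
  sr_K g (tofrac a / tofrac b) = tofrac (sr_act g a) / tofrac (sr_act g b).
Proof. exact: (frac_map_div (@sr_act_inj n g)). Qed.

Lemma sr_KE g (a : FT n) : sr_K g (tofrac a) = tofrac (sr_act g a).
Proof. exact: (frac_mapE (@sr_act_inj n g)). Qed.

Lemma sr_act_neq0 g (b : FT n) : b != 0 -> sr_act g b != 0.
Proof.
by apply: contra_neq => e; apply: (@sr_act_inj n g); rewrite e rmorph0.
Qed.

Lemma sr_K1 x : sr_K 1%g x = x.
Proof. by have [a [b [b0 ->]]] := fracP x; rewrite sr_K_div // !sr_act1. Qed.

Lemma sr_KM g h x : sr_K (g * h)%g x = sr_K g (sr_K h x).
Proof.
have [a [b [b0 ->]]] := fracP x.
by rewrite !sr_K_div ?sr_act_neq0 // !sr_actM.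
Qed.

Lemma sr_act_den g s :
  sr_act g (den s) = den [seq (wact g.2 a.1, a.2 + dot g.1 (wact g.2 a.1)) | a <- s].
Proof.
rewrite /den big_map rmorph_prod; apply: eq_bigr => a _.
by rewrite rmorphB rmorph1 /= sr_act_eaff.
Qed.

Lemma sr_K_loc g x : x \in in_loc -> sr_K g x \in in_loc.
Proof.
case/asboolP => f [s [rs ->]]; apply/asboolP.
rewrite sr_K_div ?den_neq0 // sr_act_den.
eexists _, _; split; last by [].
by rewrite /aroots all_map; apply: sub_all rs => a; exact: root_wact.
Qed.

Definition sr_loc g (x : floc) : floc := Floc (sr_K_loc g (valP x)).

Lemma sr_loc_zmod g : zmod_morphism (sr_loc g).
Proof. by move=> x y; apply: val_inj; rewrite /= !rmorphB. Qed.
Lemma sr_loc_monoid g : monoid_morphism (sr_loc g).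
Proof.
split=> [|x y]; apply: val_inj; rewrite /=; [exact: rmorph1 | exact: rmorphM].
Qed.
HB.instance Definition _ g := GRing.isZmodMorphism.Build floc floc (sr_loc g)
  (sr_loc_zmod g).
HB.instance Definition _ g := GRing.isMonoidMorphism.Build floc floc (sr_loc g)
  (sr_loc_monoid g).

Lemma sr_loc1 x : sr_loc 1%g x = x.
Proof. by apply: val_inj; exact: sr_K1. Qed.
Lemma sr_locM g h x : sr_loc (g * h)%g x = sr_loc g (sr_loc h x).
Proof. by apply: val_inj; exact: sr_KM. Qed.

Definition sr_action : ring_action floc (shift_refl n) :=
  @RingAction floc (shift_refl n) (fun g => sr_loc g) sr_loc1 sr_locM.

Lemma tofrac_loc (f : FT n) : tofrac f \in in_loc.
Proof.
apply/asboolP; exists f, [::]; split=> //.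
by rewrite /den big_nil tofrac1 divr1.
Qed.
Definition toloc (f : FT n) : floc := Floc (tofrac_loc f).

Lemma toloc_zmod : zmod_morphism toloc.
Proof. by move=> x y; apply: val_inj; exact: rmorphB. Qed.
Lemma toloc_monoid : monoid_morphism toloc.
Proof.
split=> [|x y]; apply: val_inj; [exact: rmorph1 | exact: rmorphM].
Qed.
HB.instance Definition _ := GRing.isZmodMorphism.Build (FT n) floc toloc toloc_zmod.
HB.instance Definition _ :=
  GRing.isMonoidMorphism.Build (FT n) floc toloc toloc_monoid.

Lemma cst_zmod : zmod_morphism (@cst n).
Proof. by move=> x y; exact: monalgUB. Qed.
Lemma cst_monoid : monoid_morphism (@cst n).
Proof. by split=> [|x y] //; rewrite /cst lmonM addr0. Qed.
HB.instance Definition _ := GRing.isZmodMorphism.Build baseF (FT n) (@cst n) cst_zmod.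
HB.instance Definition _ :=
  GRing.isMonoidMorphism.Build baseF (FT n) (@cst n) cst_monoid.

Definition cloc (c : baseF) : floc := toloc (cst n c).
Lemma cloc1 : cloc 1 = 1.
Proof. by rewrite /cloc !rmorph1. Qed.
Lemma clocM c d : cloc (c * d) = cloc c * cloc d.
Proof. by rewrite /cloc 2!rmorphM. Qed.
Lemma clocD c d : cloc (c + d) = cloc c + cloc d.
Proof. by rewrite /cloc 2!rmorphD. Qed.

Lemma sr_loc_cst g c : sr_loc g (cloc c) = cloc c.
Proof. by apply: val_inj; rewrite /= sr_KE sr_act_cst. Qed.
End Loc.

Definition DqW n := skew (sr_action n).

Section DqW.
Variable n : nat.
HB.instance Definition _ := GRing.NzRing.on (DqW n).
Implicit Types (x y : DqW n) (c d : baseF).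

Definition dq_scale c x : DqW n :=
  cloc n c *: (x : {malg floc n[shift_refl n]}).

Lemma dq_scaleA c d x : dq_scale c (dq_scale d x) = dq_scale (c * d) x.
Proof. by apply: etrans (scalerA _ _ _) _; rewrite -clocM. Qed.
Lemma dq_scale1 : left_id 1 dq_scale.
Proof. by move=> x; rewrite /dq_scale cloc1; exact: scale1r. Qed.
Lemma dq_scaleDr : right_distributive dq_scale +%R.
Proof. by move=> c x y; exact: scalerDr. Qed.
Lemma dq_scaleDl x : {morph dq_scale^~ x : c d / c + d}.
Proof. by move=> c d; rewrite /dq_scale clocD; exact: scalerDl. Qed.

HB.instance Definition _ := GRing.Zmodule_isLmodule.Build baseF (DqW n)
  dq_scaleA dq_scale1 dq_scaleDr dq_scaleDl.

Lemma dq_scaleE c x : c *: x = smon (sr_action n) (cloc n c) 1%g * x.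
Proof. by rewrite smon_scale. Qed.

Lemma dq_scaleAl c x y : c *: (x * y) = (c *: x) * y.
Proof. by rewrite !dq_scaleE mulrA. Qed.

Lemma dq_scaleAr c x y : c *: (x * y) = x * (c *: y).
Proof.
rewrite !dq_scaleE !mulrA; congr (_ * y); apply/esym/smon_central.
  by move=> g; exact: sr_loc_cst.
by move=> b; exact: mulrC.
Qed.

HB.instance Definition _ := GRing.Lmodule_isLalgebra.Build baseF (DqW n) dq_scaleAl.
HB.instance Definition _ := GRing.Lalgebra_isAlgebra.Build baseF (DqW n) dq_scaleAr.
End DqW.

(* Algebras presented by generators and relations *)
Section Presented.
Variables (R : comNzRingType) (I : Type).

Inductive aterm : Type :=
  | AGen of I
  | ACst of R
  | AAdd of aterm & aterm
  | AMul of aterm & aterm.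

HB.instance Definition _ := gen_eqMixin aterm.
HB.instance Definition _ := gen_choiceMixin aterm.

Variable rels : aterm -> aterm -> Prop.

Inductive acong : aterm -> aterm -> Prop :=
  | acong_rels x y of rels x y : acong x y
  | acong_refl x : acong x x
  | acong_sym x y of acong x y : acong y x
  | acong_trans x y z of acong x y & acong y z : acong x z
  | acong_add x x' y y' of acong x x' & acong y y' :
      acong (AAdd x y) (AAdd x' y')
  | acong_mul x x' y y' of acong x x' & acong y y' :
      acong (AMul x y) (AMul x' y')
  | acong_addA x y z : acong (AAdd x (AAdd y z)) (AAdd (AAdd x y) z)
  | acong_addC x y : acong (AAdd x y) (AAdd y x)
  | acong_add0 x : acong (AAdd (ACst 0) x) x
  | acong_addN x : acong (AAdd (AMul (ACst (-1)) x) x) (ACst 0)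
  | acong_mulA x y z : acong (AMul x (AMul y z)) (AMul (AMul x y) z)
  | acong_mul1 x : acong (AMul (ACst 1) x) x
  | acong_mulDl x y z :
      acong (AMul (AAdd x y) z) (AAdd (AMul x z) (AMul y z))
  | acong_mulDr x y z :
      acong (AMul x (AAdd y z)) (AAdd (AMul x y) (AMul x z))
  | acong_cstD c d : acong (ACst (c + d)) (AAdd (ACst c) (ACst d))
  | acong_cstM c d : acong (ACst (c * d)) (AMul (ACst c) (ACst d))
  | acong_cstC c x : acong (AMul (ACst c) x) (AMul x (ACst c)).

Definition acongb : rel aterm := fun x y => `[< acong x y >].

Lemma acongb_equiv : equiv_class_of acongb.
Proof.
split=> [x|x y|y x z].
- exact/asboolP/acong_refl.
- by apply/asboolP/asboolP; exact: acong_sym.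
- by move=> /asboolP xy /asboolP yz; apply/asboolP/(acong_trans xy yz).
Qed.
Canonical acong_equiv := EquivRelPack acongb_equiv.

Definition presalg := {eq_quot acong_equiv}%qT.
HB.instance Definition _ : EqQuotient _ acong_equiv presalg :=
  EqQuotient.on presalg.
HB.instance Definition _ := Choice.on presalg.

Definition pcls (x : aterm) : presalg := (\pi_presalg x)%qT.

Lemma pclsP x y : pcls x = pcls y <-> acong x y.
Proof. by split=> [/eqmodP/asboolP|xy]; [|apply/eqmodP/asboolP]. Qed.

Lemma pcls_repr (x : presalg) : pcls (generic_quotient.repr x) = x.
Proof. exact: reprK. Qed.

Lemma pclsW (P : presalg -> Prop) : (forall x, P (pcls x)) -> forall x, P x.
Proof. by move=> Px x; rewrite -(pcls_repr x). Qed.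

Definition pcst c := pcls (ACst c).
Definition padd (x y : presalg) : presalg := pcls (AAdd (generic_quotient.repr x) (generic_quotient.repr y)).
Definition pmul (x y : presalg) : presalg := pcls (AMul (generic_quotient.repr x) (generic_quotient.repr y)).
Definition popp (x : presalg) := pmul (pcst (-1)) x.
Definition pscale (c : R) (x : presalg) := pmul (pcst c) x.

Lemma repr_cong x : acong (generic_quotient.repr (pcls x)) x.
Proof. by apply/pclsP; rewrite pcls_repr. Qed.

Lemma pcls_add x y : padd (pcls x) (pcls y) = pcls (AAdd x y).
Proof. by apply/pclsP/acong_add; exact: repr_cong. Qed.
Lemma pcls_mul x y : pmul (pcls x) (pcls y) = pcls (AMul x y).
Proof. by apply/pclsP/acong_mul; exact: repr_cong. Qed.

Let pE := (pcls_add, pcls_mul).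

Lemma paddA : associative padd.
Proof.
elim/pclsW=> x; elim/pclsW=> y; elim/pclsW=> z.
by rewrite !pE; apply/pclsP/acong_addA.
Qed.
Lemma paddC : commutative padd.
Proof.
by elim/pclsW=> x; elim/pclsW=> y; rewrite !pE; apply/pclsP/acong_addC.
Qed.
Lemma padd0 : left_id (pcst 0) padd.
Proof. by elim/pclsW=> x; rewrite !pE; apply/pclsP/acong_add0. Qed.
Lemma paddN : left_inverse (pcst 0) popp padd.
Proof.
by elim/pclsW=> x; rewrite /popp /pcst !pE; apply/pclsP/acong_addN.
Qed.
HB.instance Definition _ := GRing.isZmodule.Build presalg paddA paddC padd0 paddN.

Lemma pmulA : associative pmul.
Proof.
elim/pclsW=> x; elim/pclsW=> y; elim/pclsW=> z.
by rewrite !pE; apply/pclsP/acong_mulA.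
Qed.
Lemma pcstC c (x : presalg) : pmul (pcst c) x = pmul x (pcst c).
Proof. by elim/pclsW: x => x; rewrite !pE; apply/pclsP/acong_cstC. Qed.
Lemma pmul1l : left_id (pcst 1) pmul.
Proof. by elim/pclsW=> x; rewrite !pE; apply/pclsP/acong_mul1. Qed.
Lemma pmul1r : right_id (pcst 1) pmul.
Proof. by move=> x; rewrite -pcstC pmul1l. Qed.
Lemma pmulDl : left_distributive pmul padd.
Proof.
elim/pclsW=> x; elim/pclsW=> y; elim/pclsW=> z.
by rewrite !pE; apply/pclsP/acong_mulDl.
Qed.
Lemma pmulDr : right_distributive pmul padd.
Proof.
elim/pclsW=> x; elim/pclsW=> y; elim/pclsW=> z.
by rewrite !pE; apply/pclsP/acong_mulDr.
Qed.
HB.instance Definition _ := GRing.Zmodule_isPzRing.Build presalg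
  pmulA pmul1l pmul1r pmulDl pmulDr.

Lemma pcstM c d : pcst (c * d) = pmul (pcst c) (pcst d).
Proof. by rewrite pE; apply/pclsP/acong_cstM. Qed.
Lemma pcstD c d : pcst (c + d) = padd (pcst c) (pcst d).
Proof. by rewrite pE; apply/pclsP/acong_cstD. Qed.

Lemma pscaleA c d x : pscale c (pscale d x) = pscale (c * d) x.
Proof. by rewrite /pscale pcstM pmulA. Qed.
Lemma pscale1 : left_id 1 pscale.
Proof. exact: pmul1l. Qed.
Lemma pscaleDr : right_distributive pscale +%R.
Proof. by move=> c x y; exact: pmulDr. Qed.
Lemma pscaleDl x : {morph pscale^~ x : c d / c + d}.
Proof. by move=> c d; rewrite /pscale pcstD; exact: pmulDl. Qed.
HB.instance Definition _ := GRing.Zmodule_isLmodule.Build R presalg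
  pscaleA pscale1 pscaleDr pscaleDl.

Lemma presalg_scaleAl c (x y : presalg) : c *: (x * y) = (c *: x) * y.
Proof. exact: pmulA. Qed.
Lemma presalg_scaleAr c (x y : presalg) : c *: (x * y) = x * (c *: y).
Proof.
change (pmul (pcst c) (pmul x y) = pmul x (pmul (pcst c) y)).
by rewrite !pmulA pcstC.
Qed.

End Presented.

Section DahaRel.
Variable n : nat.

Inductive daha_gen : Type :=
  | GT of 'I_n.+1 | GTV of 'I_n.+1 | GX of 'I_n | GXV of 'I_n.

Local Notation term := (aterm baseF daha_gen).
Local Notation T i := (AGen baseF (GT i) : term).
Local Notation TV i := (AGen baseF (GTV i) : term).
Local Notation X i := (AGen baseF (GX i) : term).
Local Notation XV i := (AGen baseF (GXV i) : term).
Local Notation C c := (ACst daha_gen c).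
Local Notation "x ** y" := (AMul x y) (at level 40, left associativity).
Local Notation "x -- y" := (AAdd x (AMul (C (-1)) y)) (at level 50).

Definition tpar (i : 'I_n.+1) : baseF :=
  if i == ord0 then t0h else if i == ord_max then tnh else th.

Definition far (i j : nat) : bool := (i.+1 < j)%N || (j.+1 < i)%N.

Inductive daha_rel : term -> term -> Prop :=
  | rel_TV i : daha_rel (T i ** TV i) (C 1)
  | rel_VT i : daha_rel (TV i ** T i) (C 1)
  | rel_XV j : daha_rel (X j ** XV j) (C 1)
  | rel_VX j : daha_rel (XV j ** X j) (C 1)
  | rel_XX j k : daha_rel (X j ** X k) (X k ** X j)
  | rel_quad i : daha_rel (T i -- TV i) (C (tpar i - (tpar i)^-1))
  | rel_far (i j : 'I_n.+1) of far i j : daha_rel (T i ** T j) (T j ** T i)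
  | rel_braid3 (i j : 'I_n.+1) of (1 <= i)%N & (i.+2 <= n)%N & j = i.+1 :> nat :
      daha_rel (T i ** T j ** T i) (T j ** T i ** T j)
  | rel_braid4 (i j : 'I_n.+1) of (1 < n)%N & (i = 0 :> nat) \/ (i.+1 = n) &
        j = i.+1 :> nat :
      daha_rel (T i ** T j ** T i ** T j) (T j ** T i ** T j ** T i)
  | rel_TXfar (i : 'I_n.+1) (j : 'I_n) of
        far i j.+1 \/ (i = n :> nat /\ j.+2 = n) :
      daha_rel (T i ** X j) (X j ** T i)
  | rel_TX (i : 'I_n.+1) (j k : 'I_n) of j.+1 = i & k.+1 = i.+1 :
      daha_rel (T i ** X j) (X k ** TV i)
  | rel_un (j : 'I_n) of j.+1 = n :
      daha_rel (XV j ** TV ord_max -- T ord_max ** X j) (C (unh - unh^-1))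
  | rel_u0 (j : 'I_n) of j = 0 :> nat :
      daha_rel (C qh^-1 ** TV ord0 ** X j -- C qh ** XV j ** T ord0)
        (C (u0h - u0h^-1)).

(* specialisation of all parameters, and of all the T_i and X_j, to 1 *)
Definition augF : baseF -> int :=
  @skew_sum int (lexp 6) _ int (fun=> idfun : {additive int -> int}).
HB.instance Definition _ := GRing.Additive.on augF.
Lemma augF_monoid : monoid_morphism augF.
Proof. exact: skew_sum_multiplicative. Qed.
HB.instance Definition _ :=
  GRing.isMonoidMorphism.Build baseF int augF augF_monoid.

Lemma augF_param i : augF (param i) = 1. Proof. exact: skew_sumU. Qed.
Lemma augF_paramV i : augF (param i)^-1 = 1.
Proof. by rewrite rmorphV ?param_unit //= augF_param invr1. Qed.

Fixpoint augT (x : term) : int :=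
  match x with
  | AGen _ => 1
  | ACst c => augF c
  | AAdd x y => augT x + augT y
  | AMul x y => augT x * augT y
  end.

Lemma augT_rel x y : daha_rel x y -> augT x = augT y.
Proof.
have augV i : augF (param i - (param i)^-1) = 0.
  by rewrite rmorphB /= augF_param augF_paramV.
have augN1 : augF (-1) = -1 by rewrite rmorphN rmorph1.
case=> //=; rewrite ?augN1 ?rmorph1 ?mulr1 //.
- by move=> i; rewrite /tpar; case: ifP => _; [|case: ifP => _]; rewrite augV.
- by move=> i _; rewrite augV.
- by move=> i _; rewrite augV augF_param augF_paramV.
Qed.

Lemma augT_cong x y : acong daha_rel x y -> augT x = augT y.
Proof.
elim=> /= {x y} //.
- exact: augT_rel.
- by move=> x y z _ -> _.
- by move=> x x' y y' _ -> _ ->.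
- by move=> x x' y y' _ -> _ ->.
- by move=> x y z; rewrite addrA.
- by move=> x y; rewrite addrC.
- by move=> x; rewrite rmorph0 add0r.
- by move=> x; rewrite rmorphN rmorph1 rmorph0 mulN1r addNr.
- by move=> x y z; rewrite mulrA.
- by move=> x; rewrite rmorph1 mul1r.
- by move=> x y z; rewrite mulrDl.
- by move=> x y z; rewrite mulrDr.
- by move=> c d; rewrite rmorphD.
- by move=> c d; rewrite rmorphM.
- by move=> c x; rewrite mulrC.
Qed.
End DahaRel.

Definition daha (n : nat) := presalg (@daha_rel n).

Section Daha.
Variable n : nat.
HB.instance Definition _ := GRing.PzRing.on (daha n).
HB.instance Definition _ := GRing.Lmodule.on (daha n).

Lemma daha_one_neq0 : 1 != 0 :> daha n.
Proof.
apply/eqP => /pclsP/augT_cong /=.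
by rewrite rmorph1 rmorph0.
Qed.
HB.instance Definition _ := GRing.PzSemiRing_isNonZero.Build (daha n) daha_one_neq0.
HB.instance Definition _ := GRing.Lmodule_isLalgebra.Build baseF (daha n)
  (@presalg_scaleAl _ _ (@daha_rel n)).
HB.instance Definition _ := GRing.Lalgebra_isAlgebra.Build baseF (daha n)
  (@presalg_scaleAr _ _ (@daha_rel n)).
End Daha.

Section Reflections.
Variable n : nat.
Implicit Types (a u : lexp n).

Definition coroot a : lexp n := \row_i divz (2 * a 0 i) (dot a a).

Definition reflection a u : lexp n := u - dot u (coroot a) *: a.

Definition srefl a : signed_perm n :=
  odflt 1%g [pick w | [forall i, wact w (eps i) == reflection a (eps i)]].

Lemma dotZr u (c : int) v : dot u (c *: v) = c * dot u v.
Proof.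
by rewrite /dot mulr_sumr; apply: eq_bigr => i _; rewrite mxE mulrCA.
Qed.
Lemma dotZl u (c : int) v : dot (c *: u) v = c * dot u v.
Proof. by rewrite dotC dotZr dotC. Qed.
Lemma eps_dot (i j : 'I_n) : dot (eps i) (eps j) = (i == j)%:R.
Proof. by rewrite dot_eps mxE eqxx eq_sym. Qed.

Lemma sgn_sqr (b : bool) : (-1) ^+ b * (-1) ^+ b = 1 :> int.
Proof. by case: b. Qed.

Lemma dot_short (i j : 'I_n) (b c : bool) : i != j ->
  let a := (-1) ^+ b *: eps i + (-1) ^+ c *: eps j in dot a a = 2.
Proof.
move=> ij a; have ji := negbTE ij; rewrite /a dotDr !dotZr ![dot (_ + _) _]dotC.
rewrite !dotDr !dotZr !eps_dot !eqxx (eq_sym j) ji !mulr0 addr0 add0r !mulr1.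
by rewrite !sgn_sqr.
Qed.

Lemma coroot_short (i j : 'I_n) (b c : bool) : i != j ->
  let a := (-1) ^+ b *: eps i + (-1) ^+ c *: eps j in coroot a = a.
Proof.
move=> ij a; apply/rowP => l; rewrite mxE dot_short //.
by rewrite mulKz.
Qed.

Lemma coroot_long (i : 'I_n) (b : bool) :
  coroot ((-1) ^+ b *: (eps i *+ 2)) = (-1) ^+ b *: eps i.
Proof.
rewrite /coroot.
have -> : dot ((-1) ^+ b *: (eps i *+ 2)) ((-1) ^+ b *: (eps i *+ 2)) = 4.
  rewrite dotZl dotZr mulr2n dotDl !dotDr eps_dot eqxx.
  by case: b.
apply/rowP => l; rewrite mulr2n !mxE eqxx /=.
by case: b; case: (l == i).
Qed.

Lemma reflectD a u v : reflection a (u + v) = reflection a u + reflection a v.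
Proof. by rewrite /reflection dotDl scalerDl opprD addrACA. Qed.

Lemma reflectZ a (c : int) u : reflection a (c *: u) = c *: reflection a u.
Proof.
by rewrite /reflection dotC dotZr dotC scalerBr scalerA.
Qed.

Lemma lexp_ind u (f g : lexp n -> lexp n) :
  {morph f : x y / x + y} -> {morph g : x y / x + y} ->
  (forall c : int, {morph f : x / c *: x}) -> (forall c : int, {morph g : x / c *: x}) ->
  (forall i, f (eps i) = g (eps i)) -> f u = g u.
Proof.
move=> fD gD fZ gZ fg.
have f0 : f 0 = 0 by have := fZ 0 0; rewrite !scale0r.
have g0 : g 0 = 0 by have := gZ 0 0; rewrite !scale0r.
rewrite (row_sum_delta u) (big_morph f fD f0) (big_morph g gD g0).
by apply: eq_bigr => i _; rewrite fZ gZ fg.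
Qed.

Lemma sreflP a u : isroot a -> wact (srefl a) u = reflection a u.
Proof.
move=> ra; rewrite /srefl; case: pickP => [w /forallP wP|no] /=.
  apply: (@lexp_ind u (wact w) (reflection a)).
  - exact: wactD.
  - exact: reflectD.
  - by move=> c x; exact: wactZ.
  - by move=> c x; exact: reflectZ.
  - by move=> i; apply/eqP/wP.
suff [w wP] : exists w, forall i, wact w (eps i) = reflection a (eps i).
  by have /negP[] := negbT (no w); apply/forallP => i; apply/eqP.
case/rootP: ra {no} => [i j b c ij|i b].
  exists (tperm i j, [ffun k => ((k == i) || (k == j)) && ~~ (b (+) c)]) => k.
  rewrite wact_eps /= ffunE /reflection coroot_short // dotDr !dotZr !eps_dot.
  have [->|ki] := eqVneq k i.
    rewrite tpermL (negbTE ij) mulr1 mulr0 addr0 scalerDr !sgnZ addbb /=.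
    rewrite expr0 scale1r opprD addNKr -scaleNr -signrN.
    by case: b; case: c.
  have [->|kj] := eqVneq k j.
    rewrite tpermR mulr1 mulr0 add0r scalerDr !sgnZ addbb /=.
    rewrite expr0 scale1r opprD [- _ + _]addrC addNKr -scaleNr -signrN.
    by case: b; case: c.
  rewrite tpermD 1?eq_sym // !mulr0 addr0 scale0r subr0 /= expr0 scale1r.
  by [].
exists (1%g, [ffun k => k == i]) => k.
rewrite wact_eps /= ffunE perm1 /reflection coroot_long dotZr eps_dot.
have [->|ki] := eqVneq k i; last by rewrite mulr0 scale0r subr0 expr0 scale1r.
rewrite mulr1 sgnZ addbb expr0 scale1r expr1 scaleN1r mulr2n opprD.
by rewrite addNKr.
Qed.
End Reflections.

Section Subspace.
Variable n : nat.
Implicit Types (f b : FT n) (h : FTfrac n) (a mu : lexp n) (k : int).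
Implicit Types (w : signed_perm n) (D : DqW n).

Definition realpos a k : bool :=
  (posroot a && (0 <= k)) || (negroot a && (0 < k)).

Definition divides f g := exists d : FT n, g = f * d.
Definition nzd f b := forall c : FT n, divides f (b * c) -> divides f c.

Definition regular_along f h :=
  exists b c, nzd f b /\ h * tofrac b = tofrac c.
Definition vanishes_on f h :=
  exists b c, nzd f b /\ h * tofrac b = tofrac (f * c).

Definition coef D w mu : FTfrac n := (D@_(- mu, w) : floc n).

Definition resfun a k h : FTfrac n := tofrac (1 - eaff a k) * h.

Definition simple_poles D := forall w mu a k, realpos a k ->
  regular_along (1 - eaff a k) (resfun a k (coef D w mu)).

Definition residues_cancel D := forall w mu a k, realpos a k ->
  vanishes_on (1 - eaff a k)
    (resfun a k (coef D w mu) +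
     resfun a k (coef D (srefl a * w)%g (wact (srefl a) mu - k *: coroot a))).

Definition zero_at a (p : baseF) h := vanishes_on (lmon 1 a - cst n p) h.

Definition epsw a w : int := if negroot (wact w^-1%g a) then 1 else 0.

Definition short_zeros D := forall w mu (i j : 'I_n) a, (i < j)%N ->
  a = eps i - eps j \/ a = eps i + eps j ->
  let m := dot a mu in
  let h := coef D w mu in
  [/\ m < 0 -> forall r : int, 0 <= r <= - m - 1 + epsw a w ->
        zero_at a (q ^ (- r) * t^-1) h,
      m = 0 -> epsw a w = 1 -> zero_at a t^-1 h &
      0 < m -> forall r : int, 1 <= r <= m - epsw a w ->
        zero_at a (q ^ r * t) h].

Definition long_zeros D := forall w mu (i : 'I_n),
  let a := eps i *+ 2 in
  let m := dot a mu in
  let m2 := (m %/ 2)%Z in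
  let h := coef D w mu in
  [/\ m < 0 -> forall r : int, 0 <= r <= - m2 - 1 + epsw a w ->
        zero_at (eps i) (q ^ (- r) * tnh^-1 * unh^-1) h /\
        zero_at (eps i) (- (q ^ (- r) * tnh^-1 * unh)) h,
      m < 0 -> forall r : int, 0 <= r <= - m2 - 1 ->
        zero_at (eps i) (q ^ (- r) * qh^-1 * t0h^-1 * u0h^-1) h /\
        zero_at (eps i) (- (q ^ (- r) * qh^-1 * t0h^-1 * u0h)) h,
      m = 0 -> epsw a w = 1 ->
        zero_at (eps i) (tnh^-1 * unh^-1) h /\
        zero_at (eps i) (- (tnh^-1 * unh)) h,
      0 < m -> forall r : int, 1 <= r <= m2 - epsw a w ->
        zero_at (eps i) (q ^ r * tnh * unh) h /\
        zero_at (eps i) (- (q ^ r * tnh * unh^-1)) h &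
      0 < m -> forall r : int, 0 <= r <= m2 - 1 ->
        zero_at (eps i) (q ^ r * qh * t0h * u0h) h /\
        zero_at (eps i) (- (q ^ r * qh * t0h * u0h^-1)) h].

Definition Hqk : {pred DqW n} := fun D =>
  `[< [/\ simple_poles D, residues_cancel D, short_zeros D & long_zeros D] >].
End Subspace.

(* Main.v *)
Require Import Defs.
From HB Require Import structures.
From mathcomp Require Import all_boot all_order all_algebra.
From mathcomp Require Import fingroup perm generic_quotient finmap monalg boolp.
From mathcomp Require Import zify ring lra.

Set Implicit Arguments.
Unset Strict Implicit.
Unset Printing Implicit Defensive.

Import Order.TTheory GRing.Theory Num.Theory.

Local Open Scope ring_scope.

(* The affine Weyl group of pairs (mu, w) is a Coxeter group, and the operators
   T_i = t_i^(1/2) + b_i (s_i - 1), where b_i has a simple pole along e^(alpha_i) = 1 and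
   vanishes on the divisors that the third condition attaches to alpha_i, satisfy the
   Hecke and Bernstein relations.  Written uniformly over affine roots, the three
   conditions say: simple poles, h_g + h_(s_b g) regular along e^b = 1 for every positive
   affine root b, and h_g vanishing on the numerator divisors of b whenever s_b shortens g.
   They are stable under the T_i and under multiplication by F[T], so the image of the
   Hecke algebra satisfies them.

   Conversely, let h be the coefficient at an element w of maximal length in the support
   of D.  The elements s_b w longer than w carry no coefficient, so h is regular along
   e^b = 1 for these b, and h vanishes on the numerator divisors of the other b.  Dividing
   out one simple reflection at a time, h is an F[T]-multiple of the leading coefficient of
   T_w; subtracting this multiple of T_w and repeating exhausts D.  The same triangularity,
   applied to the spanning set X^lambda T_w of the Hecke algebra, gives injectivity. *)

(** Two obstacles shape the proof. The coefficients of F[T] lie in a ring, not a field, and no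
    valuation is used: the behaviour along a divisor f is expressed through elements that are not
    zero divisors modulo f ([nzd]). What has to be known is that the binomials 1 - c e^b that occur
    are coprime in this sense. If the exponents are independent, a grading of F[T] separates them;
    if they are parallel, the independence of the parameters does. The second obstacle is the group
    theory. Elements of the affine Weyl group are identified with integral points, so that
    equalities, descents and braid relations become integer arithmetic.

    An operator is determined by its coefficient function g |-> h_g, on which T_i acts by h_g |->
    a_i h_g + b_i s_i(h_(s_i g)) with a_i = t_i^(1/2) - b_i. The relations thereby become identities
    of rational functions of a few e^alpha. Stability of the conditions under T_i rests on one
    cancellation: s_b is trivial on the divisor e^b = 1, so (h - s_b h) / (1 - e^b) is regular there
    whenever h is. *)

(** * The affine Weyl group: heights, reflections and Bruhat order *)

Section AffineWeyl.
Variable n : nat.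
Implicit Types (a u v : lexp n) (k : int) (b c : lexp n * int).
Implicit Types (w : signed_perm n) (g h : shift_refl n).

(** Half the sum of the positive roots of C_n, with coordinates (n, ..., 1). *)
Definition rho : lexp n := \row_i (n - i)%:Z.
(* point g is coxn times the image of rho / coxn, a point of the fundamental alcove, under
   x |-> w x - mu for g = (mu, w); the affine root b takes the value hgt g b / coxn there,
   so for b positive hgt g b < 0 iff s_b shortens g. *)
Definition coxn : int := (n.*2.+1)%:Z.
Definition point g : lexp n := wact g.2 rho - coxn *: g.1.
Definition hgt g b : int := coxn * b.2 + dot (point g) b.1.
(** The action on affine roots that [sr_act] induces on the monomials e^(a + k delta). *)
Definition aact g b : lexp n * int := (wact g.2 b.1, b.2 + dot g.1 (wact g.2 b.1)).
Definition arefl b : shift_refl n := (b.2 *: coroot b.1, srefl b.1).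
Definition apair b c : int := dot b.1 (coroot c.1).
Definition apos b : bool := isroot b.1 && (0 < hgt 1%g b).

Lemma dot_rho_eps i : dot rho (eps i) = (n - i)%:Z.
Proof. by rewrite dot_eps mxE. Qed.

Lemma dotBr u v (x : lexp n) : dot u (v - x) = dot u v - dot u x.
Proof. by rewrite dotDr dotNr. Qed.
Lemma dotNl u v : dot (- u) v = - dot u v.
Proof. by rewrite dotC dotNr dotC. Qed.
Lemma dotBl u v (x : lexp n) : dot (v - x) u = dot v u - dot x u.
Proof. by rewrite dotDl dotNl. Qed.
Lemma dotMnr u v m : dot u (v *+ m) = dot u v *+ m.
Proof. by rewrite -scaler_nat dotZr mulr_natl. Qed.

Lemma dot_wactV w u v : dot (wact w u) v = dot u (wact w^-1%g v).
Proof. by rewrite -[in RHS](dot_wact w) -wactM mulgV wact1. Qed.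

Lemma aactM g h b : aact (g * h)%g b = aact g (aact h b).
Proof.
rewrite /aact /= wactM; congr pair.
by rewrite [X in dot X]addrC dotDl dot_wact addrA.
Qed.
Lemma aact1 b : aact 1%g b = b.
Proof. by rewrite /aact /= wact1 dot0l addr0; case: b. Qed.
Lemma aactK g : cancel (aact g) (aact g^-1%g).
Proof. by move=> b; rewrite -aactM mulVg aact1. Qed.

Lemma point1 : point 1%g = rho.
Proof. by rewrite /point /= wact1 scaler0 subr0. Qed.

Lemma pointM g h : point (g * h)%g = wact g.2 (point h) - coxn *: g.1.
Proof.
by rewrite /point /= wactM wactD wactN wactZ scalerDr opprD [X in _ + X]addrC addrA.
Qed.

Lemma hgtM g h b : hgt (g * h)%g b = hgt h (aact g^-1%g b).
Proof.
rewrite /hgt pointM dotBl dotZl dot_wactV /aact /=.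
rewrite -[dot g.1 b.1](dot_wact g.2^-1%g) dotNl.
by rewrite mulrBr -addrA [X in _ + X]addrC.
Qed.

Lemma coroot_root a : isroot a ->
  [/\ dot a a *: coroot a = 2 *: a, dot a (coroot a) = 2 &
      (dot a a = 2 \/ dot a a = 4)].
Proof.
have rr (x y : 'I_n) : dot (eps x) (eps y) = (x == y)%:R by exact: eps_dot.
case/Defs.rootP => [i j s s' ij|i s].
  by rewrite coroot_short // dot_short //; split; [| |left].
rewrite coroot_long.
have -> : dot ((-1) ^+ s *: (eps i *+ 2)) ((-1) ^+ s *: (eps i *+ 2)) = 4.
  rewrite dotZl dotZr mulr2n dotDl !dotDr eps_dot eqxx.
  by case: s.
split; [|by rewrite dotZl dotZr dotC dotMnr eps_dot eqxx; case: s|by right].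
by rewrite mulr2n -!scaler_nat; apply/rowP => x; rewrite !mxE; ring.
Qed.

Lemma coroot_eq a u : isroot a -> dot a a *: u = 2 *: a -> coroot a = u.
Proof.
move=> ra e; have [e' _ aa] := coroot_root ra.
have aa0 : dot a a != 0 by case: aa => ->.
apply/rowP => i; apply: (mulfI aa0).
by have := congr1 (fun v : 'rV_n => v 0 i) (etrans e' (esym e)); rewrite !mxE.
Qed.

Lemma coroot_wact w a : isroot a -> coroot (wact w a) = wact w (coroot a).
Proof.
move=> ra; have [e _ _] := coroot_root ra.
apply: coroot_eq => //; first exact: root_wact.
by rewrite dot_wact -!wactZ e.
Qed.

Lemma corootN a : isroot a -> coroot (- a) = - coroot a.
Proof.
move=> ra; have [e _ _] := coroot_root ra.
apply: coroot_eq => //; first by rewrite Defs.rootN.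
by rewrite dotNl dotNr opprK !scalerN e.
Qed.

Lemma aact_arefl b c : isroot b.1 ->
  aact (arefl b) c = (c.1 - apair c b *: b.1, c.2 - apair c b * b.2).
Proof.
case: b c => [a k] [u l] /= ra; rewrite /aact /apair /= sreflP // /reflection.
have [_ e _] := coroot_root ra; congr (_, _ + _).
by rewrite dotZl dotC dotBl dotZl e; ring.
Qed.

Lemma arefl_inv b : isroot b.1 -> aact (arefl b) b = - b.
Proof.
move=> rb; rewrite aact_arefl //; have [_ e _] := coroot_root rb.
rewrite /apair e; case: b {rb e} => a k /=; congr pair; last by rewrite /=; ring.
by apply/rowP => i; rewrite !mxE; ring.
Qed.

Lemma hgtN g b : hgt g (- b) = - hgt g b.
Proof. by rewrite /hgt /= mulrN dotNr opprD. Qed.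

Lemma coroot_swap a u : isroot a ->
  dot u (coroot a) *: a = dot u a *: coroot a.
Proof.
move=> ra; have [e _ aa] := coroot_root ra.
have aa0 : dot a a != 0 by case: aa => ->.
have e2 : dot a a * dot u (coroot a) = 2 * dot u a by rewrite -dotZr e dotZr.
apply/rowP => i; apply: (mulfI aa0); rewrite !mxE mulrA e2.
have := congr1 (fun v : 'rV_n => v 0 i) e; rewrite !mxE => e'.
by rewrite [in RHS]mulrCA e'; ring.
Qed.

Lemma point_arefl b g : isroot b.1 ->
  point (arefl b * g)%g = point g - hgt g b *: coroot b.1.
Proof.
move=> rb; rewrite pointM /= sreflP // /reflection /hgt coroot_swap //.
by rewrite -addrA -opprD scalerA -scalerDl [X in X *: _]addrC.
Qed.

Lemma hgt_arefl b g c : isroot b.1 ->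
  hgt (arefl b * g)%g c = hgt g c - apair c b * hgt g b.
Proof.
move=> rb; rewrite /hgt point_arefl // dotBl dotZl /hgt /apair.
by rewrite [dot (coroot _) _]dotC; ring.
Qed.

(** The bound 2n is attained at the highest root and lies below [coxn] = 2n + 1. Hence coxn k +
    <rho, a> has the lexicographic sign of (k, <rho, a>), and S^+_Real is the set of affine roots of
    positive height at the identity. *)
Lemma rho_bound a : isroot a -> `|dot rho a| <= (n.*2)%:Z /\ dot rho a != 0.
Proof.
case/Defs.rootP => [i j s s' ij|i s]; rewrite ?dotDr !(dotZr, dotMnr) !dot_rho_eps.
  have ij' : (i : nat) != j by [].
  by case: s; case: s'; rewrite /= ?expr0 ?expr1; have := ltn_ord i; have := ltn_ord j; lia.
by case: s; rewrite /= ?expr0 ?expr1; have := ltn_ord i; lia.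
Qed.

Lemma posrootE a : posroot a = isroot a && (0 < dot rho a).
Proof.
have pp (x : lexp n) : posroot x -> 0 < dot rho x.
  case/orP=> [/existsP[i /existsP[j /andP[ij ea]]]|/existsP[i /eqP->]].
    by case/orP: ea => /eqP ->; rewrite ?dotBr ?dotDr !dot_rho_eps; have := ltn_ord i; have := ltn_ord j; lia.
  by rewrite dotMnr dot_rho_eps; have := ltn_ord i; lia.
rewrite /isroot; case pa : (posroot a) => /=; first by rewrite pp.
apply/esym/negP => /andP[/pp]; rewrite dotNr => h; lia.
Qed.

Lemma negrootE a : negroot a = isroot a && (dot rho a < 0).
Proof. by rewrite /negroot posrootE Defs.rootN dotNr oppr_gt0. Qed.

Lemma coxn_gt0 (k x : int) : `|x| <= (n.*2)%:Z ->
  (0 < coxn * k + x) = (0 < k) || (k == 0) && (0 < x).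
Proof.
rewrite /coxn => hx; case: (ltgtP k 0) => [k0|k0|->] /=; last by rewrite mulr0 add0r.
  have : coxn * k <= coxn * -1 by rewrite ler_wpM2l //; lia.
  by rewrite /coxn; lia.
have : coxn * 1 <= coxn * k by rewrite ler_wpM2l //; lia.
by rewrite /coxn; lia.
Qed.

Lemma coxn_lt0 (k x : int) : `|x| <= (n.*2)%:Z ->
  (coxn * k + x < 0) = (k < 0) || (k == 0) && (x < 0).
Proof.
move=> hx; have := @coxn_gt0 (- k) (- x); rewrite normrN mulrN -opprD !oppr_gt0.
by move=> ->; rewrite // oppr_eq0.
Qed.

Lemma aposE a k : realpos a k = apos (a, k).
Proof.
rewrite /realpos posrootE negrootE /apos /hgt /= point1.
case ra : (isroot a) => //=; have [h +] := rho_bound ra; rewrite coxn_gt0 //.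
by move: (dot _ _) => x; lia.
Qed.

Lemma aact_root g b : isroot b.1 -> isroot (aact g b).1.
Proof. exact: root_wact. Qed.

Lemma aposN b : isroot b.1 -> apos (- b) = ~~ apos b.
Proof.
move=> rb; rewrite /apos hgtN /= Defs.rootN rb /=.
rewrite /hgt point1 oppr_gt0; have [h +] := rho_bound rb.
by rewrite coxn_gt0 // coxn_lt0 //; move: (dot _ _) => x; lia.
Qed.

Lemma hgt_neq0 g b : isroot b.1 -> hgt g b != 0.
Proof.
move=> rb; have rb' := aact_root g^-1%g rb.
rewrite -[g]mulg1 hgtM /hgt point1; have [h h0] := rho_bound rb'.
have := coxn_gt0 (aact g^-1%g b).2 h; have := coxn_lt0 (aact g^-1%g b).2 h.
by move: h0; move: (dot _ _) (coxn * _) => x y; lia.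
Qed.

(** The entries of w rho have absolute value at most n, so the point modulo 2n + 1 determines the
    translation; these entries are a signed permutation of n, ..., 1, so they determine w.
    Identities between products of reflections are afterwards checked on points. *)
Lemma point_inj : injective point.
Proof.
have bd w j : `|wact w rho 0 j| <= n%:Z.
  by rewrite !mxE; case: (w.2 _); rewrite /= ?expr0 ?expr1; lia.
move=> [m w] [m' w'] /rowP e.
have em : m = m'.
  apply/rowP => j; have := e j; have := bd w j; have := bd w' j.
  rewrite /point /=; move: (wact w rho) (wact w' rho) => u u'; rewrite !mxE.
  move: (m 0 j) (m' 0 j) (u 0 j) (u' 0 j) => x y z t tn zn exy.
  have hz : `|t - z| <= (n.*2)%:Z by lia.
  have := coxn_gt0 (x - y) hz; have := coxn_lt0 (x - y) hz.
  have -> : coxn * (x - y) + (t - z) = 0 by rewrite mulrBr; lia.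
  by rewrite ltxx; lia.
rewrite {}em in e *; congr pair.
have {}e j : wact w rho 0 j = wact w' rho 0 j.
  by have := e j; rewrite !mxE => /addIr.
have ew i : w.1 i = w'.1 i /\ w.2 i = w'.2 i.
  have := e (w.1 i); rewrite !mxE permK.
  set j := (w'.1^-1)%g _ => ej.
  have [ei es] : (n - i = n - j)%N /\ w.2 i = w'.2 j.
    by move: ej; have := ltn_ord i; have := ltn_ord j; case: (w.2 i); case: (w'.2 j);
       rewrite /= ?expr0 ?expr1; lia.
  have ij : i = j by apply: val_inj => /=; have := ltn_ord i; have := ltn_ord j; lia.
  by rewrite [in RHS]ij /j permKV es -ij.
case: w w' ew {bd e} => [s f] [s' f'] /= ew; congr pair; first by apply/permP=> i; case: (ew i).
by apply/ffunP => i; case: (ew i).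
Qed.

Lemma arefl_point b g h : isroot b.1 ->
  point h = point g - hgt g b *: coroot b.1 -> h = (arefl b * g)%g.
Proof. by move=> rb e; apply: point_inj; rewrite point_arefl. Qed.

Lemma areflK b g : isroot b.1 -> (arefl b * (arefl b * g))%g = g.
Proof.
move=> rb; apply/esym/arefl_point => //; rewrite point_arefl // hgt_arefl //.
have [_ e _] := coroot_root rb; rewrite /apair e.
move: (point g) (coroot _) => u u'; by apply/rowP => i; rewrite !mxE; ring.
Qed.

Lemma arefl_conj b c g : isroot b.1 -> isroot c.1 ->
  (arefl c * (arefl b * g) = arefl (aact (arefl c) b) * (arefl c * g))%g.
Proof.
move=> rb rc; apply: arefl_point; first exact: aact_root.
rewrite !point_arefl // !hgt_arefl // aact_arefl //=.
have -> : hgt g (b.1 - apair b c *: c.1, b.2 - apair b c * c.2) = hgt g b - apair b c * hgt g c.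
  by rewrite /hgt /= dotBr dotZr; ring.
have -> : coroot (b.1 - apair b c *: c.1) = coroot b.1 - apair c b *: coroot c.1.
  have -> : b.1 - apair b c *: c.1 = wact (srefl c.1) b.1 by rewrite sreflP.
  rewrite coroot_wact // sreflP // /reflection coroot_swap //.
  by rewrite /apair dotC.
have -> : apair (b.1 - apair b c *: c.1, b.2 - apair b c * c.2) c = - apair b c.
  rewrite /apair /= dotBl dotZl; have [_ -> _] := coroot_root rc; ring.
move: (point g) (coroot _) (coroot _) => u x y; apply/rowP => i; rewrite !mxE; ring.
Qed.

Lemma areflVE b : isroot b.1 -> ((arefl b)^-1 = arefl b)%g.
Proof.
move=> rb; apply: (mulgI (arefl b)); rewrite mulgV.
by have := areflK 1%g rb; rewrite mulg1.
Qed.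

Lemma aact_areflK b c : isroot b.1 -> aact (arefl b) (aact (arefl b) c) = c.
Proof. by move=> rb; rewrite -aactM -{1}(areflVE rb) mulVg aact1. Qed.

Lemma hgt_arefl_aact b g c : isroot b.1 ->
  hgt (arefl b * g)%g c = hgt g (aact (arefl b) c).
Proof. by move=> rb; rewrite hgtM areflVE. Qed.

(* Replaces the length function: it changes in the same direction under reflections. *)
Definition dist g : nat := `|(dot (point g - rho) (point g - rho))%R|%N.

(** Reflecting changes the squared distance to rho by 4 [hgt g b] [hgt 1 b] / <b, b>, and [hgt 1 b]
    is positive for positive b. *)
Lemma dist_arefl b g : apos b -> ((dist g < dist (arefl b * g)%g)%N = (0 < hgt g b)).
Proof.
case/andP=> rb hb.
have dE h : (dist h)%:Z = dot (point h - rho) (point h - rho).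
  rewrite /dist gez0_abs // /dot; apply: sumr_ge0 => i _.
  by rewrite -expr2 sqr_ge0.
have [e1 e2 aa] := coroot_root rb.
have aa0 : 0 < dot b.1 b.1 by case: aa => ->.
have e : dot b.1 b.1 * ((dist (arefl b * g)%g)%:Z - (dist g)%:Z) = 4 * hgt g b * hgt 1%g b.
  rewrite !dE point_arefl //; set P := point g; set v := hgt g b.
  have eh : hgt 1%g b = v - dot P b.1 + dot rho b.1 by rewrite /v /hgt point1 -/P; ring.
  rewrite {}eh; move: P v => P v.
  have -> : P - v *: coroot b.1 - rho = P - rho - v *: coroot b.1 by rewrite addrAC.
  rewrite !(dotBl, dotBr, dotZl, dotZr).
  have ex u : dot b.1 b.1 * dot u (coroot b.1) = 2 * dot u b.1 by rewrite -dotZr e1 dotZr.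
  have e4 : dot b.1 b.1 * dot (coroot b.1) (coroot b.1) = 4.
    by rewrite ex dotC e2.
  rewrite [dot (coroot _) P]dotC [dot (coroot _) rho]dotC.
  have := ex P; have := ex rho; move: e4.
  move: (dot (coroot b.1) _) (dot P (coroot _)) (dot rho (coroot _)) (dot b.1 b.1).
  move=> x y z A h1 h2 h3.
  set lhs := (X in X = _).
  have -> : lhs = v * v * (A * x) - 2 * v * (A * y) + 2 * v * (A * z) by rewrite /lhs; ring.
  by rewrite h1 h2 h3; ring.
have -> : (dist g < dist (arefl b * g)%g)%N = (0 < (dist (arefl b * g)%g)%:Z - (dist g)%:Z) by lia.
by rewrite -(pmulr_rgt0 _ aa0) e -mulrA (pmulr_rgt0 _ (isT : 0 < 4 :> int)) (pmulr_lgt0 _ hb).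
Qed.

Lemma dist_arefl_lt b g : apos b -> ((dist (arefl b * g)%g < dist g)%N = (hgt g b < 0)).
Proof.
move=> pb; have /andP[rb _] := pb.
rewrite -{2}[g](areflK _ rb) dist_arefl // hgt_arefl_aact // arefl_inv // hgtN.
by rewrite oppr_gt0.
Qed.

(** The Bruhat order, generated by left multiplication with reflections that raise [dist]. *)
Inductive bruhat : shift_refl n -> shift_refl n -> Prop :=
| bruhat_refl g : bruhat g g
| bruhat_step b g h of apos b & 0 < hgt g b & bruhat (arefl b * g)%g h : bruhat g h.

Lemma bruhat_dist g h : bruhat g h -> g = h \/ (dist g < dist h)%N.
Proof.
elim=> {g h} [g|b g h pb gb _ [<-|lt]]; [by left|right|right].
  by rewrite dist_arefl.
by apply: ltn_trans lt; rewrite dist_arefl.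
Qed.

Lemma bruhat_trans g h g' : bruhat g h -> bruhat h g' -> bruhat g g'.
Proof. by elim=> // {}g {}h b pb gb _ IH /IH; apply: bruhat_step. Qed.

(** A lifting property. Conjugation by s_c turns a step along b into a step along s_c b, which is
    again positive for b different from c. At a step along c the chain already passes through s_c g,
    and h lies below s_c h. *)
Lemma bruhat_lift c g h : apos c ->
  (forall b, apos b -> b <> c -> apos (aact (arefl c) b)) ->
  0 < hgt h c -> bruhat g h -> bruhat (arefl c * g)%g (arefl c * h)%g.
Proof.
move=> pc pcP hc gh; have /andP[rc _] := pc.
elim: gh hc => {g h} [g|b g h pb gb gh IH] hc; first by move=> *; exact: bruhat_refl.
have [ebc|nbc] := eqVneq b c.
  rewrite -ebc; apply: bruhat_trans gh _.
  by apply: (@bruhat_step b); rewrite // ?ebc //; apply: bruhat_refl.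
have {}IH := IH hc; have /andP[rb _] := pb.
rewrite arefl_conj // in IH.
apply: bruhat_step IH; first by apply: pcP => //; apply/eqP.
by rewrite hgt_arefl_aact // aact_areflK.
Qed.
End AffineWeyl.

(** * Simple affine roots *)

Section SimpleRoots.
Variable m : nat.
Local Notation n := m.+1.
Implicit Types (a u v : lexp n) (k : int) (b c : lexp n * int).
Implicit Types (w : signed_perm n) (g h : shift_refl n) (i j : 'I_m.+2).

Definition simple i : lexp n * int :=
  if i == 0 :> nat then (- (eps ord0 *+ 2), 1)
  else if i == m.+1 :> nat then (eps ord_max *+ 2, 0)
  else (eps (inord i.-1) - eps (inord i), 0).

Definition srefl_simple i : shift_refl n := arefl (simple i).

Variant simple_spec i : lexp n * int -> Type :=
| Simple0 of i = 0 :> nat : simple_spec i (- (eps ord0 *+ 2), 1)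
| SimpleN of i = m.+1 :> nat : simple_spec i (eps ord_max *+ 2, 0)
| SimpleM (p p' : 'I_n) of p = i.-1 :> nat & p' = i :> nat & (0 < i < m.+1)%N :
   simple_spec i (eps p - eps p', 0).

Lemma simpleP i : simple_spec i (simple i).
Proof.
rewrite /simple; case: eqP => [|/eqP i0]; first exact: Simple0.
case: eqP => [|/eqP iN]; first exact: SimpleN.
have lti := ltn_ord i.
by apply: SimpleM; rewrite ?inordK //; lia.
Qed.

Lemma isroot_sub (p q : 'I_n) : p != q -> isroot (eps p - eps q).
Proof. by move/(root_short false true); rewrite expr0 expr1 scale1r scaleN1r. Qed.
Lemma isroot_dbl (p : 'I_n) : isroot (eps p *+ 2).
Proof. by have := root_long p false; rewrite scale1r. Qed.

Lemma simple_root i : isroot (simple i).1.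
Proof.
case: simpleP => [_|_|p p' ep ep' hi] /=; rewrite ?Defs.rootN ?isroot_dbl //.
by apply: isroot_sub; rewrite -val_eqE /= ep ep'; lia.
Qed.
#[local] Hint Resolve simple_root : core.

Lemma coroot_dbl (p : 'I_n) : coroot (eps p *+ 2) = eps p.
Proof. by have := coroot_long p false; rewrite !scale1r. Qed.

Lemma coroot_simple i : coroot (simple i).1 =
  if i == 0 :> nat then - eps ord0 else if i == m.+1 :> nat then eps ord_max
  else (simple i).1.
Proof.
case: simpleP => [->|->|p p' ep ep' hi] //=.
- by rewrite corootN ?isroot_dbl // coroot_dbl.
- by rewrite eqxx coroot_dbl.
rewrite !ifF; try lia.
have pp' : p != p' by rewrite -val_eqE /= ep ep'; lia.
by have := coroot_short false true pp'; rewrite /= expr0 expr1 scale1r scaleN1r.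
Qed.

Lemma apos_gt b : isroot b.1 ->
  apos b = (0 < b.2) || (b.2 == 0) && (0 < dot (rho n) b.1).
Proof.
move=> rb; rewrite /apos rb /hgt point1.
by have [h _] := rho_bound rb; rewrite coxn_gt0.
Qed.

Lemma rho_simple i : dot (rho n) (simple i).1 =
  if i == 0 :> nat then - (n.*2)%:Z else if i == m.+1 :> nat then 2 else 1.
Proof.
case: simpleP => [->|->|p p' ep ep' hi] //=.
- by rewrite dotNr dotMnr dot_rho_eps /=; lia.
- by rewrite eqxx dotMnr dot_rho_eps /=; lia.
by rewrite dotBr !dot_rho_eps ep ep' !ifF; lia.
Qed.

Lemma simple_pos i : apos (simple i).
Proof.
rewrite apos_gt // rho_simple; case: simpleP => [->|->|p p' ep ep' hi] //=.
  by rewrite eqxx.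
by rewrite !ifF; lia.
Qed.

Lemma simple_perm i b : apos b -> apos (aact (srefl_simple i) b) \/ b = simple i.
Proof.
move=> pb; have /andP[rb _] := pb.
have rb' := aact_root (srefl_simple i) rb.
rewrite apos_gt //; move: pb; rewrite apos_gt //.
have [_ n0] := rho_bound rb'; move: n0; rewrite /srefl_simple aact_arefl //=.
rewrite dotBr dotZr rho_simple {rb'}; case: b rb => a k /= ra.
rewrite /apair coroot_simple /=.
have E (x p : 'I_n) : dot (eps x) (eps p) = (x == p :> nat)%:R by rewrite eps_dot.
case: simpleP => [ei|ei|p p' ep ep' hi] /=; [rewrite ei /=|rewrite ei eqxx /=|rewrite !ifF; try lia];
  case/Defs.rootP: ra => [x y s s' xy|x s];
  rewrite ?(dotBr, dotDl, dotDr, dotNr, dotZr, dotZl, dotMnr, =^~ mulr2n) ?dot_rho_eps.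
all: rewrite ?E; have := ltn_ord x; rewrite ?mulr1 ?mulr0 ?opprK.
all: try (have := ltn_ord y; have : (x : nat) <> y by move/val_inj/eqP; rewrite (negbTE xy)).
all: try case: s; try case: s'; rewrite ?expr0 ?expr1 ?mul1r ?mulN1r ?scale1r ?scaleN1r.
all: repeat case: (_ =P _) => /=; intros; rewrite ?mulr1n ?mulr0n.
all: try by left; lia.
(* In the remaining cases the finite part is that of alpha_i; the delta-coordinate decides between
   alpha_i itself and a root that stays positive. *)
- have -> : x = ord0 by exact: val_inj.
  by have [->|k1] := eqVneq k 1; [right|left; lia].
- have -> : x = ord_max by exact: val_inj.
  by have [->|k1] := eqVneq k 0; [right|left; lia].
- have [-> ->] : x = p' /\ y = p by split; exact: val_inj.
  by have [->|k1] := eqVneq k 0; [right; rewrite addrC|left; lia].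
have [-> ->] : x = p /\ y = p' by split; exact: val_inj.
by have [->|k1] := eqVneq k 0; [right|left; lia].
Qed.

Lemma simple_permP i b : apos b -> b <> simple i -> apos (aact (srefl_simple i) b).
Proof. by move=> pb nb; case: (simple_perm i pb). Qed.

End SimpleRoots.
#[export] Hint Resolve simple_root : core.

(** * Reduced words and Matsumoto's theorem *)

Section SimpleWords.
Variable m : nat.
Local Notation n := m.+1.
Implicit Types (a u v : lexp n) (b c : lexp n * int).
Implicit Types (w : signed_perm n) (g h : shift_refl n) (i j : 'I_m.+2).

(** The entries of [point g] are n strictly decreasing integers, and the conditions at alpha_0 and
    alpha_n confine them to 1, ..., n; so the point is rho. *)
Lemma dominant_id g : (forall i, 0 < hgt g (simple i)) -> g = 1%g.
Proof.
move=> dom; apply: point_inj; rewrite point1; set P := point g.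
have P0 : 2 * P 0 ord0 < coxn n.
  have := dom ord0; rewrite /hgt -/P; case: simpleP => //= _.
  by rewrite dotNr dotMnr dot_eps; lia.
have PN : 0 < P 0 ord_max.
  have := dom ord_max; rewrite /hgt -/P; case: simpleP => //= [_|p p' _ _].
    by rewrite dotMnr dot_eps; lia.
  by rewrite ltnn.
have PM (p p' : 'I_n) : p' = p.+1 :> nat -> P 0 p' < P 0 p.
  move=> e; have ip : (p' < m.+2)%N by rewrite (ltn_trans (ltn_ord _)).
  have := dom (Ordinal ip); rewrite /hgt -/P; case: simpleP => /=; try by have := ltn_ord p'; lia.
  move=> x y ex ey _; rewrite dotBr !dot_eps.
  have -> : y = p' by exact: val_inj.
  have -> : x = p by apply: val_inj => /=; lia.
  by lia.
have up k (p : 'I_n) : p = k :> nat -> P 0 p <= (n - k)%:Z.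
  elim: k p => [|k IH] p ep.
    have -> : p = ord0 by exact: val_inj.
    by move: P0; rewrite /coxn; lia.
  have kn : (k < n)%N by have := ltn_ord p; lia.
  have := IH (Ordinal kn) erefl; have := PM (Ordinal kn) p ep.
  by have := ltn_ord p; lia.
have dn k (p : 'I_n) : (m - p = k)%N -> k.+1%:Z <= P 0 p.
  elim: k p => [|k IH] p ep.
    have -> : p = ord_max by apply: val_inj => /=; have := ltn_ord p; lia.
    by lia.
  have kn : (p.+1 < n)%N by have := ltn_ord p; lia.
  have := IH (Ordinal kn); have := PM p (Ordinal kn) erefl.
  by move=> /= h /(_ ltac:(lia)); lia.
apply/rowP => p; rewrite [RHS]mxE; have := up _ p erefl.
by have := dn _ p erefl; have := ltn_ord p; lia.
Qed.

(* ws is a reduced word of g: each letter is a left descent of what remains. *)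
Fixpoint red (ws : seq 'I_m.+2) g : bool :=
  if ws is i :: ws' then (hgt g (simple i) < 0) && red ws' (srefl_simple i * g)%g
  else g == 1%g.

Lemma dist_descent g i : hgt g (simple i) < 0 ->
  (dist (srefl_simple i * g)%g < dist g)%N.
Proof. by move=> h; rewrite dist_arefl_lt // simple_pos. Qed.

Lemma red_exists g : exists ws, red ws g.
Proof.
have [k] := ubnP (dist g); elim: k g => // k IH g lek.
have [/existsP[i hi]|] := boolP [exists i, hgt g (simple i) < 0].
  have [|ws rws] := IH (srefl_simple i * g)%g.
    exact: leq_trans (dist_descent hi) lek.
  by exists (i :: ws); rewrite /= hi.
rewrite negb_exists => /forallP no; exists [::] => /=; apply/eqP/dominant_id => i.
by rewrite lt_neqAle eq_sym hgt_neq0 //= leNgt no.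
Qed.

Definition word g : seq 'I_m.+2 := xchoose (red_exists g).
Lemma wordP g : red (word g) g.
Proof. exact: (xchooseP (red_exists g)). Qed.

(** The form in which the lifting property later bounds the support of a product of the T_i. *)
Lemma red_bruhat ws g i : red (i :: ws) g -> forall h, bruhat h (srefl_simple i * g)%g ->
  bruhat (srefl_simple i * h)%g g.
Proof.
move=> /= /andP[hg _] h bv; rewrite -[g](areflK _ (simple_root i)).
apply: bruhat_lift => //; first exact: simple_pos.
  by move=> b pb nb; exact: simple_permP.
by rewrite hgt_arefl_aact // arefl_inv // hgtN oppr_gt0.
Qed.

Variant simple_cospec i : lexp n * int -> lexp n -> Type :=
| Cosimple0 of i = 0 :> nat : simple_cospec i (- (eps ord0 *+ 2), 1) (- eps ord0)
| CosimpleN of i = n :> nat : simple_cospec i (eps ord_max *+ 2, 0) (eps ord_max)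
| CosimpleM (p p' : 'I_n) of p = i.-1 :> nat & p' = i :> nat & (0 < i < n)%N :
   simple_cospec i (eps p - eps p', 0) (eps p - eps p').

Lemma simple_coP i : simple_cospec i (simple i) (coroot (simple i).1).
Proof.
rewrite coroot_simple; case: simpleP => [ei|ei|p p' ep ep' hi].
- by rewrite ei; exact: Cosimple0.
- by rewrite ei eqxx; exact: CosimpleN.
by rewrite !ifF; try lia; exact: CosimpleM.
Qed.

Let dotE := (dotBl, dotBr, dotNl, dotNr, dotMnr).
Let eps0 (p q : 'I_n) : (p : nat) <> q -> dot (eps p) (eps q) = 0.
Proof. by rewrite eps_dot => /eqP; rewrite -val_eqE => /negbTE->. Qed.
Let eps1 (p q : 'I_n) : (p : nat) = q -> dot (eps p) (eps q) = 1.
Proof. by rewrite eps_dot => /val_inj->; rewrite eqxx. Qed.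

Lemma simple_far i j : far i j -> apair (simple i) (simple j) = 0.
Proof.
rewrite /far /apair; case: (simple_coP i) => [ei|ei|p p' ep ep' hi];
case: (simple_coP j) => [ej|ej|x x' ex ex' hj] ij; try lia.
all: rewrite /= ?dotE ?[dot (_ *+ _) _]dotC ?dotE !eps0 //=; lia.
Qed.

Lemma simple_adj3 i j : (0 < i)%N -> (i.+1 < n)%N -> j = i.+1 :> nat ->
  apair (simple i) (simple j) = -1 /\ apair (simple j) (simple i) = -1.
Proof.
move=> i0 iN eij; rewrite /apair; case: (simple_coP i) => [ei|ei|p p' ep ep' hi];
case: (simple_coP j) => [ej|ej|x x' ex ex' hj]; try lia.
have px : dot (eps p) (eps x) = 0 by apply: eps0; lia.
have px' : dot (eps p) (eps x') = 0 by apply: eps0; lia.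
have p'x : dot (eps p') (eps x) = 1 by apply: eps1; lia.
have p'x' : dot (eps p') (eps x') = 0 by apply: eps0; lia.
by rewrite /= !dotE ![dot (eps x) _]dotC ![dot (eps x') _]dotC px px' p'x p'x'.
Qed.

Lemma simple_adj4 i j : (1 < n)%N -> i = 0 :> nat \/ i.+1 = n -> j = i.+1 :> nat ->
  (apair (simple i) (simple j) = -2 /\ apair (simple j) (simple i) = -1) \/
  (apair (simple i) (simple j) = -1 /\ apair (simple j) (simple i) = -2).
Proof.
move=> n1 iN eij; rewrite /apair; case: (simple_coP i) => [ei|ei|p p' ep ep' hi];
case: (simple_coP j) => [ej|ej|x x' ex ex' hj]; try lia; [left|right].
  have e1 : dot (eps ord0) (eps x) = 1 by apply: eps1; rewrite /=; lia.
  have e2 : dot (eps ord0) (eps x') = 0 by apply: eps0; rewrite /=; lia.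
  by rewrite /= [dot (- _) _]dotC !dotE ![dot _ (eps ord0)]dotC e1 e2.
have e1 : dot (eps p') (eps ord_max) = 1 by apply: eps1; rewrite /=; lia.
have e2 : dot (eps p) (eps ord_max) = 0 by apply: eps0; rewrite /=; lia.
by rewrite /= [dot (_ *+ _) _]dotC !dotE e1 e2.
Qed.

Let hs i j g : hgt (srefl_simple i * g)%g (simple j) =
  hgt g (simple j) - apair (simple j) (simple i) * hgt g (simple i).
Proof. exact: hgt_arefl. Qed.
Let ps i g : point (srefl_simple i * g)%g =
  point g - hgt g (simple i) *: coroot (simple i).1.
Proof. exact: point_arefl. Qed.
Let aii i : apair (simple i) (simple i) = 2.
Proof. by rewrite /apair; have [_ ->] := coroot_root (simple_root i). Qed.

Section DihedralPoints.
Variables (r : 'I_m.+2 -> shift_refl n -> shift_refl n).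
Hypothesis rhs : forall i j g, hgt (r i g) (simple j) =
  hgt g (simple j) - apair (simple j) (simple i) * hgt g (simple i).
Hypothesis rps : forall i g, point (r i g) =
  point g - hgt g (simple i) *: coroot (simple i).1.

Let point_far i j g : far i j -> r j (r i g) = r i (r j g).
Proof.
move=> f; have f' : far j i by move: f; rewrite /far; lia.
apply: point_inj; rewrite !rps !rhs (simple_far f) (simple_far f') !mul0r !subr0.
exact: addrAC.
Qed.

Let point_braid3 i j g : (1 <= i)%N -> (i.+2 <= n)%N -> j = i.+1 :> nat ->
  r i (r j (r i g)) = r j (r i (r j g)).
Proof.
move=> i1 iN eij; have [aij aji] := simple_adj3 i1 iN eij.
apply: point_inj; rewrite !rps !rhs !aii aij aji.
by move: (point g) (coroot _) (coroot _) => u x y; apply/rowP => k; rewrite !mxE; ring.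
Qed.

Let point_braid4 i j g : (1 < n)%N -> i = 0 :> nat \/ i.+1 = n -> j = i.+1 :> nat ->
  r j (r i (r j (r i g))) = r i (r j (r i (r j g))).
Proof.
move=> n1 iN eij; have aa := simple_adj4 n1 iN eij.
apply: point_inj; rewrite !rps !rhs !aii; case: aa => -[-> ->];
by move: (point g) (coroot _) (coroot _) => u x y; apply/rowP => k; rewrite !mxE; ring.
Qed.

Definition dihedral_points := (point_far, point_braid3, point_braid4).
End DihedralPoints.

Lemma srefl_far i j g : far i j ->
  (srefl_simple j * (srefl_simple i * g) = srefl_simple i * (srefl_simple j * g))%g.
Proof. exact: (dihedral_points hs ps).1.1. Qed.

Lemma srefl_braid3 i j g : (1 <= i)%N -> (i.+2 <= n)%N -> j = i.+1 :> nat ->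
  (srefl_simple i * (srefl_simple j * (srefl_simple i * g)) =
   srefl_simple j * (srefl_simple i * (srefl_simple j * g)))%g.
Proof. exact: (dihedral_points hs ps).1.2. Qed.

Lemma srefl_braid4 i j g : (1 < n)%N -> i = 0 :> nat \/ i.+1 = n -> j = i.+1 :> nat ->
  (srefl_simple j * (srefl_simple i * (srefl_simple j * (srefl_simple i * g))) =
   srefl_simple i * (srefl_simple j * (srefl_simple i * (srefl_simple j * g))))%g.
Proof. exact: (dihedral_points hs ps).2. Qed.

Section Matsumoto.
Variables (B : pzRingType) (X : 'I_m.+2 -> B).
Hypothesis X_far : forall i j, far i j -> X i * X j = X j * X i.
Hypothesis X_braid3 : forall i j, (1 <= i)%N -> (i.+2 <= n)%N -> j = i.+1 :> nat ->
  X i * X j * X i = X j * X i * X j.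
Hypothesis X_braid4 : forall i j, (1 < n)%N -> (i = 0 :> nat) \/ (i.+1 = n) ->
  j = i.+1 :> nat -> X i * X j * X i * X j = X j * X i * X j * X i.

Definition wprod (ws : seq 'I_m.+2) : B := \prod_(i <- ws) X i.
Lemma wprod_cons i ws : wprod (i :: ws) = X i * wprod ws.
Proof. exact: big_cons. Qed.

(* Two descents generate a finite dihedral group whose longest element is a
   left factor of g. *)
Lemma red_descents g i j : (i < j)%N -> hgt g (simple i) < 0 -> hgt g (simple j) < 0 ->
  exists us vs, [/\ red (i :: us) g, red (j :: vs) g & wprod (i :: us) = wprod (j :: vs)].
Proof.
move=> ij gi gj.
(* For n = 1 the two reflections generate an infinite dihedral group and satisfy no braid relation.
   But then alpha_0 + alpha_1 = delta has height [coxn] > 0, so they are never both descents. *)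
have n1 : (1 < n)%N || far i j.
  have [//|n1] := ltnP 1 n; have i0 : i = 0 :> nat by have := ltn_ord j; lia.
  have : hgt g (simple i) + hgt g (simple j) = coxn n.
    rewrite /hgt; case: (simpleP i) => [ei|ei|p p' ep ep' hi]; try lia.
    case: (simpleP j) => [ej|ej|x x' ex ex' hj]; try (have := ltn_ord j; lia).
    have -> : ord_max = ord0 :> 'I_n by apply: val_inj => /=; lia.
    by rewrite /= dotNr; ring.
  by rewrite /coxn; lia.
have redE x ws h : red (x :: ws) h = (hgt h (simple x) < 0) && red ws (srefl_simple x * h)%g by [].
pose r x h : shift_refl n := (srefl_simple x * h)%g.
have rhs x y h : hgt (r x h) (simple y) =
    hgt h (simple y) - apair (simple y) (simple x) * hgt h (simple x) by exact: hs.
have rfar (f : far i j) : r j (r i g) = r i (r j g) := @srefl_far i j g f.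
have rbr3 (h1 : (1 <= i)%N) (h2 : (i.+2 <= n)%N) (h3 : j = i.+1 :> nat) : r i (r j (r i g)) = r j (r i (r j g)) := @srefl_braid3 i j g h1 h2 h3.
have rbr4 (h1 : (1 < n)%N) (h2 : i = 0 :> nat \/ i.+1 = n) (h3 : j = i.+1 :> nat) : r j (r i (r j (r i g))) = r i (r j (r i (r j g))) :=
  @srefl_braid4 i j g h1 h2 h3.
have {}redE x ws h : red (x :: ws) h = (hgt h (simple x) < 0) && red ws (r x h) by exact: redE.
have rex := @red_exists.
move: (@hgt n) (@red) rhs redE rex gi gj => H Re rhs redE rex gi gj.
clearbody r.
have [f|] := boolP (far i j).
  have f' : far j i by move: f; rewrite /far; lia.
  have aij := simple_far f; have aji := simple_far f'.
  have [z rz] := rex (r j (r i g)).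
  have e := rfar f.
  exists (j :: z), (i :: z); rewrite !wprod_cons !mulrA (X_far f); split.
  - by rewrite !redE rz rhs aji gi mul0r subr0 gj.
  - by rewrite !redE -e rz rhs aij gj mul0r subr0 gi.
  - by [].
rewrite /far => nf; have eij : j = i.+1 :> nat by lia.
have {nf}n1 : (1 < n)%N by move: n1; rewrite /far (negbTE nf) orbF.
have [h3|h4] := boolP ((1 <= i) && (i.+2 <= n))%N.
  case/andP: h3 => i1 iN.
  have [aij aji] := simple_adj3 i1 iN eij.
  have [z rz] := rex (r i (r j (r i g))).
  have e := rbr3 i1 iN eij.
  exists (j :: i :: z), (i :: j :: z); rewrite !wprod_cons !mulrA (X_braid3 i1 iN eij); split.
  - by rewrite !redE rz !rhs !aii aij aji andbT; apply/and3P; split; lia.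
  - by rewrite !redE -e rz !rhs !aii aij aji andbT; apply/and3P; split; lia.
  - by [].
have h4' : i = 0 :> nat \/ i.+1 = n by have := ltn_ord j; lia.
have aa := simple_adj4 n1 h4' eij.
have [z rz] := rex (r j (r i (r j (r i g)))).
have e := rbr4 n1 h4' eij.
exists (j :: i :: j :: z), (i :: j :: i :: z); rewrite !wprod_cons !mulrA (X_braid4 n1 h4' eij); split.
- by rewrite !redE rz !rhs !aii andbT; case: aa => -[-> ->]; apply/and4P; split; lia.
- by rewrite !redE -e rz !rhs !aii andbT; case: aa => -[-> ->]; apply/and4P; split; lia.
- by [].
Qed.

(** Matsumoto's theorem, by induction on [dist]. Words with the same first letter reduce to their
    tails; words with first letters i and j are compared through two reduced words that begin with i
    and j and are related by one braid relation. *)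
Theorem red_uniq ws ws' g : red ws g -> red ws' g -> wprod ws = wprod ws'.
Proof.
have [k] := ubnP (dist g); elim: k ws ws' g => // k IH ws ws' g; rewrite ltnS => lek.
case: ws => [|i us]; case: ws' => [|j vs] //=.
- move=> /eqP-> /andP[]; have /andP[_ +] := simple_pos j; lia.
- move=> /andP[+ _] /eqP eg; rewrite eg; have /andP[_ +] := simple_pos i; lia.
move=> /andP[gi ru] /andP[gj rv].
have lti := leq_trans (dist_descent gi) lek; have ltj := leq_trans (dist_descent gj) lek.
wlog ij : i j us vs gi ru gj rv lti ltj / (i <= j)%N.
  move=> H; case: (leqP i j) => [|/ltnW] ij; first exact: H.
  by apply/esym/H.
move: ij; rewrite leq_eqVlt => /orP[/eqP/val_inj eij|ij].
  by rewrite !wprod_cons eij (IH us vs (srefl_simple j * g)%g) // -eij.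
have [us' [vs' []]] := red_descents ij gi gj.
move=> /= /andP[_ ru'] /andP[_ rv']; rewrite !wprod_cons => e.
by rewrite (IH us us' _ _ ru ru') // e (IH vs vs' _ _ rv rv').
Qed.
End Matsumoto.
End SimpleWords.

(** * Coprimality of binomials in F[T] *)

Lemma subr_unitE (R : comPzRingType) (x y : R) : y * x = 1 -> 1 - y = - y * (1 - x).
Proof. by move=> e; rewrite mulrBr mulr1 mulNr opprK e addrC. Qed.

Lemma mulr_sub1_add1 (R : comPzRingType) (x : R) : (1 - x) * (1 + x) = 1 - x * x.
Proof. ring. Qed.

Lemma mulr_sub1_elim (R : comPzRingType) (c d x y : R) : d * x = c * y ->
  d * (1 - x) + (- c) * (1 - y) = d - c.
Proof. by move=> e; rewrite mulNr !mulrBr !mulr1 e; ring. Qed.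

Section Divisibility.
Variable n : nat.
Implicit Types (f g x y : FT n) (a b v : lexp n) (c d : baseF).

Definition fmon c a : FT n := lmon c a.
Lemma fmonM c d a b : fmon c a * fmon d b = fmon (c * d) (a + b).
Proof. exact: lmonM. Qed.
Lemma fmon1 : fmon 1 0 = 1.
Proof. exact: lmon1. Qed.
Lemma fmonB a c d : fmon (c - d) a = fmon c a - fmon d a.
Proof. exact: monalgUB. Qed.
Lemma fmon_mulV c a : c \is a GRing.unit -> fmon c a * fmon c^-1 (- a) = 1.
Proof. by move=> uc; rewrite fmonM (divrr uc) subrr fmon1. Qed.
Lemma fmon_unit c a : c \is a GRing.unit -> fmon c a \is a GRing.unit.
Proof.
by move=> uc; apply/unitrPr; exists (fmon c^-1 (- a)); rewrite fmon_mulV.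
Qed.
Lemma FT_ind (P : FT n -> Prop) : P 0 -> (forall x y, P x -> P y -> P (x + y)) ->
  (forall c a, P (fmon c a)) -> forall x, P x.
Proof.
move=> P0 PD Pm x; rewrite [x]skewE.
by apply: (big_ind P) => // a _; exact: Pm.
Qed.
Lemma mcoeff_fmon c a b : (fmon c a : {malg baseF[lexp n]})@_b = c *+ (a == b).
Proof. exact: mcoeffU. Qed.

Lemma dividesD f x y : divides f x -> divides f y -> divides f (x + y).
Proof. by move=> [d ->] [e ->]; exists (d + e); rewrite mulrDr. Qed.
Lemma dividesMr f x y : divides f x -> divides f (y * x).
Proof. by move=> [d ->]; exists (y * d); rewrite mulrCA. Qed.
Lemma divides_mull f x : divides f (f * x).
Proof. by exists x. Qed.
Lemma divides0 f : divides f 0.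
Proof. by exists 0; rewrite mulr0. Qed.
Lemma divides_sum f (I : eqType) (r : seq I) (F : I -> FT n) :
  (forall i, i \in r -> divides f (F i)) -> divides f (\sum_(i <- r) F i).
Proof.
move=> h; rewrite big_seq; apply: (big_ind (divides f)) => //; first exact: divides0.
by move=> *; apply: dividesD.
Qed.
Lemma divides_unit f x (u : FT n) : u \is a GRing.unit -> divides (u * f) x <-> divides f x.
Proof.
move=> uu; split=> [[d ->]|[d ->]]; first by exists (u * d); rewrite mulrCA mulrA.
by exists (u^-1 * d); rewrite mulrACA divrr // mul1r.
Qed.

Lemma nzd1 f : nzd f 1.
Proof. by move=> x; rewrite mul1r. Qed.
Lemma nzdM f x y : nzd f x -> nzd f y -> nzd f (x * y).
Proof. by move=> hx hy z; rewrite -mulrA => /hx /hy. Qed.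
Lemma nzd_mulP f x y : nzd f (x * y) -> nzd f x.
Proof. by move=> h z hz; apply: h; rewrite mulrAC mulrC; apply: dividesMr. Qed.
Lemma nzd_sym f x : f != 0 -> nzd f x -> nzd x f.
Proof.
move=> f0 h y [e he]; have [|d ed] := h e; first by exists y; rewrite -he.
by exists d; apply: (mulfI f0); rewrite he ed mulrCA.
Qed.
(** A Bezout criterion whose right-hand side need only be coprime to f. *)
Lemma nzd_comb f x y z (d : FT n) : y * f + z * x = d -> nzd f d -> nzd f x.
Proof.
move=> <- h e he; apply: h; rewrite mulrDl; apply: dividesD.
  by rewrite -mulrA mulrCA; exact: divides_mull.
by rewrite -mulrA; exact: dividesMr.
Qed.
Lemma nzd_unitl f x (u : FT n) : u \is a GRing.unit -> nzd (u * f) x <-> nzd f x.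
Proof.
by move=> uu; split=> h y; [move/(divides_unit _ _ uu)/h/(divides_unit _ _ uu)
 |move/(divides_unit _ _ uu)/h/(divides_unit _ _ uu)].
Qed.
Lemma nzd_unitr f x (u : FT n) : u \is a GRing.unit -> nzd f x -> nzd f (u * x).
Proof.
move=> uu h; apply: nzdM => // y fy.
by have := dividesMr (u^-1) fy; rewrite mulrA mulVr // mul1r.
Qed.
Lemma divides_sr (g0 : shift_refl n) f x : divides f x <-> divides (sr_act g0 f) (sr_act g0 x).
Proof.
split=> [[d ->]|[d e]]; first by exists (sr_act g0 d); rewrite rmorphM.
exists (sr_act g0^-1%g d); apply: (@sr_act_inj _ g0); rewrite rmorphM e /=.
by rewrite -[X in _ = _ * X]sr_actM mulgV sr_act1.
Qed.
Lemma nzd_sr (g0 : shift_refl n) f x : nzd f x -> nzd (sr_act g0 f) (sr_act g0 x).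
Proof.
move=> h y; have -> : y = sr_act g0 (sr_act g0^-1%g y) by rewrite -sr_actM mulgV sr_act1.
by rewrite -rmorphM => hy; apply: (proj1 (divides_sr g0 _ _)); apply: h; apply: (proj2 (divides_sr g0 _ _)).
Qed.

Definition binom c b : FT n := 1 - fmon c b.

Lemma binom_neq0 c b : b != 0 -> binom c b != 0.
Proof.
move=> b0; rewrite subr_eq0 -fmon1; apply/eqP => e.
have := congr1 (fun f : {malg baseF[lexp n]} => f@_(0 : lexp n)) e.
rewrite (mcoeff_fmon 1 0 0) (mcoeff_fmon c b 0) eqxx (negbTE b0) => /eqP.
by rewrite oner_eq0.
Qed.

Lemma binomN c b : c \is a GRing.unit -> binom c (- b) = - fmon c (- b) * binom c^-1 b.
Proof.
move=> uc; apply: (@subr_unitE (FT n) (fmon c^-1 b) (fmon c (- b))).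
by rewrite fmonM (divrr uc) addNr fmon1.
Qed.

(* The component of degree j for the grading of F[T] by <v, .>. *)
Definition gmon v (j : int) u c : FT n := if dot v u == j then fmon c u else 0.
Lemma gmon_additive v j u : zmod_morphism (gmon v j u).
Proof. by move=> c d; rewrite /gmon; case: (_ == j); [rewrite fmonB|rewrite subr0]. Qed.
HB.instance Definition _ v j u :=
  GRing.isZmodMorphism.Build baseF (FT n) (gmon v j u) (gmon_additive v j u).
Definition gproj v j : FT n -> FT n :=
  @skew_sum baseF (lexp n) _ (FT n) (fun u => gmon v j u : {additive baseF -> FT n}).
HB.instance Definition _ v j := GRing.Additive.on (gproj v j).
Lemma gproj_fmon v j c u : gproj v j (fmon c u) = gmon v j u c.
Proof. exact: skew_sumU. Qed.

Lemma gprojM v j c u x : gproj v j (fmon c u * x) = fmon c u * gproj v (j - dot v u) x.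
Proof.
elim/FT_ind: x => [|x y IHx IHy|d y]; first by rewrite mulr0 !raddf0 mulr0.
  by rewrite mulrDr !raddfD /= IHx IHy mulrDr.
rewrite fmonM !gproj_fmon /gmon dotDr.
have -> : (dot v u + dot v y == j) = (dot v y == j - dot v u) by lia.
by case: (_ == _); rewrite ?mulr0 ?fmonM.
Qed.

Lemma gproj_fin v x : exists s : seq int,
  x = \sum_(j <- s) gproj v j x /\ (forall j, j \notin s -> gproj v j x = 0).
Proof.
exists (undup [seq dot v u | u <- msupp (x : {malg baseF[lexp n]})]).
have E j : gproj v j x = \sum_(u <- msupp (x : {malg baseF[lexp n]})) gmon v j u (x : {malg baseF[lexp n]})@_u.
  exact: skew_sumE.
split; last first.
  move=> j; rewrite mem_undup => nj; rewrite E big_seq big1 // => u us.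
  rewrite /gmon ifF //; apply: contraNF nj => /eqP <-; exact: map_f.
rewrite [LHS](skewE x); under [RHS]eq_bigr => j _ do rewrite E.
rewrite exchange_big /= big_seq [RHS]big_seq; apply: eq_bigr => u us.
rewrite (bigD1_seq (dot v u)) /= ?undup_uniq ?mem_undup ?map_f //.
rewrite {1}/gmon eqxx big1 ?addr0 // => j ju.
by rewrite /gmon eq_sym (negbTE ju).
Qed.

(** The first hypothesis says that f is homogeneous of degree 0 for v. If f divides (1 - c e^b) x,
    then the components satisfy x_j = c e^b x_(j - <v, b>) modulo f. Iterating this leaves the
    finite support of x, so f divides every x_j. *)
Lemma nzd_graded v c b f :
  (forall j x, gproj v j (f * x) = f * gproj v j x) -> dot v b != 0 -> nzd f (binom c b).
Proof.
move=> hf vb x [e he].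
have step j : divides f (gproj v j x - fmon c b * gproj v (j - dot v b) x).
  rewrite -gprojM -raddfB /= -[X in X - _]mul1r -mulrBl -/(binom c b) he hf.
  exact: divides_mull.
have [s [xs s0]] := gproj_fin v x.
have [N hN] : exists N : nat, forall j, j \in s -> (`|j|%N < N)%N.
  elim: s {xs s0} => [|j s [N hN]]; first by exists 0%N.
  exists (maxn N `|j|.+1) => l; rewrite inE => /orP[/eqP->|/hN]; lia.
have iter_step k j : divides f (gproj v j x - fmon c b ^+ k * gproj v (j - dot v b *+ k) x).
  elim: k => [|k IH]; first by rewrite expr0 mul1r mulr0n subr0 subrr; exact: divides0.
  have := dividesD IH (dividesMr (fmon c b ^+ k) (step (j - dot v b *+ k))).
  by rewrite mulrBr addrA subrK mulrA -exprSr -addrA -opprD -mulrSr.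
rewrite xs; apply: divides_sum => j _.
(* After N + |j| shifts by a nonzero integer, the degree is outside the range bounded by N. *)
have [M eM] : {M : nat | M = (N + `|j|)%N} by eexists.
have := iter_step M j; rewrite [X in _ * X]s0 ?mulr0 ?subr0 //.
apply/negP => /hN; move: vb; move: (dot v b) => z; rewrite -mulr_natr natz => z0.
have : M%:Z <= `|z * M%:Z|.
  have : 1 <= `|z| by lia.
  rewrite normrM (@ger0_norm _ M%:Z) //; move: (`|z|)%R => y; nia.
by move: (z * _) => y; lia.
Qed.

Lemma binom_graded v c b j x : dot v b = 0 ->
  gproj v j (binom c b * x) = binom c b * gproj v j x.
Proof. move=> e; have E := gprojM v j c b x; rewrite e subr0 in E.
have BE y : binom c b * y = y - fmon c b * y by rewrite [LHS]mulrBl mul1r.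
by rewrite !BE -E; exact: raddfB. Qed.

(** The grading along b itself applies, since <b, b> > 0; [nzd_sym] then exchanges the two sides. *)
Lemma nzd_cst c b d : d != 0 -> b != 0 -> nzd (binom c b) (cst n d).
Proof.
move=> d0 b0; apply: nzd_sym.
  apply/eqP => e; have := congr1 (fun f : {malg baseF[lexp n]} => f@_(0 : lexp n)) e.
  by rewrite mcoeffUU mcoeff0 => /eqP; rewrite (negbTE d0).
apply: (@nzd_graded b).
  move=> j x; have := gprojM b j d 0 x; rewrite dot0r subr0; exact.
have : 0 <= dot b b by apply: sumr_ge0 => i _; rewrite -expr2 sqr_ge0.
rewrite le_eqVlt => /orP[/eqP/esym e|/lt0r_neq0 //].
have {}e i : b 0 i = 0.
  move/eqP: e; rewrite /dot psumr_eq0 => [/allP/(_ i (mem_index_enum i))/=|k _].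
    by rewrite mulf_eq0 orbb => /eqP.
  by rewrite -expr2 sqr_ge0.
by case/eqP: b0; apply/rowP => i; rewrite e mxE.
Qed.

Lemma nzd_binom_indep v c b d b' : dot v b = 0 -> dot v b' != 0 -> nzd (binom c b) (binom d b').
Proof. by move=> e; apply: nzd_graded => j x; exact: binom_graded. Qed.

Lemma fmon_cst c d b : cst n c * fmon d b = fmon (c * d) b.
Proof. by rewrite fmonM add0r. Qed.

(** The combination d (1 - c e^b) - c (1 - d e^b) is the nonzero constant d - c. *)
Lemma nzd_binom_eq c d b : b != 0 -> c != d -> nzd (binom c b) (binom d b).
Proof.
move=> b0 cd.
have e : cst n d * fmon c b = cst n c * fmon d b.
  exact: (etrans (fmon_cst d c b)
    (etrans (congr1 (fun z => fmon z b) (mulrC d c)) (esym (fmon_cst c d b)))).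
have e3 : cst n d - cst n c = cst n (d - c) by exact/esym/(rmorphB (@cst n)).
have e2 : cst n d * binom c b + (- cst n c) * binom d b = cst n (d - c).
  exact: (etrans (mulr_sub1_elim e) e3).
apply: (nzd_comb e2).
apply: nzd_cst b0.
rewrite subr_eq0 eq_sym.
exact: cd.
Qed.

(** Reduces to equal exponents, as 1 - d e^b divides 1 - d^2 e^(2b). *)
Lemma nzd_binom_dbl c d b : b != 0 -> c != d ^+ 2 -> nzd (binom c (b *+ 2)) (binom d b).
Proof.
move=> b0 cd; apply: (@nzd_mulP _ _ (1 + fmon d b)).
have -> : binom d b * (1 + fmon d b) = binom (d ^+ 2) (b *+ 2).
  by rewrite /binom mulr2n expr2 -fmonM; exact: (@mulr_sub1_add1 (FT n)).
apply: nzd_binom_eq cd; apply: contra_neq b0 => e; apply/rowP => i.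
have := congr1 (fun v : 'rV_n => v 0 i) e; rewrite mulr2n !mxE.
by move: (b 0 i) => z; lia.
Qed.

Lemma nzd_binomN c d b b' : c \is a GRing.unit ->
  nzd (binom c^-1 b) (binom d b') -> nzd (binom c (- b)) (binom d b').
Proof.
move=> uc h; rewrite binomN //; apply/nzd_unitl => //.
by rewrite unitrN fmon_unit .
Qed.
End Divisibility.

(** * Monomials in the parameters *)

Section ParameterMonomials.
Implicit Types (s : bool) (e : lexp 6).

(* The parameter monomial with exponent vector e and sign (-1)^s. *)
Definition pmon s e : baseF := lmon ((-1) ^+ s) e.

(** Exponents of q^(1/2), t^(1/2), t_0^(1/2), t_n^(1/2), u_0^(1/2), u_n^(1/2), in this order. *)
Definition row6 (x0 x1 x2 x3 x4 x5 : int) : lexp 6 :=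
  \row_j nth 0 [:: x0; x1; x2; x3; x4; x5] j.

Lemma pmonM s s' e e' : pmon s e * pmon s' e' = pmon (s (+) s') (e + e').
Proof. by apply: etrans (lmonM _ _ _ _) _; rewrite -signr_addb. Qed.
Lemma pmon1 : pmon false 0 = 1.
Proof. by []. Qed.
Lemma pmon_mulV s e : pmon s e * pmon s (- e) = 1.
Proof. by rewrite pmonM addbb subrr pmon1. Qed.
Lemma pmon_unit s e : pmon s e \is a GRing.unit.
Proof. by apply/unitrPr; exists (pmon s (- e)); exact: pmon_mulV. Qed.
Lemma pmonV s e : (pmon s e)^-1 = pmon s (- e).
Proof.
apply: (mulrI (pmon_unit s e)); apply: etrans (divrr (pmon_unit s e)) _.
by rewrite pmon_mulV.
Qed.
Lemma pmonN s e : - pmon s e = pmon (~~ s) e.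
Proof.
rewrite -mulN1r -[1]pmon1.
have -> : - pmon false 0 = pmon true 0 by exact/esym/monalgUN.
by rewrite pmonM add0r.
Qed.
Lemma pmonX s e : pmon s e ^+ 2 = pmon false (e + e).
Proof. by rewrite expr2 pmonM addbb. Qed.

Lemma pmon_inj s s' e e' : pmon s e = pmon s' e' -> s = s' /\ e = e'.
Proof.
move=> h; have := congr1 (fun f : {malg int[lexp 6]} => f@_e) h.
rewrite /pmon /lmon /smon !mcoeffU eqxx; have [->|ne] := eqVneq e' e.
  by case: s {h}; case: s' => //.
by rewrite mulr0n; case: s {h}.
Qed.

Lemma row6D x0 x1 x2 x3 x4 x5 y0 y1 y2 y3 y4 y5 :
  row6 x0 x1 x2 x3 x4 x5 + row6 y0 y1 y2 y3 y4 y5 =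
  row6 (x0 + y0) (x1 + y1) (x2 + y2) (x3 + y3) (x4 + y4) (x5 + y5).
Proof. by apply/rowP => -[[|[|[|[|[|[|//]]]]]] i]; rewrite !mxE. Qed.
Lemma row6N x0 x1 x2 x3 x4 x5 :
  - row6 x0 x1 x2 x3 x4 x5 = row6 (- x0) (- x1) (- x2) (- x3) (- x4) (- x5).
Proof. by apply/rowP => -[[|[|[|[|[|[|//]]]]]] i]; rewrite !mxE. Qed.
Lemma row6_inj x0 x1 x2 x3 x4 x5 y0 y1 y2 y3 y4 y5 :
  row6 x0 x1 x2 x3 x4 x5 = row6 y0 y1 y2 y3 y4 y5 ->
  [/\ x0 = y0, x1 = y1 & x2 = y2] /\ [/\ x3 = y3, x4 = y4 & x5 = y5].
Proof.
move=> h.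
have H i (lt : (i < 6)%N) : nth 0 [:: x0; x1; x2; x3; x4; x5] i = nth 0 [:: y0; y1; y2; y3; y4; y5] i.
  by have := congr1 (fun v : 'rV_6 => v 0 (Ordinal lt)) h; rewrite !mxE.
by split; split; [exact: (H 0%N)|exact: (H 1%N)|exact: (H 2)|exact: (H 3)|exact: (H 4)|exact: (H 5)].
Qed.
Lemma row60 : row6 0 0 0 0 0 0 = 0.
Proof. by apply/rowP => -[[|[|[|[|[|[|//]]]]]] i]; rewrite !mxE. Qed.

Lemma pmon_row s x0 x1 x2 x3 x4 x5 y0 y1 y2 y3 y4 y5 :
  x0 = y0 -> x1 = y1 -> x2 = y2 -> x3 = y3 -> x4 = y4 -> x5 = y5 ->
  pmon s (row6 x0 x1 x2 x3 x4 x5) = pmon s (row6 y0 y1 y2 y3 y4 y5).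
Proof. by move=> -> -> -> -> -> ->. Qed.

Lemma paramE (i : nat) e : delta_mx 0 (inord i) = e -> param i = pmon false e.
Proof. by move=> <-. Qed.
Lemma pE0 : qh = pmon false (row6 1 0 0 0 0 0).
Proof.
by apply: paramE; apply/rowP => -[[|[|[|[|[|[|//]]]]]] i]; rewrite !mxE eqxx -val_eqE /= inordK.
Qed.
Lemma pE1 : th = pmon false (row6 0 1 0 0 0 0).
Proof.
by apply: paramE; apply/rowP => -[[|[|[|[|[|[|//]]]]]] i]; rewrite !mxE eqxx -val_eqE /= inordK.
Qed.
Lemma pE2 : t0h = pmon false (row6 0 0 1 0 0 0).
Proof.
by apply: paramE; apply/rowP => -[[|[|[|[|[|[|//]]]]]] i]; rewrite !mxE eqxx -val_eqE /= inordK.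
Qed.
Lemma pE3 : tnh = pmon false (row6 0 0 0 1 0 0).
Proof.
by apply: paramE; apply/rowP => -[[|[|[|[|[|[|//]]]]]] i]; rewrite !mxE eqxx -val_eqE /= inordK.
Qed.
Lemma pE4 : u0h = pmon false (row6 0 0 0 0 1 0).
Proof.
by apply: paramE; apply/rowP => -[[|[|[|[|[|[|//]]]]]] i]; rewrite !mxE eqxx -val_eqE /= inordK.
Qed.
Lemma pE5 : unh = pmon false (row6 0 0 0 0 0 1).
Proof.
by apply: paramE; apply/rowP => -[[|[|[|[|[|[|//]]]]]] i]; rewrite !mxE eqxx -val_eqE /= inordK.
Qed.

Lemma q_pmon (k : int) : q ^ k = pmon false (row6 (k * 2) 0 0 0 0 0).
Proof.
have q1 : q = pmon false (row6 2 0 0 0 0 0) by rewrite /q pE0 pmonX row6D.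
have nn (m : nat) : q ^+ m = pmon false (row6 (m%:Z * 2) 0 0 0 0 0).
  elim: m => [|m IH]; first by rewrite mul0r row60.
  by rewrite exprS IH q1 pmonM row6D; apply: pmon_row; lia.
case: k => m; first exact: nn.
have -> : q ^ Negz m = (q ^+ m.+1)^-1 by [].
by rewrite nn pmonV row6N; apply: pmon_row; lia.
Qed.

(** The weight in t, t_0 and t_n. It is positive on the numerator constants, zero on powers of q,
    and changes sign under inversion; this separates numerator factors from root factors, and
    numerator factors of opposite roots from each other. *)
Definition pwt e : int := e 0 (inord 1) + e 0 (inord 2) + e 0 (inord 3).
Lemma pwt_row6 x0 x1 x2 x3 x4 x5 : pwt (row6 x0 x1 x2 x3 x4 x5) = x1 + x2 + x3.
Proof. by rewrite /pwt !mxE !inordK. Qed.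
Lemma pwtD e e' : pwt (e + e') = pwt e + pwt e'.
Proof. by rewrite /pwt !mxE; ring. Qed.
Lemma pwtN e : pwt (- e) = - pwt e.
Proof. by rewrite /pwt !mxE; ring. Qed.
End ParameterMonomials.

(** * Root factors and numerator factors of an affine root *)

Section Numerators.
Variable n : nat.
Implicit Types (a u v : lexp n) (b c : lexp n * int).

(* The constants p for which 1 - p e^(coroot a) is a factor of the numerator of the
   reflection coefficient attached to the affine root b = (a, k). *)
Definition nums b : seq baseF :=
  if dot b.1 b.1 == 2 then [:: pmon false (row6 (b.2 * 2) 2 0 0 0 0)]
  else if odd `|b.2| then
    [:: pmon false (row6 b.2 0 1 0 1 0); pmon true (row6 b.2 0 1 0 (-1) 0)]
  else [:: pmon false (row6 b.2 0 0 1 0 1); pmon true (row6 b.2 0 0 1 0 (-1))].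

Definition rfac b : FT n := binom (q ^ b.2) b.1.
Definition nfac b (p : baseF) : FT n := binom p (coroot b.1).

Lemma mem_seq2 (T : eqType) (x y z : T) : x \in [:: y; z] -> x = y \/ x = z.
Proof. by rewrite !inE => /orP[] /eqP; [left|right]. Qed.
Lemma mem_single (T : eqType) (x y : T) : x \in [:: y] -> x = y.
Proof. by rewrite inE => /eqP. Qed.

Definition sg (s : bool) : int := if s then -1 else 1.
Variant nums_spec b : baseF -> Prop :=
| NumShort of dot b.1 b.1 = 2 : nums_spec b (pmon false (row6 (b.2 * 2) 2 0 0 0 0))
| NumOdd s of dot b.1 b.1 != 2 & odd `|b.2| : nums_spec b (pmon s (row6 b.2 0 1 0 (sg s) 0))
| NumEven s of dot b.1 b.1 != 2 & ~~ odd `|b.2| : nums_spec b (pmon s (row6 b.2 0 0 1 0 (sg s))).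

Lemma numsP b p : p \in nums b -> nums_spec b p.
Proof.
rewrite /nums; case: eqP => [e /mem_single ->|/eqP e]; first exact: NumShort.
case: (boolP (odd _)) => o /mem_seq2[] ->.
- exact: (@NumOdd _ false).
- exact: (@NumOdd _ true).
- exact: (@NumEven _ false).
- exact: (@NumEven _ true).
Qed.

Lemma nums_pmon b p : p \in nums b -> exists s e, p = pmon s e /\ 0 < pwt e.
Proof. by case/numsP => *; eexists; eexists; (split; [reflexivity|rewrite pwt_row6]). Qed.

Lemma nums_unit b p : p \in nums b -> p \is a GRing.unit.
Proof. by case/nums_pmon => s [e [-> _]]; exact: pmon_unit. Qed.

(** The exponent of q^(1/2) in a numerator constant is 2k for a short root and k for a long one, so
    it recovers k. *)
Lemma nums_sep b c p : b.1 = c.1 -> p \in nums b -> p \in nums c -> b = c.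
Proof.
move=> ebc pb pc.
have H : forall x, nums_spec b x -> nums_spec c x -> b.2 = c.2; last first.
  by have := H p (numsP pb) (numsP pc); case: b c ebc {pb pc H} => [a k] [a' l] /= -> ->.
move=> {pb pc} x hb hc.
have {hb}[s [e [xe he]]] : exists s e, x = pmon s e /\ (if dot c.1 c.1 == 2 then e 0 0 = b.2 * 2 else e 0 0 = b.2).
  by case: hb => [e|s e _|s e _]; do 2 eexists; (split; [reflexivity|]); rewrite -ebc ?e ?eqxx ?(negbTE e) mxE.
have {hc}[s' [e' [xe' he']]] : exists s e, x = pmon s e /\ (if dot c.1 c.1 == 2 then e 0 0 = c.2 * 2 else e 0 0 = c.2).
  by case: hc => [f|s' f _|s' f _]; do 2 eexists; (split; [reflexivity|]); rewrite ?f ?eqxx ?(negbTE f) mxE.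
move: xe'; rewrite xe => /pmon_inj[_ ee]; move: he he'; rewrite ee.
by case: ifP => _ -> //; lia.
Qed.

Lemma coroot_neq0 a : isroot a -> coroot a != 0.
Proof.
move=> ra; have [_ e _] := coroot_root ra; apply: contra_eq_neq e => ->.
by rewrite dot0r.
Qed.

(** The witness is a multiple of the component of a' orthogonal to a. If it pairs to 0 with a', it
    is 0, and <a, a'>^2 = <a, a> <a', a'> is 4, 8 or 16. As 8 is not a square, the lengths agree and
    a' is a or -a. *)
Lemma root_indep a a' : isroot a -> isroot a' -> a != a' -> a != - a' ->
  exists v, dot v a = 0 /\ dot v a' != 0.
Proof.
move=> ra ra' d1 d2; have [_ _ aa] := coroot_root ra; have [_ _ aa'] := coroot_root ra'.
set v := dot a a *: a' - dot a a' *: a.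
have va : dot v a = 0 by rewrite /v dotBl !dotZl [dot a' a]dotC; ring.
exists v; split=> //; apply/eqP => va'.
have vv : dot v v = 0 by rewrite {2}/v dotBr !dotZr va va'; ring.
have {}vv i : v 0 i = 0.
  move/eqP: vv; rewrite {1}/dot psumr_eq0 => [/allP/(_ i (mem_index_enum i))|k _].
    by rewrite mulf_eq0 orbb => /eqP.
  by rewrite -expr2 sqr_ge0.
have e : dot a a *: a' = dot a a' *: a.
  by apply/eqP; rewrite -subr_eq0; apply/eqP/rowP => i; rewrite -/v vv mxE.
have e1 : dot a a * dot a' a' = dot a a' * dot a a' by rewrite -dotZl e dotZl.
have hd : dot a a' = dot a a \/ dot a a' = - dot a a.
  have sq (x y : int) : x * x = y * y -> x = y \/ x = - y.
    by rewrite -!expr2 => /eqP; rewrite eqf_sqr => /orP[] /eqP; [left|right].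
  have n8 (x : int) : x * x <> 8.
    move=> h; have : (`|x| * `|x|)%N = 8%N by rewrite -abszM h.
    by case: `|x|%N => [|[|[|y]]] //; lia.
  move: e1; case: aa => ->; case: aa' => ->; try by move/esym/n8.
    by move/esym/(sq _ 2).
  by move/esym/(sq _ 4).
have aa0 : dot a a != 0 by case: aa => ->.
have sc (x y : lexp n) : dot a a *: x = dot a a *: y -> x = y.
  move=> h; apply/rowP => i; apply: (mulfI aa0).
  by have := congr1 (fun v : 'rV_n => v 0 i) h; rewrite !mxE.
case: hd => hd; rewrite hd in e.
  by move/sc: e => e; rewrite e eqxx in d1.
by case/eqP: d2; apply: sc; rewrite scalerN e scaleNr opprK.
Qed.

Lemma dot_coroot_root v a : isroot a -> dot a a * dot v (coroot a) = 2 * dot v a.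
Proof. by move=> ra; have [e _ _] := coroot_root ra; rewrite -dotZr e dotZr. Qed.

Lemma dot_coroot0 v a : isroot a -> (dot v (coroot a) == 0) = (dot v a == 0).
Proof.
move=> ra; have := dot_coroot_root v ra; have [_ _ aa] := coroot_root ra.
by case: aa => -> e; apply/eqP/eqP; lia.
Qed.

Lemma q_unitZ (k : int) : q ^ k \is a GRing.unit.
Proof. by rewrite q_pmon pmon_unit. Qed.
Lemma qV (k : int) : (q ^ k)^-1 = q ^ (- k).
Proof. by rewrite (q_pmon k) (q_pmon (- k)) pmonV row6N; apply: pmon_row; lia. Qed.

Lemma rfac_neq0 b : isroot b.1 -> rfac b != 0.
Proof. by move=> rb; apply: binom_neq0; exact: root_neq0. Qed.
Lemma nfac_neq0 b p : isroot b.1 -> nfac b p != 0.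
Proof. by move=> rb; apply: binom_neq0; exact: coroot_neq0. Qed.

Lemma rfac_nzd b c : isroot b.1 -> isroot c.1 -> b <> c -> b <> - c ->
  nzd (rfac b) (rfac c).
Proof.
case: b c => [a k] [a' l] /= ra ra' d1 d2; rewrite /rfac /=.
have qq (i j : int) : i <> j -> q ^ i != q ^ j.
  move=> ij; apply/eqP; rewrite !q_pmon => /pmon_inj[_ /row6_inj[[e _ _] _]]; lia.
have [e1|n1] := eqVneq a a'.
  rewrite e1 in d1 *; apply: nzd_binom_eq; first exact: root_neq0.
  by apply: qq => e; apply: d1; rewrite e.
have [e2|n2] := eqVneq a (- a').
  rewrite e2 in d2 *; apply: nzd_binomN; first exact: q_unitZ.
  rewrite qV; apply: nzd_binom_eq; first exact: root_neq0.
  by apply: qq => e; apply: d2; rewrite -e; congr pair; rewrite /= opprK.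
have [v [va va']] := root_indep ra ra' n1 n2.
exact: nzd_binom_indep va va'.
Qed.

Lemma coroot_mul2 a : isroot a -> dot a a != 2 -> a = coroot a *+ 2.
Proof.
move=> ra; have [e _ [->//|aa] _] := coroot_root ra.
move: (coroot a) e => u e.
apply/rowP => i; have := congr1 (fun v : 'rV_n => v 0 i) e; rewrite aa mulr2n !mxE.
by move: (u 0 i) (a 0 i) => x y; lia.
Qed.

(** Parallel roots are the delicate case. A short root requires q^k and p to differ; a long root is
    twice its coroot and requires q^k and p^2 to differ. The weight [pwt] separates them. *)
Lemma rfac_nfac_nzd b c p : isroot b.1 -> isroot c.1 -> p \in nums c ->
  nzd (rfac b) (nfac c p).
Proof.
case: b c => [a k] [a' l] ra ra' pp; have [s [e [ep we]]] := nums_pmon pp.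
have main (i : int) : nzd (binom (q ^ i) a') (binom p (coroot a')).
  have [_ _ aa] := coroot_root ra'; rewrite /= in ra' aa.
  case: aa => aa.
    rewrite (_ : coroot a' = a'); last first.
      by apply: coroot_eq; rewrite ?aa.
    apply: nzd_binom_eq; first exact: root_neq0.
    apply/eqP; rewrite q_pmon ep => /pmon_inj[_ /esym eq_e].
    by move: we; rewrite eq_e pwt_row6.
  rewrite {1}(coroot_mul2 ra'); last by rewrite aa.
  apply: nzd_binom_dbl; first exact: coroot_neq0.
  apply/eqP; rewrite q_pmon ep pmonX => /pmon_inj[_ eq_e].
  have := pwtD e e; rewrite -eq_e pwt_row6; lia.
rewrite /rfac /nfac /=; rewrite /= in ra ra'.
have [->|n1] := eqVneq a a'; first exact: main.
have [->|n2] := eqVneq a (- a').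
  by apply: nzd_binomN; [exact: q_unitZ|rewrite qV].
have [v [va va']] := root_indep ra ra' n1 n2.
by apply: nzd_binom_indep va _; rewrite dot_coroot0.
Qed.

Lemma nfac_nzd b c p r : isroot b.1 -> isroot c.1 -> p \in nums b -> r \in nums c ->
  (b, p) <> (c, r) -> nzd (nfac b p) (nfac c r).
Proof.
move=> rb rc pb rc' ne; rewrite /nfac.
have [s [e [ep we]]] := nums_pmon pb; have [s' [e' [er we']]] := nums_pmon rc'.
have [e1|n1] := eqVneq b.1 c.1.
  rewrite e1; apply: nzd_binom_eq; first exact: coroot_neq0.
  apply/eqP => epr; rewrite -epr in rc'; have ebc := nums_sep e1 pb rc'.
  by apply: ne; rewrite ebc epr.
have [e2|n2] := eqVneq b.1 (- c.1).
  rewrite e2 corootN //; apply: nzd_binomN; first exact: nums_unit pb.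
  apply: nzd_binom_eq; first exact: coroot_neq0.
  apply/eqP; rewrite ep er pmonV => /pmon_inj[_ ee]; move: we'; rewrite -ee pwtN; lia.
have [v [va va']] := root_indep rb rc n1 n2.
by apply: (@nzd_binom_indep _ v); [apply/eqP; rewrite dot_coroot0 // va|rewrite dot_coroot0].
Qed.
End Numerators.

(** * Regularity and vanishing along a divisor *)

Section LocalConditions.
Variable n : nat.
Implicit Types (f x y : FT n) (h : FTfrac n) (g : shift_refl n) (b : lexp n * int).

Lemma reg_tofrac f x : regular_along f (tofrac x).
Proof. by exists 1, x; split; [exact: nzd1|rewrite tofrac1 mulr1]. Qed.
Lemma regD f h h' : regular_along f h -> regular_along f h' -> regular_along f (h + h').
Proof.
move=> [x [y [nx e]]] [x' [y' [nx' e']]]; exists (x * x'), (y * x' + y' * x).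
split; first exact: nzdM.
by rewrite !rmorphD !rmorphM /= -e -e' mulrDl !mulrA; congr (_ + _); rewrite mulrAC.
Qed.
Lemma regM f h h' : regular_along f h -> regular_along f h' -> regular_along f (h * h').
Proof.
move=> [x [y [nx e]]] [x' [y' [nx' e']]]; exists (x * x'), (y * y').
by split; [exact: nzdM|rewrite !rmorphM /= -e -e' mulrACA].
Qed.
Lemma van_reg f h : vanishes_on f h -> regular_along f h.
Proof. by move=> [x [y [nx e]]]; exists x, (f * y). Qed.
Lemma vanM f h h' : vanishes_on f h -> regular_along f h' -> vanishes_on f (h * h').
Proof.
move=> [x [y [nx e]]] [x' [y' [nx' e']]]; exists (x * x'), (y * y').
by split; [exact: nzdM|rewrite !rmorphM /= mulrACA e e' rmorphM /= mulrA].
Qed.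
Lemma vanMl f h h' : regular_along f h' -> vanishes_on f h -> vanishes_on f (h' * h).
Proof. by move=> r v; rewrite mulrC; exact: vanM. Qed.
Lemma van_tofrac f : vanishes_on f (tofrac f).
Proof. by exists 1, 1; split; [exact: nzd1|rewrite tofrac1 !mulr1]. Qed.
Lemma vanD f h h' : vanishes_on f h -> vanishes_on f h' -> vanishes_on f (h + h').
Proof.
move=> [x [y [nx e]]] [x' [y' [nx' e']]]; exists (x * x'), (y * x' + y' * x).
split; first exact: nzdM.
have -> : f * (y * x' + y' * x) = f * y * x' + f * y' * x by rewrite mulrDr !mulrA.
rewrite tofracD (tofracM (f * y)) (tofracM (f * y')) -e -e' tofracM mulrDl !mulrA.
by congr (_ + _); rewrite mulrAC.
Qed.
Lemma van0 f : vanishes_on f 0.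
Proof. by exists 1, 0; split; [exact: nzd1|rewrite mul0r mulr0 tofrac0]. Qed.
Lemma reg0 f : regular_along f 0.
Proof. exact/van_reg/van0. Qed.
Lemma regN f h : regular_along f h -> regular_along f (- h).
Proof. by move=> [x [y [nx e]]]; exists x, (- y); rewrite rmorphN mulNr e. Qed.
Lemma regB f h h' : regular_along f h -> regular_along f h' -> regular_along f (h - h').
Proof. by move=> hh /regN; exact: regD. Qed.
Lemma reg_van f h : f != 0 -> vanishes_on f (tofrac f * h) -> regular_along f h.
Proof.
move=> f0 [x [y [nx e]]]; exists x, y; split=> //.
by apply: (@mulfI _ (tofrac f)); rewrite ?tofrac_eq0 // mulrA e rmorphM.
Qed.
Lemma van_mul f h : regular_along f h -> vanishes_on f (tofrac f * h).
Proof. by move=> r; apply: vanM => //; exact: van_tofrac. Qed.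
Lemma reg_inv f x : x != 0 -> nzd f x -> regular_along f (tofrac x)^-1.
Proof.
by move=> x0 nx; exists x, 1; rewrite mulVf ?tofrac_eq0 ?tofrac1.
Qed.

Lemma reg_sr g f h : regular_along f h -> regular_along (sr_act g f) (sr_K g h).
Proof.
move=> [x [y [nx e]]]; exists (sr_act g x), (sr_act g y); split; first exact: nzd_sr.
by rewrite -!sr_KE -rmorphM e.
Qed.
Lemma van_sr g f h : vanishes_on f h -> vanishes_on (sr_act g f) (sr_K g h).
Proof.
move=> [x [y [nx e]]]; exists (sr_act g x), (sr_act g y); split; first exact: nzd_sr.
by rewrite -rmorphM /= -!sr_KE -rmorphM e.
Qed.
Lemma reg_unit (u : FT n) f h : u \is a GRing.unit -> regular_along (u * f) h <-> regular_along f h.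
Proof.
move=> uu; split=> -[x [y [nx e]]]; exists x, y; split=> //.
  exact/(nzd_unitl f x uu).
exact/(nzd_unitl f x uu).
Qed.
Lemma van_unit (u : FT n) f h : u \is a GRing.unit -> vanishes_on (u * f) h <-> vanishes_on f h.
Proof.
move=> uu; split=> -[x [y [nx e]]].
  by exists x, (u * y); split; [exact/(nzd_unitl f x uu)|rewrite e mulrCA mulrA].
exists x, (u^-1 * y); split; first exact/(nzd_unitl f x uu).
by rewrite e mulrACA divrr // mul1r.
Qed.

Lemma rfacE b : 1 - eaff b.1 b.2 = rfac b.
Proof. by []. Qed.

Lemma rfacN b : exists2 u : FT n, u \is a GRing.unit & rfac (- b) = u * rfac b.
Proof.
have uq := q_unitZ (- b.2).
exists (- fmon (q ^ (- b.2)) (- b.1)); first by rewrite unitrN fmon_unit.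
apply: etrans (binomN b.1 uq) _; rewrite qV opprK; by [].
Qed.

Lemma reg_loc f h : (forall b, isroot b.1 -> nzd f (rfac b)) -> h \in @in_loc n ->
  regular_along f h.
Proof.
move=> nf /asboolP[y [s [rs ->]]]; apply: regM; first exact: reg_tofrac.
apply: reg_inv; first exact: den_neq0.
elim: s rs => [|b s IH] /=; first by move=> _; rewrite /den big_nil; exact: nzd1.
by case/andP=> rb /IH ns; rewrite /den big_cons; apply: nzdM ns; exact: nf.
Qed.

Lemma nfac_reg_loc b p h : isroot b.1 -> p \in nums b -> h \in @in_loc n ->
  regular_along (nfac b p) h.
Proof.
move=> rb pb; apply: reg_loc => c rc; apply: nzd_sym; first exact: rfac_neq0.
exact: rfac_nfac_nzd.
Qed.

(** Regularity along 1 - e^b forces this factor of the denominator to divide the numerator, so the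
    factors cancel one at a time. The factor of a negative root is a unit times that of its
    opposite. *)
Lemma loc_int h : h \in @in_loc n ->
  (forall b, apos b -> regular_along (rfac b) h) -> exists x, h = tofrac x.
Proof.
move=> /asboolP[y [s [rs ->]]] reg.
elim: s y rs reg => [|b s IH] y /=.
  by exists y; rewrite /den big_nil tofrac1 divr1.
case/andP=> rb rs reg.
have [x [z [nx e]]] : regular_along (rfac b) (tofrac y / tofrac (den (b :: s))).
  have [pb|] := boolP (apos b); first exact: reg.
  rewrite -aposN // => pb; have [u uu e] := rfacN b.
  by have := reg _ pb; rewrite e => /(reg_unit _ _ uu).
have b0 := rfac_neq0 rb; have s0 := den_neq0 rs.
have eden : den (b :: s) = rfac b * den s by rewrite /den big_cons.
have [w ew] : divides (rfac b) y.
  apply: nx; exists (den s * z); apply/eqP; rewrite mulrA -eden [x * y]mulrC -tofrac_eq rmorphM /=.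
  rewrite [X in _ == X]rmorphM /= -e; apply/eqP.
  rewrite mulrA [tofrac (den _) * (_ / _)]mulrC divfK ?tofrac_eq0 //.
  by rewrite eden mulf_neq0.
have ey : tofrac y / tofrac (den (b :: s)) = tofrac w / tofrac (den s).
  by rewrite eden ew !rmorphM /= invfM mulrACA divff ?tofrac_eq0 // mul1r.
by rewrite ey in reg *; apply: IH.
Qed.

Lemma loc_div x h : x != 0 -> vanishes_on x h -> h \in @in_loc n ->
  h / tofrac x \in @in_loc n.
Proof.
move=> x0 [b [c [nb e]]] /asboolP[y [s [rs eh]]]; apply/asboolP.
have s0 := den_neq0 rs.
have [w ew] : divides x y.
  apply: nb; exists (c * den s); apply/eqP; rewrite mulrA -tofrac_eq rmorphM /=.
  rewrite [X in _ == X]rmorphM /= -e eh; apply/eqP.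
  by rewrite mulrAC divfK ?tofrac_eq0 // mulrC.
exists w, s; split=> //; rewrite eh ew rmorphM /= mulrAC [tofrac x * _]mulrC mulfK ?tofrac_eq0 //.
Qed.

Lemma loc_rfac_inv b : isroot b.1 -> (tofrac (rfac b))^-1 \in @in_loc n.
Proof.
move=> rb; apply/asboolP; exists 1, [:: b]; rewrite /= rb; split=> //.
by rewrite /den big_cons big_nil mulr1 tofrac1 mul1r.
Qed.

Lemma sr_rfac g b : sr_act g (rfac b) = rfac (aact g b).
Proof. by rewrite -rfacE rmorphB rmorph1 /= sr_act_eaff. Qed.

Lemma sr_fmon g c a : sr_act g (fmon c a) = fmon (c * q ^ dot g.1 (wact g.2 a)) (wact g.2 a).
Proof. exact: sr_actU. Qed.

Lemma nums_short b : dot b.1 b.1 = 2 -> pmon false (row6 (b.2 * 2) 2 0 0 0 0) \in nums b.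
Proof. by rewrite /nums => ->; rewrite eqxx mem_head. Qed.
Lemma nums_odd b s : dot b.1 b.1 != 2 -> odd `|b.2| ->
  pmon s (row6 b.2 0 1 0 (sg s) 0) \in nums b.
Proof.
rewrite /nums => /negbTE-> ->; case: s; last by rewrite mem_head.
by rewrite in_cons mem_head orbT.
Qed.
Lemma nums_even b s : dot b.1 b.1 != 2 -> ~~ odd `|b.2| ->
  pmon s (row6 b.2 0 0 1 0 (sg s)) \in nums b.
Proof.
rewrite /nums => /negbTE-> /negbTE->; case: s; last by rewrite mem_head.
by rewrite in_cons mem_head orbT.
Qed.

Lemma coroot_short2 (a : lexp n) : isroot a -> dot a a = 2 -> coroot a = a.
Proof. by move=> ra e; apply: coroot_eq; rewrite ?e. Qed.

(** For a long root, g shifts k by an even number, so the parity that selects (t_0, u_0) or (t_n,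
    u_n) is preserved. *)
Lemma nums_sr g b p : isroot b.1 -> p \in nums b ->
  exists2 p', p' \in nums (aact g b) & sr_act g (nfac b p) = nfac (aact g b) p'.
Proof.
move=> rb pb; set e := dot g.1 (wact g.2 (coroot b.1)).
have -> : sr_act g (nfac b p) = nfac (aact g b) (p * q ^ e).
  rewrite /nfac /binom coroot_wact //.
  by rewrite -sr_fmon; apply: etrans (rmorphB (sr_act g) _ _) _; rewrite rmorph1.
exists (p * q ^ e); last by [].
rewrite q_pmon.
have el : dot b.1 b.1 != 2 -> (aact g b).2 = b.2 + e * 2.
  move=> nb; rewrite /= {1}(coroot_mul2 rb nb) /e mulr2n wactD dotDr; lia.
have dd : dot (aact g b).1 (aact g b).1 = dot b.1 b.1 by exact: dot_wact.
case/numsP: pb => [db|s db o|s db o]; rewrite pmonM row6D addbF !addr0.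
- have eb : (aact g b).2 = b.2 + e by rewrite /e coroot_short2.
  by have := @nums_short (aact g b); rewrite dd db eb mulrDl => /(_ erefl).
- have := @nums_odd (aact g b) s; rewrite dd db el // => /(_ isT); apply; lia.
have := @nums_even (aact g b) s; rewrite dd db el // => /(_ isT); apply; lia.
Qed.

Lemma sr_actVK g : cancel (@sr_act n g^-1%g) (sr_act g).
Proof. by move=> x; rewrite -sr_actM mulgV sr_act1. Qed.

Lemma nums_srV g b p : isroot b.1 -> p \in nums (aact g b) ->
  exists2 p', p' \in nums b & nfac (aact g b) p = sr_act g (nfac b p').
Proof.
move=> rb pb; have [p'] := nums_sr g^-1%g (aact_root g rb) pb.
rewrite aactK => pb' e; exists p'; first exact: pb'.
exact: (etrans (esym (sr_actVK g _)) (congr1 (sr_act g) e)).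
Qed.

Lemma addrKA_sub (V : zmodType) (u x y : V) : u - x + (x - y) = u - y.
Proof. by rewrite addrA subrK. Qed.

Lemma rfac_pow b (m : int) : divides (rfac b) (1 - fmon (q ^ (m * b.2)) (m *: b.1)).
Proof.
have nn (k : nat) : divides (rfac b) (1 - fmon (q ^ (k%:Z * b.2)) (k%:Z *: b.1)).
  elim: k => [|k IH].
    by rewrite mul0r scale0r expr0z fmon1 subrr; exact: divides0.
  have := dividesD (divides_mull (rfac b) 1) (dividesMr (fmon (q ^ b.2) b.1) IH).
  rewrite mulr1 mulrBr mulr1 fmonM -qexpD.
  rewrite -[X in q ^ (X + _)]mul1r -[X in fmon _ (X + _)]scale1r -mulrDl -scalerDl.
  by rewrite [X in divides _ X -> _](addrKA_sub (1 : FT n)).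
case: m => k; first exact: nn.
have [d e] := nn k.+1; rewrite NegzE.
exists (- fmon (q ^ (- k.+1%:Z * b.2)) (- k.+1%:Z *: b.1) * d).
rewrite mulrCA -e; apply: subr_unitE; rewrite fmonM -qexpD -mulrDl -scalerDl addNr.
by rewrite mul0r scale0r expr0z fmon1.
Qed.

(** On a monomial x the difference is x (1 - e^(m b)) with m an integer, and 1 - e^b divides 1 -
    e^(m b): Demazure difference quotients are integral. *)
Lemma rfac_refl b x : isroot b.1 -> divides (rfac b) (x - sr_act (arefl b) x).
Proof.
move=> rb; elim/FT_ind: x => [|x y hx hy|c a].
- by rewrite rmorph0 subrr; exact: divides0.
- by rewrite rmorphD opprD addrACA; exact: dividesD.
have [m em] : {m | m = - dot a (coroot b.1)} by eexists.
have e := aact_arefl (a, 0) rb; rewrite /aact /apair /= in e.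
case: e => e1 e2; rewrite sr_fmon e1.
have -> : dot (b.2 *: coroot b.1) (a - dot a (coroot b.1) *: b.1) = m * b.2.
  by rewrite -e1; move: e2; rewrite em; lia.
have -> : a - dot a (coroot b.1) *: b.1 = a + m *: b.1 by rewrite em scaleNr.
have -> : fmon c a - fmon (c * q ^ (m * b.2)) (a + m *: b.1) =
    fmon c a * (1 - fmon (q ^ (m * b.2)) (m *: b.1)).
  by rewrite mulrBr mulr1 fmonM.
by apply: dividesMr; exact: rfac_pow.
Qed.

Lemma cross_diff (R : comPzRingType) (f d d' x x' y y' : R) :
  f * d = y - y' -> f * d' = x - x' -> f * (d * x - y * d') = y * x' - y' * x.
Proof. by move=> e e'; rewrite mulrBr mulrA e mulrCA e'; ring. Qed.

Lemma cross_distr (R : comPzRingType) (h h' x x' : R) :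
  (h - h') * (x * x') = h * x * x' - h' * x' * x.
Proof. ring. Qed.

(* The reflection acts trivially on functions on the divisor e^b = 1. *)
Lemma reg_refl_diff b h : isroot b.1 -> regular_along (rfac b) h ->
  regular_along (rfac b) ((h - sr_K (arefl b) h) / tofrac (rfac b)).
Proof.
move=> rb rh; have b0 := rfac_neq0 rb.
apply: reg_van => //; rewrite mulrC divfK ?tofrac_eq0 //.
have [x [y [nx e]]] := rh; set s := arefl b.
have e' : sr_K s h * tofrac (sr_act s x) = tofrac (sr_act s y).
  by rewrite -!sr_KE -rmorphM e.
have [u uu eu] := rfacN b.
have nsx : nzd (rfac b) (sr_act s x).
  have es : sr_act s (rfac b) = u * rfac b.
    exact: (etrans (sr_rfac s b) (etrans (congr1 (@rfac n) (arefl_inv rb)) eu)).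
  have := @nzd_sr _ s _ _ nx; rewrite es => nx'.
  exact: (proj1 (nzd_unitl _ _ uu) nx').
have [d1 ed1] := rfac_refl x rb; have [d2 ed2] := rfac_refl y rb.
exists (x * sr_act s x), (d2 * x - y * d1); split; first exact: nzdM.
rewrite (cross_diff (esym ed2) (esym ed1)) tofracB (tofracM y) (tofracM (sr_act s y)) -e -e'.
by rewrite tofracM cross_distr.
Qed.
End LocalConditions.

(** * The three conditions restated over affine roots *)

Lemma subl_mulr_sub1 (R : comPzRingType) (c y x : R) : c * y = x -> x - c = - c * (1 - y).
Proof. by move=> <-; ring. Qed.

Section UniformConditions.
Variable n : nat.
Implicit Types (D : DqW n) (h : FTfrac n) (g : shift_refl n) (b : lexp n * int).
Implicit Types (a mu : lexp n) (w : signed_perm n).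

Definition cf D g : FTfrac n := (D@_g : floc n).

Lemma cf_coef D w mu : coef D w mu = cf D (- mu, w).
Proof. by []. Qed.

Definition residue_conditions D : Prop :=
  [/\ forall g b, apos b -> regular_along (rfac b) (tofrac (rfac b) * cf D g),
      forall g b, apos b ->
        vanishes_on (rfac b) (tofrac (rfac b) * (cf D g + cf D (arefl b * g)%g)) &
      forall g b p, apos b -> hgt g b < 0 -> p \in nums b ->
        vanishes_on (nfac b p) (cf D g)].

(** The height is coxn (k + <a, mu>) + <rho, w^-1 a>, whose sign is lexicographic. The ranges of r
    in the third condition come from the inequality on the right. *)
Lemma hgt_neg w mu a (k : int) : isroot a ->
  (hgt (- mu, w) (a, k) < 0) = (k + dot a mu < epsw a w).
Proof.
move=> ra; have rwa := root_wact w^-1%g ra.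
have -> : hgt (- mu, w) (a, k) = coxn n * (k + dot a mu) + dot (rho n) (wact w^-1%g a).
  rewrite /hgt /point /= dotBl dotZl dot_wactV [dot (- mu) a]dotC dotNr; ring.
have [bd r0] := rho_bound rwa; rewrite coxn_lt0 // /epsw negrootE rwa /=.
by move: (dot a mu) => x; move: r0; move: (dot _ _) => y; case: ifP; lia.
Qed.

Lemma epswN a w : isroot a -> epsw (- a) w = 1 - epsw a w.
Proof.
move=> ra; have rwa := root_wact w^-1%g ra.
rewrite /epsw !negrootE wactN Defs.rootN rwa dotNr /=.
have [_ r0] := rho_bound rwa; move: r0; move: (dot _ _) => y.
by case: ifP; case: ifP; lia.
Qed.

Lemma epsw01 a w : epsw a w = 0 \/ epsw a w = 1.
Proof. by rewrite /epsw; case: ifP; [right|left]. Qed.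

Lemma zero_at_pmon a s e h :
  zero_at a (pmon s e) h <-> vanishes_on (binom (pmon s (- e)) a) h.
Proof.
have uu : - cst n (pmon s e) \is a GRing.unit.
  by rewrite unitrN; exact: (fmon_unit 0 (pmon_unit s e)).
have E : lmon 1 a - cst n (pmon s e) = - cst n (pmon s e) * binom (pmon s (- e)) a.
  apply: (@subl_mulr_sub1 (FT n) _ (fmon (pmon s (- e)) a)).
  exact: (etrans (fmon_cst _ _ _) (congr1 (fun z => fmon z a) (pmon_mulV s e))).
by rewrite /zero_at E; exact: van_unit.
Qed.

(** The same divisor written with exponent -a: a zero imposed for m_alpha > 0 belongs to an affine
    root with finite part -alpha. *)
Lemma zero_at_pmonN a s e h :
  zero_at a (pmon s e) h <-> vanishes_on (binom (pmon s e) (- a)) h.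
Proof.
have ub : - fmon (pmon s e) (- a) \is a GRing.unit.
  by rewrite unitrN; exact: (fmon_unit _ (pmon_unit s e)).
have := binomN a (pmon_unit s e); rewrite pmonV => ->.
apply: (iff_trans (zero_at_pmon a s e h)).
by split=> H; [exact: (proj2 (van_unit _ _ ub) H)|exact: (proj1 (van_unit _ _ ub) H)].
Qed.
End UniformConditions.

Section UniformZeros.
Variable n : nat.
Implicit Types (D : DqW n) (h : FTfrac n) (g : shift_refl n) (b : lexp n * int).
Implicit Types (a mu : lexp n) (w : signed_perm n).

Definition uniform_zeros D := forall w mu a (k : int) p, realpos a k ->
  k + dot a mu < epsw a w -> p \in nums (a, k) -> vanishes_on (binom p (coroot a)) (coef D w mu).

Definition shortc (k : int) := pmon false (row6 (k * 2) 2 0 0 0 0).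
(** The parity of k selects (t_0, u_0) or (t_n, u_n), and [s] selects one of the two constants of
    that pair. *)
Definition longc s (k : int) :=
  if odd `|k| then pmon s (row6 k 0 1 0 (sg s) 0) else pmon s (row6 k 0 0 1 0 (sg s)).

Definition uniform_short D := forall w mu (i j : 'I_n) a, (i < j)%N ->
  a = eps i - eps j \/ a = eps i + eps j -> forall k : int,
  (0 <= k -> k + dot a mu < epsw a w -> vanishes_on (binom (shortc k) a) (coef D w mu)) /\
  (0 < k -> k - dot a mu < 1 - epsw a w -> vanishes_on (binom (shortc k) (- a)) (coef D w mu)).

Definition uniform_long D := forall w mu (i : 'I_n) s (k : int),
  (0 <= k -> k + 2 * mu 0 i < epsw (eps i *+ 2) w ->
    vanishes_on (binom (longc s k) (eps i)) (coef D w mu)) /\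
  (0 < k -> k - 2 * mu 0 i < 1 - epsw (eps i *+ 2) w ->
    vanishes_on (binom (longc s k) (- eps i)) (coef D w mu)).

Lemma short_data (i j : 'I_n) a : (i < j)%N -> a = eps i - eps j \/ a = eps i + eps j ->
  [/\ posroot a, isroot a, dot a a = 2 & coroot a = a].
Proof.
move=> ij ea; have pa : posroot a.
  apply/orP; left; apply/existsP; exists i; apply/existsP; exists j; rewrite ij.
  by case: ea => ->; rewrite eqxx ?orbT.
have ra : isroot a by rewrite /isroot pa.
have ne : i != j by rewrite neq_ltn ij.
have aa : dot a a = 2.
  case: ea => ->; first by have := dot_short false true ne; rewrite expr0 expr1 scale1r scaleN1r.
  by have := dot_short false false ne; rewrite expr0 !scale1r.
by split=> //; exact: coroot_short2.
Qed.

Lemma long_data (i : 'I_n) :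
  [/\ posroot (eps i *+ 2), isroot (eps i *+ 2), dot (eps i *+ 2) (eps i *+ 2) != 2 &
      coroot (eps i *+ 2) = eps i].
Proof.
have pa : posroot (eps i *+ 2) by apply/orP; right; apply/existsP; exists i.
split=> //; first by rewrite /isroot pa.
  by rewrite dotMnr dotC dotMnr eps_dot eqxx.
by have := coroot_long i false; rewrite !scale1r.
Qed.

Lemma nums_long a k s : dot a a != 2 -> longc s k \in nums (a, k).
Proof.
rewrite /longc => aa; case: (boolP (odd _)) => o; first exact: (@nums_odd _ (a, k)).
exact: (@nums_even _ (a, k)).
Qed.

Lemma nums_longP a k p : dot a a != 2 -> p \in nums (a, k) -> exists s, p = longc s k.
Proof.
move=> aa /numsP[e|s e o|s e o]; first by rewrite /= in e; rewrite e in aa.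
  by exists s; rewrite /longc; rewrite /= in o; rewrite o.
by exists s; rewrite /longc; rewrite /= in o; rewrite (negbTE o).
Qed.

Lemma nums_shortP a k p : dot a a = 2 -> p \in nums (a, k) -> p = shortc k.
Proof.
by move=> aa /numsP[//|s /negP[]|s /negP[]]; rewrite /= aa eqxx.
Qed.

Lemma dot_dbl (i : 'I_n) mu : dot (eps i *+ 2) mu = 2 * mu 0 i.
Proof. by rewrite dotC dotMnr dot_eps; lia. Qed.

Lemma uniform_zerosP D : uniform_zeros D <-> uniform_short D /\ uniform_long D.
Proof.
split=> [U|[US UL] w mu a k p].
  split=> [w mu i j a ij ea k|w mu i s k].
    have [pa ra aa ca] := short_data ij ea; split=> k0 hk.
      rewrite -{1}ca; apply: (U w mu a k) => //; first by rewrite /realpos pa k0.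
      exact: (@nums_short _ (a, k)).
    rewrite -{1}ca -corootN //; apply: (U w mu (- a) k).
    - by rewrite /realpos /negroot opprK pa k0 orbT.
    - by rewrite dotNl epswN.
    - by apply: (@nums_short _ (- a, k)); rewrite /= dotNl dotNr opprK.
  have [pa ra aa ca] := long_data i; split=> k0 hk.
    rewrite -{1}ca; apply: (U w mu _ k); first by rewrite /realpos pa k0.
      by rewrite dot_dbl.
    exact: nums_long.
  rewrite -{1}ca -corootN //; apply: (U w mu _ k).
  - by rewrite /realpos /negroot opprK pa k0 orbT.
  - by rewrite dotNl epswN // dot_dbl.
  - by apply: nums_long; rewrite dotNl dotNr opprK.
case/orP=> /andP[].
  case/orP=> [/existsP[i /existsP[j /andP[ij ea]]]|/existsP[i /eqP->]] k0 hk.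
    have ea' : a = eps i - eps j \/ a = eps i + eps j by case/orP: ea => /eqP; [left|right].
    have [pa ra aa ca] := short_data ij ea'.
    by move/(nums_shortP aa) => ->; rewrite ca; case: (US w mu i j a ij ea' k) => H _; exact: H.
  have [pa ra aa ca] := long_data i; case/(nums_longP aa) => s ->.
  by rewrite ca; case: (UL w mu i s k) => H _; apply: H => //; rewrite -dot_dbl.
rewrite /negroot => na k0; rewrite -[a]opprK; move: (- a) na => {}a.
case/orP=> [/existsP[i /existsP[j /andP[ij ea]]]|/existsP[i /eqP->]].
  have ea' : a = eps i - eps j \/ a = eps i + eps j by case/orP: ea => /eqP; [left|right].
  have [pa ra aa ca] := short_data ij ea'; rewrite dotNl epswN // corootN // ca => hk.
  have aa' : dot (- a) (- a) = 2 by rewrite dotNl dotNr opprK.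
  by move/(nums_shortP aa') => ->; case: (US w mu i j a ij ea' k) => _ H; exact: H.
have [pa ra aa ca] := long_data i; rewrite dotNl epswN // corootN // ca dot_dbl => hk.
have aa' : dot (- (eps i *+ 2)) (- (eps i *+ 2)) != 2 by rewrite dotNl dotNr opprK.
by case/(nums_longP aa') => s ->; case: (UL w mu i s k) => _ H; exact: H.
Qed.

Lemma vE0 : qh^-1 = pmon false (row6 (-1) 0 0 0 0 0).
Proof. by rewrite pE0 pmonV row6N; apply: pmon_row; rewrite ?oppr0. Qed.
Lemma vE2 : t0h^-1 = pmon false (row6 0 0 (-1) 0 0 0).
Proof. by rewrite pE2 pmonV row6N; apply: pmon_row; rewrite ?oppr0. Qed.
Lemma vE3 : tnh^-1 = pmon false (row6 0 0 0 (-1) 0 0).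
Proof. by rewrite pE3 pmonV row6N; apply: pmon_row; rewrite ?oppr0. Qed.
Lemma vE4 : u0h^-1 = pmon false (row6 0 0 0 0 (-1) 0).
Proof. by rewrite pE4 pmonV row6N; apply: pmon_row; rewrite ?oppr0. Qed.
Lemma vE5 : unh^-1 = pmon false (row6 0 0 0 0 0 (-1)).
Proof. by rewrite pE5 pmonV row6N; apply: pmon_row; rewrite ?oppr0. Qed.
Lemma tE : t = pmon false (row6 0 2 0 0 0 0).
Proof. by rewrite /t pE1 pmonX row6D; apply: pmon_row; rewrite ?addr0. Qed.
Lemma tVE : t^-1 = pmon false (row6 0 (-2) 0 0 0 0).
Proof. by rewrite tE pmonV row6N; apply: pmon_row; rewrite ?oppr0. Qed.
Lemma cS1 (r : int) : q ^ (- r) * t^-1 = pmon false (row6 (- (r * 2)) (-2) 0 0 0 0).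
Proof. by rewrite q_pmon tVE pmonM row6D ; apply: pmon_row; lia. Qed.
Lemma cS3 (r : int) : q ^ r * t = pmon false (row6 (r * 2) 2 0 0 0 0).
Proof. by rewrite q_pmon tE pmonM row6D ; apply: pmon_row; lia. Qed.
Lemma cN1 (r : int) : q ^ (- r) * tnh^-1 * unh^-1 = pmon false (row6 (- (r * 2)) 0 0 (-1) 0 (-1)).
Proof. by rewrite q_pmon vE3 vE5 pmonM row6D pmonM row6D ; apply: pmon_row; lia. Qed.
Lemma cN1' (r : int) : - (q ^ (- r) * tnh^-1 * unh) = pmon true (row6 (- (r * 2)) 0 0 (-1) 0 1).
Proof. by rewrite q_pmon vE3 pE5 pmonM row6D pmonM row6D pmonN; apply: pmon_row; lia. Qed.
Lemma c01 (r : int) : q ^ (- r) * qh^-1 * t0h^-1 * u0h^-1 = pmon false (row6 (- (r * 2 + 1)) 0 (-1) 0 (-1) 0).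
Proof. by rewrite q_pmon vE0 vE2 vE4 pmonM row6D pmonM row6D pmonM row6D ; apply: pmon_row; lia. Qed.
Lemma c01' (r : int) : - (q ^ (- r) * qh^-1 * t0h^-1 * u0h) = pmon true (row6 (- (r * 2 + 1)) 0 (-1) 0 1 0).
Proof. by rewrite q_pmon vE0 vE2 pE4 pmonM row6D pmonM row6D pmonM row6D pmonN; apply: pmon_row; lia. Qed.
Lemma cN2  : tnh^-1 * unh^-1 = pmon false (row6 0 0 0 (-1) 0 (-1)).
Proof. by rewrite vE3 vE5 pmonM row6D ; apply: pmon_row; lia. Qed.
Lemma cN2'  : - (tnh^-1 * unh) = pmon true (row6 0 0 0 (-1) 0 1).
Proof. by rewrite vE3 pE5 pmonM row6D pmonN; apply: pmon_row; lia. Qed.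
Lemma cN3 (r : int) : q ^ r * tnh * unh = pmon false (row6 (r * 2) 0 0 1 0 1).
Proof. by rewrite q_pmon pE3 pE5 pmonM row6D pmonM row6D ; apply: pmon_row; lia. Qed.
Lemma cN3' (r : int) : - (q ^ r * tnh * unh^-1) = pmon true (row6 (r * 2) 0 0 1 0 (-1)).
Proof. by rewrite q_pmon pE3 vE5 pmonM row6D pmonM row6D pmonN; apply: pmon_row; lia. Qed.
Lemma c03 (r : int) : q ^ r * qh * t0h * u0h = pmon false (row6 (r * 2 + 1) 0 1 0 1 0).
Proof. by rewrite q_pmon pE0 pE2 pE4 pmonM row6D pmonM row6D pmonM row6D ; apply: pmon_row; lia. Qed.
Lemma c03' (r : int) : - (q ^ r * qh * t0h * u0h^-1) = pmon true (row6 (r * 2 + 1) 0 1 0 (-1) 0).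
Proof. by rewrite q_pmon pE0 pE2 vE4 pmonM row6D pmonM row6D pmonM row6D pmonN; apply: pmon_row; lia. Qed.
End UniformZeros.

Section FrozenZeros.
Variable n : nat.
Implicit Types (D : DqW n) (h : FTfrac n) (g : shift_refl n) (b : lexp n * int).
Implicit Types (a mu : lexp n) (w : signed_perm n) (r k : int).

Lemma zeroV a p s e e' h : p = pmon s e -> e' = - e ->
  zero_at a p h <-> vanishes_on (binom (pmon s e') a) h.
Proof. by move=> -> ->; exact: zero_at_pmon. Qed.
Lemma zeroN a p s e h : p = pmon s e ->
  zero_at a p h <-> vanishes_on (binom (pmon s e) (- a)) h.
Proof. by move=> ->; exact: zero_at_pmonN. Qed.

Lemma row6_eqN x0 x1 x2 x3 x4 x5 y0 y1 y2 y3 y4 y5 :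
  x0 = - y0 -> x1 = - y1 -> x2 = - y2 -> x3 = - y3 -> x4 = - y4 -> x5 = - y5 ->
  row6 x0 x1 x2 x3 x4 x5 = - row6 y0 y1 y2 y3 y4 y5.
Proof. by rewrite row6N => -> -> -> -> -> ->. Qed.

Lemma zS1 a r h : zero_at a (q ^ (- r) * t^-1) h <-> vanishes_on (binom (shortc r) a) h.
Proof. by apply: (zeroV _ _ (cS1 r)); apply: row6_eqN; lia. Qed.
Lemma zS2 a h : zero_at a t^-1 h <-> vanishes_on (binom (shortc 0) a) h.
Proof. by apply: (zeroV _ _ tVE); apply: row6_eqN; lia. Qed.
Lemma zS3 a r h : zero_at a (q ^ r * t) h <-> vanishes_on (binom (shortc r) (- a)) h.
Proof. exact: zeroN (cS3 r). Qed.

Lemma longc_even s r : longc s (r * 2) = pmon s (row6 (r * 2) 0 0 1 0 (sg s)).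
Proof. by rewrite /longc ifF //; lia. Qed.
Lemma longc_odd s r : longc s (r * 2 + 1) = pmon s (row6 (r * 2 + 1) 0 1 0 (sg s) 0).
Proof. by rewrite /longc ifT //; lia. Qed.

Lemma bool_and (P Q : Prop) (F : bool -> Prop) : (P <-> F false) -> (Q <-> F true) ->
  (P /\ Q <-> forall s, F s).
Proof.
by move=> hP hQ; split=> [[/hP ? /hQ ?] []|H] //; split; [apply/hP|apply/hQ].
Qed.

Lemma zN1 a r h : zero_at a (q ^ (- r) * tnh^-1 * unh^-1) h /\
    zero_at a (- (q ^ (- r) * tnh^-1 * unh)) h <->
  forall s, vanishes_on (binom (longc s (r * 2)) a) h.
Proof.
apply: (@bool_and _ _ (fun s => vanishes_on (binom (longc s (r * 2)) a) h)); rewrite longc_even.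
  by apply: (zeroV _ _ (cN1 r)); apply: row6_eqN; rewrite /=; lia.
by apply: (zeroV _ _ (cN1' r)); apply: row6_eqN; rewrite /=; lia.
Qed.
Lemma z01 a r h : zero_at a (q ^ (- r) * qh^-1 * t0h^-1 * u0h^-1) h /\
    zero_at a (- (q ^ (- r) * qh^-1 * t0h^-1 * u0h)) h <->
  forall s, vanishes_on (binom (longc s (r * 2 + 1)) a) h.
Proof.
apply: (@bool_and _ _ (fun s => vanishes_on (binom (longc s (r * 2 + 1)) a) h)); rewrite longc_odd.
  by apply: (zeroV _ _ (c01 r)); apply: row6_eqN; rewrite /=; lia.
by apply: (zeroV _ _ (c01' r)); apply: row6_eqN; rewrite /=; lia.
Qed.
Lemma zN2 a h : zero_at a (tnh^-1 * unh^-1) h /\ zero_at a (- (tnh^-1 * unh)) h <->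
  forall s, vanishes_on (binom (longc s 0) a) h.
Proof.
apply: (@bool_and _ _ (fun s => vanishes_on (binom (longc s 0) a) h)); rewrite (longc_even _ 0).
  by apply: (zeroV _ _ cN2); apply: row6_eqN; rewrite /=; lia.
by apply: (zeroV _ _ cN2'); apply: row6_eqN; rewrite /=; lia.
Qed.
Lemma zN3 a r h : zero_at a (q ^ r * tnh * unh) h /\
    zero_at a (- (q ^ r * tnh * unh^-1)) h <->
  forall s, vanishes_on (binom (longc s (r * 2)) (- a)) h.
Proof.
apply: (@bool_and _ _ (fun s => vanishes_on (binom (longc s (r * 2)) (- a)) h)); rewrite longc_even.
  exact: (zeroN _ _ (cN3 r)).
exact: (zeroN _ _ (cN3' r)).
Qed.
Lemma z03 a r h : zero_at a (q ^ r * qh * t0h * u0h) h /\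
    zero_at a (- (q ^ r * qh * t0h * u0h^-1)) h <->
  forall s, vanishes_on (binom (longc s (r * 2 + 1)) (- a)) h.
Proof.
apply: (@bool_and _ _ (fun s => vanishes_on (binom (longc s (r * 2 + 1)) (- a)) h)); rewrite longc_odd.
  exact: (zeroN _ _ (c03 r)).
exact: (zeroN _ _ (c03' r)).
Qed.

(** With k = r, the first two clauses of the condition are the inequality for alpha + k delta, k >=
    0, and the last one is that for -alpha + k delta, k > 0. *)
Lemma short_zerosP D : short_zeros D <-> uniform_short D.
Proof.
split=> [S w mu i j a ij ea k|U w mu i j a ij ea m h].
  have [zm zz zp] := S w mu i j a ij ea; move: zm zz zp.
  move: (dot a mu) (coef D w mu) (epsw01 a w) => m h e01 zm zz zp; split=> k0 hk.
    have [m0|m0|m0] := ltgtP m 0.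
    - by apply: (proj1 (zS1 _ _ _)); apply: zm; lia.
    - lia.
    - have -> : k = 0 by lia.
      by apply: (proj1 (zS2 _ _)); apply: zz; lia.
  by apply: (proj1 (zS3 _ _ _)); apply: zp; lia.
have {U} U := U w mu i j a ij ea; rewrite -/m -/h in U.
move: m h U (epsw01 a w) => m h U e01; split.
- by move=> m0 r hr; apply: (proj2 (zS1 _ _ _)); apply: (proj1 (U r)); lia.
- by move=> m0 e1; apply: (proj2 (zS2 _ _)); apply: (proj1 (U 0)); lia.
- by move=> m0 r hr; apply: (proj2 (zS3 _ _ _)); apply: (proj2 (U r)); lia.
Qed.

(** Even k = 2r gives the constants in t_n and u_n, odd k = 2r + 1 those in t_0 and u_0. For odd k
    the number k + 2 mu_i is odd, hence never 0, so the inequality is the same for both values of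
    epsilon; this is why epsilon is absent from those two ranges. *)
Lemma long_zerosP D : long_zeros D <-> uniform_long D.
Proof.
split=> [L w mu i s k|U w mu i a m m2 h].
  have [] := L w mu i; rewrite dot_dbl mulrC mulzK //.
  move: (mu 0 i) (coef D w mu) (epsw01 (eps i *+ 2) w) => m h e01 z1 z2 z3 z4 z5.
  have [r [ek|ek]] : exists r, k = r * 2 \/ k = r * 2 + 1.
  - by exists (k %/ 2)%Z; have := divz_eq k 2; have := modz_ge0 k (isT : 2 != 0 :> int);
       have := ltz_pmod k (isT : 0 < 2 :> int); lia.
  - rewrite {}ek; split=> k0 hk.
      have [m0|m0|m0] := ltgtP m 0.
      + by apply: (proj1 (zN1 _ _ _)); apply: z1; lia.
      + lia.
      + have -> : r * 2 = 0 by lia.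
        by apply: (proj1 (zN2 _ _)); apply: z3; lia.
    by apply: (proj1 (zN3 _ _ _)); apply: z4; lia.
  rewrite {}ek; split=> k0 hk.
    by apply: (proj1 (z01 _ _ _)); apply: z2; lia.
  by apply: (proj1 (z03 _ _ _)); apply: z5; lia.
have em : m = 2 * mu 0 i by exact: dot_dbl.
have em2 : m2 = mu 0 i by rewrite /m2 em mulrC mulzK.
have {U} U := U w mu i; rewrite -/h in U; rewrite em em2; clearbody h m m2.
rewrite {}/a; move: (mu 0 i) U (epsw01 (eps i *+ 2) w) {em em2} => x U e01; split.
- by move=> m0 r hr; apply: (proj2 (zN1 _ _ _)) => s; apply: (proj1 (U s _)); lia.
- by move=> m0 r hr; apply: (proj2 (z01 _ _ _)) => s; apply: (proj1 (U s _)); lia.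
- by move=> m0 e1; apply: (proj2 (zN2 _ _)) => s; apply: (proj1 (U s _)); lia.
- by move=> m0 r hr; apply: (proj2 (zN3 _ _ _)) => s; apply: (proj2 (U s _)); lia.
- by move=> m0 r hr; apply: (proj2 (z03 _ _ _)) => s; apply: (proj2 (U s _)); lia.
Qed.

Theorem HqkP D : D \in @Hqk n <-> residue_conditions D.
Proof.
have cfE g : cf D g = coef D g.2 (- g.1) by rewrite cf_coef opprK; case: g.
have hz : (short_zeros D /\ long_zeros D) <-> uniform_zeros D.
  apply: iff_trans (iff_sym (uniform_zerosP D)).
  by split=> -[h1 h2]; split; [exact/short_zerosP|exact/long_zerosP|exact/short_zerosP|exact/long_zerosP].
(* As h_(w, mu) is read at the group element (-mu, w), the index paired with it in the second
   condition is its left multiple by the affine reflection. *)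
have hr w mu a k : (arefl (a, k) * ((- mu, w) : shift_refl n))%g =
    (- (wact (srefl a) mu - k *: coroot a), (srefl a * w)%g) :> shift_refl n.
  by rewrite /arefl /= [LHS]/(srmul _ _) /srmul /= wactN opprB.
split=> [/asboolP[P R S L]|[P R Z]].
  split=> [g b pb|g b pb|g b p pb hg pn].
  - case: b pb => a k; rewrite -aposE => pb; rewrite cfE; exact: P.
  - case: b pb => a k; rewrite -aposE => pb; rewrite mulrDr.
    case: g => m w; rewrite -[m]opprK; have := R w (- m) a k pb.
    by rewrite /resfun !cf_coef -hr.
  - case: b pb hg pn => a k pb; case: g => m w; rewrite -[m]opprK hgt_neg; last by case/andP: pb.
    rewrite -aposE in pb => hg pn; rewrite -cf_coef.
    exact: (proj1 hz (conj S L)) pb hg pn.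
have [S L] : short_zeros D /\ long_zeros D.
  apply/hz => w mu a k p pa hk pn; rewrite aposE in pa.
  by apply: (Z _ (a, k)) => //; rewrite hgt_neg //; case/andP: pa.
apply/asboolP; split=> // w mu a k; rewrite aposE => pa.
  exact: (P _ (a, k)).
have := R (- mu, w) (a, k) pa; rewrite hr mulrDr.
by [].
Qed.
End FrozenZeros.

(** * Coefficients of operators and stability under F[T] *)

Section Coefficients.
Variable n : nat.
Implicit Types (D : DqW n) (g s : shift_refl n) (c : floc n) (x : FT n).

Definition dmon c g : DqW n := smon (sr_action n) c g.

Lemma DqW_ind (P : DqW n -> Prop) : P 0 -> (forall D D', P D -> P D' -> P (D + D')) ->
  (forall c g, P (dmon c g)) -> forall D, P D.
Proof.
by move=> P0 PD Pm D; rewrite [D]skewE; apply: (big_ind P) => // g _; exact: Pm.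
Qed.

Lemma cfD D D' g : cf (D + D') g = cf D g + cf D' g.
Proof. by rewrite /cf mcoeffD. Qed.
Lemma cf0 g : cf (0 : DqW n) g = 0.
Proof. by rewrite /cf mcoeff0. Qed.
Lemma cf_dmon c s g : cf (dmon c s) g = if s == g then floc_val c else 0.
Proof. by rewrite /cf mcoeffU; case: (s == g); rewrite ?mulr1n ?mulr0n. Qed.

Lemma dmonM c c' g g' : dmon c g * dmon c' g' = dmon (c * sr_loc g c') (g * g')%g.
Proof. exact: smonM. Qed.

Lemma cf_dmonM c s D g : cf (dmon c s * D) g = floc_val c * sr_K s (cf D (s^-1 * g)%g).
Proof.
elim/DqW_ind: D => [|D D' IH IH'|c' g'].
- by rewrite mulr0 !cf0 rmorph0 mulr0.
- by rewrite mulrDr !cfD IH IH' rmorphD mulrDr.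
rewrite dmonM.
apply: etrans (cf_dmon _ _ _) _.
rewrite cf_dmon.
have -> : (s * g' == g)%g = (g' == s^-1 * g)%g.
  apply/eqP/eqP => [<-|->].
    by rewrite mulKg.
  by rewrite mulKVg.
by case: (_ == _) => //; rewrite rmorph0 mulr0.
Qed.

Lemma cf_ext D D' : (forall g, cf D g = cf D' g) -> D = D'.
Proof. by move=> e; apply/malgP => g; apply: val_inj; exact: e. Qed.

Lemma cf_loc D g : cf D g \in @in_loc n.
Proof. exact: (valP (D@_g : floc n)). Qed.

Definition fop x : DqW n := dmon (toloc x) 1%g.

Lemma cf_fop x D g : cf (fop x * D) g = tofrac x * cf D g.
Proof. by rewrite cf_dmonM invg1 mul1g sr_K1. Qed.

Lemma residue_conditionsD D D' : residue_conditions D -> residue_conditions D' ->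
  residue_conditions (D + D').
Proof.
move=> [P R Z] [P' R' Z']; split=> [g b pb|g b pb|g b p pb hg pn].
- by rewrite cfD mulrDr; apply: regD; [exact: P|exact: P'].
- by rewrite !cfD addrACA mulrDr; apply: vanD; [exact: R|exact: R'].
by rewrite cfD; apply: vanD; [exact: Z pn|exact: Z' pn].
Qed.

Lemma residue_conditions_fop x D : residue_conditions D -> residue_conditions (fop x * D).
Proof.
move=> [P R Z]; split=> [g b pb|g b pb|g b p pb hg pn]; rewrite !cf_fop.
- by rewrite mulrCA; apply: regM; [exact: reg_tofrac|exact: P].
- by rewrite -mulrDr mulrCA; apply: vanMl; [exact: reg_tofrac|exact: R].
by apply: vanMl; [exact: reg_tofrac|exact: Z pn].
Qed.

Lemma residue_conditions1 : residue_conditions (1 : DqW n).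
Proof.
have cf1 g : cf 1 g = if 1%g == g then 1 else 0 by exact: (cf_dmon 1 1%g g).
split=> [g b pb|g b pb|g b p pb hg pn]; rewrite !cf1.
- apply: regM; first exact: reg_tofrac.
  by case: ifP => _; [rewrite -tofrac1; exact: reg_tofrac|exact: reg0].
- apply: van_mul; apply: regD.
    by case: ifP => _; [rewrite -tofrac1; exact: reg_tofrac|exact: reg0].
  by case: ifP => _; [rewrite -tofrac1; exact: reg_tofrac|exact: reg0].
rewrite ifF; first exact: van0.
apply/negP => /eqP e; rewrite -e in hg; case/andP: pb => _ hg'.
by have := lt_trans hg hg'; rewrite ltxx.
Qed.
End Coefficients.

(** * The operators T_i *)

Section Operators.
Variable m : nat.
Local Notation n := m.+1.
Implicit Types (D : DqW n) (g : shift_refl n) (b : lexp n * int) (i j : 'I_m.+2).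

(** The factor t_i^(-1/2) is what makes a_i + s_i(a_i) equal to t_i^(1/2) - t_i^(-1/2), which the
    quadratic relation requires. *)
Definition numer i : FT n :=
  cst n (tpar i)^-1 * \prod_(p <- nums (simple i)) nfac (simple i) p.

Definition kc (c : baseF) : FTfrac n := tofrac (cst n c).
Definition kb i : FTfrac n := tofrac (numer i) / tofrac (rfac (simple i)).
Definition ka i : FTfrac n := kc (tpar i) - kb i.

Lemma kb_loc i : kb i \in @in_loc n.
Proof. by apply: rpredM; [exact: tofrac_loc|exact: loc_rfac_inv]. Qed.
Definition lb i : floc n := Floc (kb_loc i).
Definition la i : floc n := cloc n (tpar i) - lb i.
(** The Demazure-Lusztig operator in Noumi's form, split into its coefficients at the identity and
    at s_i. *)
Definition Top i : DqW n := dmon (la i) 1%g + dmon (lb i) (srefl_simple i).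

Lemma cf_Top i D g : cf (Top i * D) g =
  ka i * cf D g + kb i * sr_K (srefl_simple i) (cf D (srefl_simple i * g)%g).
Proof.
have e1 : cf (dmon (la i) 1%g * D) g = ka i * cf D g.
  by apply: etrans (cf_dmonM _ _ _ _) _; rewrite invg1 mul1g sr_K1.
have e2 : cf (dmon (lb i) (srefl_simple i) * D) g =
    kb i * sr_K (srefl_simple i) (cf D (srefl_simple i * g)%g).
  apply: etrans (cf_dmonM _ _ _ _) _.
  by rewrite {1}/srefl_simple (areflVE (simple_root i)).
rewrite -e1 -e2; apply: etrans (congr1 (fun X => cf X g) (mulrDl _ _ D)) _.
exact: cfD.
Qed.

Lemma apos_neg b c : apos b -> apos c -> b <> - c.
Proof. by move=> /andP[_ hi] /andP[_ hj] e; move: hi; rewrite e hgtN oppr_gt0 => hi; have := lt_trans hi hj; rewrite ltxx. Qed.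

Lemma kb_reg f i : nzd f (rfac (simple i)) -> regular_along f (kb i).
Proof.
move=> nf; apply: regM; first exact: reg_tofrac.
by apply: reg_inv => //; exact: rfac_neq0.
Qed.
Lemma ka_reg f i : nzd f (rfac (simple i)) -> regular_along f (ka i).
Proof. by move=> nf; apply: regB; [exact: reg_tofrac|exact: kb_reg]. Qed.

Lemma kb_van i p : p \in nums (simple i) -> vanishes_on (nfac (simple i) p) (kb i).
Proof.
move=> pn; have np : nzd (nfac (simple i) p) (rfac (simple i)).
  apply: nzd_sym; first exact: rfac_neq0.
  by apply: rfac_nfac_nzd.
have [y ey] : divides (nfac (simple i) p) (numer i).
  apply: dividesMr; elim: (nums _) pn => // r s IH; rewrite in_cons big_cons.
  case/orP=> [/eqP<-|/IH]; first exact: divides_mull.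
  exact: dividesMr.
rewrite /kb ey tofracM -mulrA; apply: van_mul; apply: regM; first exact: reg_tofrac.
by apply: reg_inv => //; exact: rfac_neq0.
Qed.

Lemma sr_reg_simple i h : regular_along (rfac (simple i)) h ->
  regular_along (rfac (simple i)) (sr_K (srefl_simple i) h).
Proof.
move=> rh; have [u uu eu] := rfacN (simple i).
have es : sr_act (srefl_simple i) (rfac (simple i)) = u * rfac (simple i).
  exact: (etrans (sr_rfac _ _) (etrans (congr1 (@rfac n) (arefl_inv (simple_root i))) eu)).
have := @reg_sr _ (srefl_simple i) _ _ rh; rewrite es.
by move=> H; exact: (proj1 (reg_unit _ _ uu) H).
Qed.

(** This is e^a e^(-a) = 1 for a = alpha_i, in terms of F = 1 - e^a and s_i F, the variables of the
    field identities below. *)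
Lemma rfac_mulV i : (1 - tofrac (rfac (simple i))) *
  (1 - sr_K (srefl_simple i) (tofrac (rfac (simple i)))) = 1.
Proof.
have es : sr_act (srefl_simple i) (rfac (simple i)) = rfac (- simple i).
  exact: (etrans (sr_rfac _ _) (congr1 (@rfac n) (arefl_inv (simple_root i)))).
have E : sr_K (srefl_simple i) (tofrac (rfac (simple i))) = tofrac (rfac (- simple i)).
  exact: (etrans (sr_KE _ _) (congr1 (fun x => tofrac x) es)).
rewrite {}E {es}.
have X b : 1 - tofrac (rfac b) = tofrac (fmon (q ^ b.2) b.1).
  by rewrite /rfac /binom tofracB tofrac1 subKr.
have M : fmon (q ^ (simple i).2) (simple i).1 * fmon (q ^ (- simple i).2) (- simple i).1 = 1.
  apply: etrans (fmonM _ _ _ _) _.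
  have -> : q ^ (simple i).2 * q ^ (- simple i).2 = 1 by rewrite -qexpD /= subrr expr0z.
  by rewrite /= subrr fmon1.
exact: (etrans (congr2 (fun x y => x * y) (X (simple i)) (X (- simple i)))
  (etrans (esym (tofracM _ _)) (etrans (congr1 (fun x => tofrac x) M) (tofrac1 _)))).
Qed.
End Operators.

(** * Stability of the conditions under T_i *)

Section TopAlgebra.
Variable K : fieldType.
Implicit Types F SF h Sh e Se tau B : K.

(** Here F = 1 - e^(alpha_i), h = h_g, a prefix S marks the image under s_i, and e = h_g + h_(s_i
    g). On the right the only denominator is in the difference quotient of F h, which
    [reg_refl_diff] shows to be regular. *)
Lemma top_pole_identity F SF h Sh Se tau B : F != 0 -> (1 - F) * (1 - SF) = 1 ->
  F * ((tau - B / F) * h + B / F * (Se - Sh)) =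
  tau * (F * h) + B * Se - B * ((F * h - SF * Sh) / F + SF * Sh).
Proof.
move=> F0 e; have e' : SF * (F - 1) = F.
  have -> : SF * (F - 1) = (1 - F) * (1 - SF) - 1 + F by ring.
  by rewrite e; ring.
have -> : (F * h - SF * Sh) / F + SF * Sh = h + Sh * ((SF * (F - 1)) / F) by field.
by rewrite e'; field.
Qed.

Lemma top_residue_identity F e Se tau B :
  (tau - B / F) * e + B / F * Se = tau * e - B * ((e - Se) / F).
Proof. by ring. Qed.

Lemma top_factor (x ka kb h Sh : K) : x * (ka * h + kb * Sh) = ka * (x * h) + kb * (x * Sh).
Proof. ring. Qed.

Lemma top_factor2 (x ka kb h Sh h2 Sh2 : K) :
  x * ((ka * h + kb * Sh) + (ka * h2 + kb * Sh2)) = ka * (x * (h + h2)) + kb * (x * (Sh + Sh2)).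
Proof. ring. Qed.

Lemma top_sum (ka kb h Sh h2 Sh2 : K) :
  (ka * h + kb * Sh) + (ka * h2 + kb * Sh2) = ka * (h + h2) + kb * (Sh + Sh2).
Proof. ring. Qed.
End TopAlgebra.

Section TopPreserves.
Variable m : nat.
Local Notation n := m.+1.
Implicit Types (D : DqW n) (g : shift_refl n) (b : lexp n * int) (i j : 'I_m.+2).

Lemma tofrac_rfac_neq0 b : isroot b.1 -> tofrac (rfac b) != 0 :> FTfrac n.
Proof. by move=> rb; rewrite tofrac_eq0; exact: rfac_neq0. Qed.

(** Away from alpha_i the coefficients of T_i are regular, and s_i exchanges the conditions at b and
    s_i b. Along alpha_i the sum h_g + h_(s_i g) is regular, so the extra pole introduced by T_i
    occurs only in difference quotients under s_i. *)
Lemma residue_conditions_Top i D : residue_conditions D -> residue_conditions (Top i * D).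
Proof.
move=> [P R Z]; set s := srefl_simple i; set F := tofrac (rfac (simple i)) : FTfrac n.
have ri := simple_root i; have pi := simple_pos i.
have F0 : F != 0 by exact: tofrac_rfac_neq0.
have e_reg g : regular_along (rfac (simple i)) (cf D g + cf D (s * g)%g).
  by apply: reg_van; [exact: rfac_neq0|exact: R].
have Sfac b : isroot b.1 -> sr_K s (tofrac (rfac (aact s b))) = tofrac (rfac b).
  move=> rb; apply: etrans (sr_KE _ _) _; apply: (congr1 (fun x => tofrac x)).
  by apply: etrans (sr_rfac _ _) _; rewrite /s aact_areflK.
have Sact b : isroot b.1 -> sr_act s (rfac (aact s b)) = rfac b.
  by move=> rb; apply: etrans (sr_rfac _ _) _; rewrite /s aact_areflK.
have sp b : apos b -> b <> simple i -> apos (aact s b) by exact: simple_permP.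
have cop b : apos b -> b <> simple i -> nzd (rfac b) (rfac (simple i)).
  move=> pb ne; apply: rfac_nzd => //; first by case/andP: pb.
  exact: apos_neg.
have ssg g : (s * (s * g))%g = g by exact: areflK.
split=> [g b pb|g b pb|g b p pb hg pn].
- rewrite cf_Top -/s; have rb : isroot b.1 by case/andP: pb.
  have [eb|/eqP nb] := eqVneq b (simple i).
    rewrite {}eb -/F {pb rb}.
    have -> : sr_K s (cf D (s * g)%g) =
        sr_K s (cf D g + cf D (s * g)%g) - sr_K s (cf D g).
      by rewrite -rmorphB [X in X - _]addrC addrK.
    rewrite /ka /kb -/F (top_pole_identity _ _ _ _ _ F0 (rfac_mulV i)) -/F -/s.
    have Pg := P g _ pi; rewrite -/F in Pg.
    have Eg := e_reg g.
    have E : sr_K s F * sr_K s (cf D g) = sr_K s (F * cf D g).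
      exact: (esym (rmorphM (sr_K s) _ _)).
    rewrite {}E.
    apply: regB.
      apply: regD; first by apply: regM => //; exact: reg_tofrac.
      by apply: regM; [exact: reg_tofrac|exact: sr_reg_simple].
    apply: regM; first exact: reg_tofrac.
    apply: regD; first exact: (reg_refl_diff ri Pg).
    exact: sr_reg_simple.
  rewrite top_factor; apply: regD.
    by apply: regM; [exact: ka_reg (cop _ _ _)|exact: P].
  apply: regM; first exact: kb_reg (cop _ _ _).
  rewrite -(Sfac b rb) -rmorphM /= -(Sact b rb); apply: reg_sr; apply: P; exact: sp.
- rewrite !cf_Top -/s; have rb : isroot b.1 by case/andP: pb.
  have [eb|/eqP nb] := eqVneq b (simple i).
    rewrite {}eb -/(srefl_simple i) -/s ssg {pb rb}; apply: van_mul.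
    rewrite top_sum; have Eg := e_reg g.
    have -> : sr_K s (cf D (s * g)%g) + sr_K s (cf D g) = sr_K s (cf D g + cf D (s * g)%g).
      by rewrite [RHS]rmorphD addrC.
    rewrite /ka /kb -/F top_residue_identity; apply: regB.
      by apply: regM => //; exact: reg_tofrac.
    by apply: regM; [exact: reg_tofrac|exact: (reg_refl_diff ri Eg)].
  rewrite top_factor2; apply: vanD.
    by apply: vanMl; [exact: ka_reg (cop _ _ _)|exact: R].
  apply: vanMl; first exact: kb_reg (cop _ _ _).
  rewrite -(Sfac b rb) -rmorphD -rmorphM /= -(Sact b rb); apply: van_sr.
  rewrite /s /srefl_simple arefl_conj //; apply: R; exact: sp.
rewrite cf_Top -/s; have rb : isroot b.1 by case/andP: pb.
have [eb|/eqP nb] := eqVneq b (simple i).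
  (* Here s_i shortens g: the first summand inherits the zero of h_g, and the second has the zero of
     b_i, since h_(s_i g), an element of F[T]_loc, is regular along numerator divisors. *)
  rewrite {}eb in hg pn *; apply: vanD.
    apply: vanMl; last exact: Z pn.
    by apply: ka_reg; apply: nzd_sym; [exact: rfac_neq0|exact: rfac_nfac_nzd].
  apply: vanM; first exact: kb_van.
  by apply: nfac_reg_loc => //; apply: sr_K_loc; exact: cf_loc.
have nn : nzd (nfac b p) (rfac (simple i)).
  by apply: nzd_sym; [exact: rfac_neq0|exact: rfac_nfac_nzd].
apply: vanD.
  by apply: vanMl; [exact: ka_reg|exact: Z pn].
apply: vanMl; first exact: kb_reg.
have rb' := aact_root s rb.
have pn' : p \in nums (aact s (aact s b)) by rewrite /s aact_areflK.
have [p' pp' ep] := nums_srV rb' pn'.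
rewrite /s aact_areflK // -/s in ep; rewrite ep; apply: van_sr.
apply: Z pp'; first exact: sp.
(* The root b has the same height at g as s_i b has at s_i g. *)
by rewrite /s hgt_arefl_aact // aact_areflK.
Qed.
End TopPreserves.

(** * Braid relations as identities of rational functions *)

(* In both braid sections, E with a word as suffix equates the coefficients of that word on
   the two sides; the words without such a hypothesis agree by commutativity of K. *)
Section Braid3.
Variables (K : fieldType) (G : Type) (gi gj : G -> G) (Si Sj : {rmorphism K -> K}).
Variables (t aA aAn aP aPn aB aBn : K).
Hypotheses (gi2 : forall g, gi (gi g) = g) (gj2 : forall g, gj (gj g) = g).
Hypotheses (Si2 : forall x, Si (Si x) = x) (Sj2 : forall x, Sj (Sj x) = x).
Hypothesis gbr : forall g, gi (gj (gi g)) = gj (gi (gj g)).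
Hypothesis Sbr : forall x, Si (Sj (Si x)) = Sj (Si (Sj x)).
Hypotheses (Si_t : Si t = t) (Sj_t : Sj t = t).
Hypotheses (Si_A : Si aA = aAn) (Si_An : Si aAn = aA) (Si_B : Si aB = aP) (Si_P : Si aP = aB)
  (Si_Bn : Si aBn = aPn) (Si_Pn : Si aPn = aBn) (Sj_B : Sj aB = aBn) (Sj_Bn : Sj aBn = aB)
  (Sj_A : Sj aA = aP) (Sj_P : Sj aP = aA) (Sj_An : Sj aAn = aPn) (Sj_Pn : Sj aPn = aAn).
Hypothesis E0 : aA * aB * aA + (t - aA) * aP * (t - aAn) =
   aB * aA * aB + (t - aB) * aP * (t - aBn).
Hypothesis Ei : aA * aB * (t - aA) + (t - aA) * aP * aAn =
   aB * (t - aA) * aP.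
Hypothesis Ej : aA * (t - aB) * aP =
   aB * aA * (t - aB) + (t - aB) * aP * aBn.
Definition braid3_opi (h : G -> K) g := aA * h g + (t - aA) * Si (h (gi g)).
Definition braid3_opj (h : G -> K) g := aB * h g + (t - aB) * Sj (h (gj g)).
(** [aA], [aB], [aP] are the coefficients a attached to alpha_i, alpha_j and alpha_i + alpha_j; the
    suffix n marks the opposite root. *)
Lemma braid3_identity h g : braid3_opi (braid3_opj (braid3_opi h)) g = braid3_opj (braid3_opi
  (braid3_opj h)) g.
Proof.
rewrite /braid3_opi /braid3_opj !(rmorphD, rmorphN, rmorphM) /=.
rewrite !(gi2, gj2, Si2, Sj2, Si_A, Si_An, Si_B, Si_P, Si_Bn, Si_Pn, Sj_B, Sj_Bn, Sj_A, Sj_P,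
  Sj_An, Sj_Pn, Si_t, Sj_t).
rewrite gbr Sbr.
move: (Sj (Si (Sj (h (gj (gi (gj g))))))) => Htop.
move: (Si (Sj (h (gj (gi g))))) => Hij.
move: (Sj (Si (h (gi (gj g))))) => Hji.
move: (Si (h (gi g))) => Hi.
move: (Sj (h (gj g))) => Hj.
move: (h g) => H0.
transitivity ((aA * aB * aA + (t - aA) * aP * (t - aAn)) * H0 + (aA * aB * (t - aA) + (t - aA) *
  aP * aAn) * Hi + (aA * (t - aB) * aP) * Hj + ((t - aA) * (t - aP) * aB) * Hij + (aA * (t - aB)
  * (t - aP)) * Hji + ((t - aA) * (t - aP) * (t - aB)) * Htop); first by ring.
by rewrite E0 Ei Ej; ring.
Qed.
End Braid3.

Section Braid4.
Variables (K : fieldType) (G : Type) (gi gj : G -> G) (Si Sj : {rmorphism K -> K}).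
Variables (t u aA aAn aP aPn aB aBn aQ aQn : K).
Hypotheses (gi2 : forall g, gi (gi g) = g) (gj2 : forall g, gj (gj g) = g).
Hypotheses (Si2 : forall x, Si (Si x) = x) (Sj2 : forall x, Sj (Sj x) = x).
Hypothesis gbr : forall g, gi (gj (gi (gj g))) = gj (gi (gj (gi g))).
Hypothesis Sbr : forall x, Si (Sj (Si (Sj x))) = Sj (Si (Sj (Si x))).
Hypotheses (Si_t : Si t = t) (Sj_t : Sj t = t) (Si_u : Si u = u) (Sj_u : Sj u = u).
Hypotheses (Si_A : Si aA = aAn) (Si_An : Si aAn = aA) (Si_P : Si aP = aP) (Si_Pn : Si aPn = aPn)
  (Si_B : Si aB = aQ) (Si_Q : Si aQ = aB) (Si_Bn : Si aBn = aQn) (Si_Qn : Si aQn = aBn)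
  (Sj_A : Sj aA = aP) (Sj_P : Sj aP = aA) (Sj_An : Sj aAn = aPn) (Sj_Pn : Sj aPn = aAn)
  (Sj_B : Sj aB = aBn) (Sj_Bn : Sj aBn = aB) (Sj_Q : Sj aQ = aQ) (Sj_Qn : Sj aQn = aQn).
Hypothesis E0 : aA * aB * aA * aB + aA * (u - aB) * aP * (u - aBn) + (t - aA) * aQ * (t - aAn) *
  aB =
   aB * aA * aB * aA + aB * (t - aA) * aQ * (t - aAn) + (u - aB) * aP * (u - aBn) * aA.
Hypothesis Ei : aA * aB * (t - aA) * aQ + (t - aA) * aQ * aAn * aQ + (t - aA) * (u - aQ) * aP *
  (u - aQn) =
   aB * aA * aB * (t - aA) + aB * (t - aA) * aQ * aAn + (u - aB) * aP * (u - aBn) * (t - aA).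
Hypothesis Ej : aA * aB * aA * (u - aB) + aA * (u - aB) * aP * aBn + (t - aA) * aQ * (t - aAn) *
  (u - aB) =
   aB * aA * (u - aB) * aP + (u - aB) * aP * aBn * aP + (u - aB) * (t - aP) * aQ * (t - aPn).
Hypothesis Eij : aA * aB * (t - aA) * (u - aQ) + (t - aA) * aQ * aAn * (u - aQ) + (t - aA) * (u
  - aQ) * aP * aQn =
   aB * (t - aA) * (u - aQ) * aP.
Hypothesis Eji : aA * (u - aB) * (t - aP) * aQ =
aB * aA * (u - aB) * (t - aP) + (u - aB) * aP * aBn * (t - aP) + (u - aB) * (t - aP) * aQ * aPn.
Definition braid4_opi (h : G -> K) g := aA * h g + (t - aA) * Si (h (gi g)).
Definition braid4_opj (h : G -> K) g := aB * h g + (u - aB) * Sj (h (gj g)).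
(** Now [aP] belongs to s_j alpha_i and [aQ] to s_i alpha_j, the other two positive roots of the
    rank two system. *)
Lemma braid4_identity h g : braid4_opi (braid4_opj (braid4_opi (braid4_opj h))) g = braid4_opj
  (braid4_opi (braid4_opj (braid4_opi h))) g.
Proof.
rewrite /braid4_opi /braid4_opj !(rmorphD, rmorphN, rmorphM) /=.
rewrite !(gi2, gj2, Si2, Sj2, Si_A, Si_An, Si_P, Si_Pn, Si_B, Si_Q, Si_Bn, Si_Qn, Sj_A, Sj_P,
  Sj_An, Sj_Pn, Sj_B, Sj_Bn, Sj_Q, Sj_Qn, Si_t, Sj_t, Si_u, Sj_u).
rewrite gbr Sbr.
move: (Sj (Si (Sj (Si (h (gj (gi (gj (gi g))))))))) => Htop.
move: (Si (Sj (Si (h (gi (gj (gi g))))))) => Hiji.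
move: (Sj (Si (Sj (h (gj (gi (gj g))))))) => Hjij.
move: (Si (Sj (h (gj (gi g))))) => Hij.
move: (Sj (Si (h (gi (gj g))))) => Hji.
move: (Si (h (gi g))) => Hi.
move: (Sj (h (gj g))) => Hj.
move: (h g) => H0.
transitivity ((aA * aB * aA * aB + aA * (u - aB) * aP * (u - aBn) + (t - aA) * aQ * (t - aAn) *
  aB) * H0 + (aA * aB * (t - aA) * aQ + (t - aA) * aQ * aAn * aQ + (t - aA) * (u - aQ) * aP * (u
  - aQn)) * Hi + (aA * aB * aA * (u - aB) + aA * (u - aB) * aP * aBn + (t - aA) * aQ * (t - aAn)
  * (u - aB)) * Hj + (aA * aB * (t - aA) * (u - aQ) + (t - aA) * aQ * aAn * (u - aQ) + (t - aA)
  * (u - aQ) * aP * aQn) * Hij + (aA * (u - aB) * (t - aP) * aQ) * Hji + ((t - aA) * (u - aQ) *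
  (t - aP) * aB) * Hiji + (aA * (u - aB) * (t - aP) * (u - aQ)) * Hjij + ((t - aA) * (u - aQ) *
  (t - aP) * (u - aB)) * Htop); first by ring.
by rewrite E0 Ei Ej Eij Eji; ring.
Qed.
End Braid4.

Ltac nzs := repeat (apply/andP; split); try assumption; try (rewrite -oppr_eq0 opprB; assumption).

Section BraidCoefficients.
Variable K : fieldType.

(** [short_a] and [long_a] express a_i through x = e^(alpha_i) and, for a long root, y = e^(alpha_i
    / 2). Their arguments t and u are the square roots of the parameters. *)
Definition short_a (t x : K) := (t - t^-1) / (1 - x).
Definition long_a (t u y : K) := ((t - t^-1) + (u - u^-1) * y) / (1 - y ^+ 2).

Section Coefficients3.
Variables t x y : K.
Hypotheses (t0 : t != 0) (x0 : x != 0) (y0 : y != 0).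
Hypotheses (d1 : 1 - x != 0) (d2 : 1 - y != 0) (d3 : 1 - x * y != 0).
Local Notation A := (short_a t x).
Local Notation An := (short_a t x^-1).
Local Notation B := (short_a t y).
Local Notation Bn := (short_a t y^-1).
Local Notation P := (short_a t (x * y)).

Lemma braid3_coef_0 : A * B * A + (t - A) * P * (t - An) =
    B * A * B + (t - B) * P * (t - Bn).
Proof. by rewrite /short_a; field; nzs. Qed.

Lemma braid3_coef_i : A * B * (t - A) + (t - A) * P * An =
    B * (t - A) * P.
Proof. by rewrite /short_a; field; nzs. Qed.

Lemma braid3_coef_j : A * (t - B) * P =
    B * A * (t - B) + (t - B) * P * Bn.
Proof. by rewrite /short_a; field; nzs. Qed.
End Coefficients3.

Section Coefficients4.
Variables t s u x y : K.
Hypotheses (t0 : t != 0) (s0 : s != 0) (u0 : u != 0) (x0 : x != 0) (y0 : y != 0).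
Hypotheses (d1 : 1 - x != 0) (d2 : 1 - x * y ^+ 2 != 0) (d3 : 1 - y ^+ 2 != 0).
Hypothesis d4 : 1 - (x * y) ^+ 2 != 0.
Local Notation A := (short_a t x).
Local Notation An := (short_a t x^-1).
Local Notation P := (short_a t (x * y ^+ 2)).
Local Notation Pn := (short_a t (x * y ^+ 2)^-1).
Local Notation B := (long_a s u y).
Local Notation Bn := (long_a s u y^-1).
Local Notation Q := (long_a s u (x * y)).
Local Notation Qn := (long_a s u (x * y)^-1).

Lemma braid4_coef_0 : A * B * A * B + A * (s - B) * P * (s - Bn) + (t - A) * Q * (t - An) * B =
    B * A * B * A + B * (t - A) * Q * (t - An) + (s - B) * P * (s - Bn) * A.
Proof. by rewrite /short_a /long_a; field; nzs. Qed.

Lemma braid4_coef_i : A * B * (t - A) * Q + (t - A) * Q * An * Q + (t - A) * (s - Q) * P * (s - Qn) =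
    B * A * B * (t - A) + B * (t - A) * Q * An + (s - B) * P * (s - Bn) * (t - A).
Proof. by rewrite /short_a /long_a; field; nzs. Qed.

Lemma braid4_coef_j : A * B * A * (s - B) + A * (s - B) * P * Bn + (t - A) * Q * (t - An) * (s - B) =
    B * A * (s - B) * P + (s - B) * P * Bn * P + (s - B) * (t - P) * Q * (t - Pn).
Proof. by rewrite /short_a /long_a; field; nzs. Qed.

Lemma braid4_coef_ij : A * B * (t - A) * (s - Q) + (t - A) * Q * An * (s - Q) + (t - A) * (s - Q) * P * Qn =
    B * (t - A) * (s - Q) * P.
Proof. by rewrite /short_a /long_a; field; nzs. Qed.

Lemma braid4_coef_ji : A * (s - B) * (t - P) * Q =
    B * A * (s - B) * (t - P) + (s - B) * P * Bn * (t - P) + (s - B) * (t - P) * Q * Pn.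
Proof. by rewrite /short_a /long_a; field; nzs. Qed.
End Coefficients4.
End BraidCoefficients.

Section BraidField.
Variables (K : fieldType) (G : Type) (gi gj : G -> G) (Si Sj : {rmorphism K -> K}).
Hypotheses (gi2 : forall g, gi (gi g) = g) (gj2 : forall g, gj (gj g) = g).
Hypotheses (Si2 : forall x, Si (Si x) = x) (Sj2 : forall x, Sj (Sj x) = x).

Lemma rmorph_short_a (S : {rmorphism K -> K}) t x : S t = t ->
  S (short_a t x) = short_a t (S x).
Proof. by move=> e; rewrite /short_a rmorphM fmorphV !rmorphB rmorph1 fmorphV e. Qed.
Lemma rmorph_long_a (S : {rmorphism K -> K}) t u y : S t = t -> S u = u ->
  S (long_a t u y) = long_a t u (S y).
Proof.
move=> e e'; rewrite /long_a rmorphM fmorphV rmorphD rmorphM !rmorphB rmorph1 rmorphXn.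
by rewrite !fmorphV e e'.
Qed.

Definition demazure (S : K -> K) (r : G -> G) (a b : K) (h : G -> K) g :=
  a * h g + b * S (h (r g)).

Section ShortShort.
Hypothesis gbr : forall g, gi (gj (gi g)) = gj (gi (gj g)).
Hypothesis Sbr : forall x, Si (Sj (Si x)) = Sj (Si (Sj x)).
Variables t x y : K.
Hypotheses (t0 : t != 0) (x0 : x != 0) (y0 : y != 0).
Hypotheses (d1 : 1 - x != 0) (d2 : 1 - y != 0) (d3 : 1 - x * y != 0).
Hypotheses (Sit : Si t = t) (Sjt : Sj t = t).
Hypotheses (Six : Si x = x^-1) (Siy : Si y = x * y) (Sjy : Sj y = y^-1) (Sjx : Sj x = x * y).

Lemma demazure_braid3 h g :
  let Ti := demazure Si gi (short_a t x) (t - short_a t x) in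
  let Tj := demazure Sj gj (short_a t y) (t - short_a t y) in
  Ti (Tj (Ti h)) g = Tj (Ti (Tj h)) g.
Proof.
move=> Ti Tj.
have Sixy : Si (x * y) = y by rewrite rmorphM Six Siy mulKf.
have Sjxy : Sj (x * y) = x by rewrite rmorphM Sjx Sjy mulfK.
rewrite /Ti /Tj /demazure.
apply: (@braid3_identity K G gi gj Si Sj t (short_a t x) (short_a t x^-1)
  (short_a t (x * y)) (short_a t y) (short_a t y^-1) gi2 gj2 Si2 Sj2 gbr Sbr);
  rewrite ?rmorph_short_a ?fmorphV ?Sixy ?Sjxy ?Six ?Siy ?Sjx ?Sjy ?invrK //.
- exact: braid3_coef_0.
- exact: braid3_coef_i.
- exact: braid3_coef_j.
Qed.
End ShortShort.

Section ShortLong.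
Hypothesis gbr : forall g, gi (gj (gi (gj g))) = gj (gi (gj (gi g))).
Hypothesis Sbr : forall x, Si (Sj (Si (Sj x))) = Sj (Si (Sj (Si x))).
Variables t s u x y : K.
Hypotheses (t0 : t != 0) (s0 : s != 0) (u0 : u != 0) (x0 : x != 0) (y0 : y != 0).
Hypotheses (d1 : 1 - x != 0) (d2 : 1 - x * y ^+ 2 != 0) (d3 : 1 - y ^+ 2 != 0).
Hypotheses (d4 : 1 - (x * y) ^+ 2 != 0).
Hypotheses (Sit : Si t = t) (Sjt : Sj t = t) (Sis : Si s = s) (Sjs : Sj s = s).
Hypotheses (Siu : Si u = u) (Sju : Sj u = u).
Hypotheses (Six : Si x = x^-1) (Siy : Si y = x * y) (Sjy : Sj y = y^-1) (Sjx : Sj x = x * y ^+ 2).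

Lemma demazure_braid4 h g :
  let Ti := demazure Si gi (short_a t x) (t - short_a t x) in
  let Tj := demazure Sj gj (long_a s u y) (s - long_a s u y) in
  Ti (Tj (Ti (Tj h))) g = Tj (Ti (Tj (Ti h))) g.
Proof.
move=> Ti Tj.
have Siq : Si (x * y) = y by rewrite rmorphM Six Siy mulKf.
have Sjq : Sj (x * y) = x * y by rewrite rmorphM Sjx Sjy expr2 mulrA mulfK.
have Sip : Si (x * y ^+ 2) = x * y ^+ 2.
  by rewrite rmorphM rmorphXn Six Siy exprMn expr2 -mulrA mulKf.
have Sjp : Sj (x * y ^+ 2) = x.
  by rewrite rmorphM rmorphXn Sjx Sjy exprVn mulfK // expf_neq0.
rewrite /Ti /Tj /demazure.
apply: (@braid4_identity K G gi gj Si Sj t s (short_a t x) (short_a t x^-1)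
  (short_a t (x * y ^+ 2)) (short_a t (x * y ^+ 2)^-1) (long_a s u y) (long_a s u y^-1)
  (long_a s u (x * y)) (long_a s u (x * y)^-1) gi2 gj2 Si2 Sj2 gbr Sbr);
  rewrite ?rmorph_short_a ?rmorph_long_a ?fmorphV ?Sip ?Sjp ?Siq ?Sjq ?Six ?Siy ?Sjx ?Sjy ?invrK //.
- exact: braid4_coef_0.
- exact: braid4_coef_i.
- exact: braid4_coef_j.
- exact: braid4_coef_ij.
- exact: braid4_coef_ji.
Qed.
End ShortLong.

Lemma demazure_far a b h g : (forall g, gi (gj g) = gj (gi g)) ->
  (forall x, Si (Sj x) = Sj (Si x)) -> Si b = b -> Sj a = a ->
  forall t s, Si s = s -> Sj t = t ->
  let Ti := demazure Si gi a (t - a) in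
  let Tj := demazure Sj gj b (s - b) in Ti (Tj h) g = Tj (Ti h) g.
Proof.
move=> gC SC Sib Sja t s Sis Sjt; rewrite /demazure /=.
rewrite !(rmorphD, rmorphN, rmorphM) /= Sib Sja Sis Sjt SC gC; ring.
Qed.

Lemma demazure_quad a t h g : t != 0 -> Si t = t -> a + Si a = t - t^-1 ->
  let Ti := demazure Si gi a (t - a) in
  Ti (Ti h) g = (t - t^-1) * Ti h g + h g.
Proof.
move=> t0 Sit e; rewrite /demazure /=.
rewrite !(rmorphD, rmorphN, rmorphM) /= Sit Si2 gi2.
have -> : Si a = t - t^-1 - a by rewrite -e; ring.
by field.
Qed.

Lemma short_a_refl (t x : K) : t != 0 -> x != 0 -> 1 - x != 0 ->
  short_a t x + short_a t x^-1 = t - t^-1.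
Proof. by move=> t0 x0 d; rewrite /short_a; field; nzs. Qed.

Lemma long_a_refl (t u y : K) : t != 0 -> u != 0 -> y != 0 -> 1 - y ^+ 2 != 0 ->
  long_a t u y + long_a t u y^-1 = t - t^-1.
Proof. by move=> t0 u0 y0 d; rewrite /long_a; field; nzs. Qed.

Lemma short_numer (t x : K) : t != 0 -> 1 - x != 0 ->
  t - (t^-1 * (1 - t ^+ 2 * x)) / (1 - x) = short_a t x.
Proof. by move=> t0 d; rewrite /short_a; field; nzs. Qed.

Lemma long_numer (t u y : K) : t != 0 -> u != 0 -> 1 - y ^+ 2 != 0 ->
  t - (t^-1 * ((1 - t * u * y) * (1 + t / u * y))) / (1 - y ^+ 2) = long_a t u y.
Proof. by move=> t0 u0 d; rewrite /long_a; field; nzs. Qed.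
End BraidField.

Lemma mulr1_neq0 (R : nzRingType) (x y : R) : x * y = 1 -> x != 0.
Proof. by move=> e; apply: contra_eq_neq e => ->; rewrite mul0r eq_sym oner_eq0. Qed.

Lemma subr_mulN1 (R : pzRingType) (x y : R) : 1 - (- x) * y = 1 + x * y.
Proof. by rewrite mulNr opprK. Qed.

(** * Explicit form of the reflection coefficients *)

Section HalfMonomials.
Variable n : nat.
Implicit Types (v : lexp n * int) (b : lexp n * int) (c d : baseF) (k : int).

Lemma kcM' c d : tofrac (cst n (c * d)) = tofrac (cst n c) * tofrac (cst n d).
Proof. exact: (etrans (congr1 (fun x => tofrac x) (rmorphM (@cst n) c d)) (tofracM _ _)). Qed.
Lemma kc1' : tofrac (cst n 1) = 1.
Proof. exact: (etrans (congr1 (fun x => tofrac x) (rmorph1 (@cst n))) (tofrac1 _)). Qed.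
Lemma kcN' c : tofrac (cst n (- c)) = - tofrac (cst n c).
Proof. exact: (etrans (congr1 (fun x => tofrac x) (rmorphN (@cst n) c)) (tofracN _)). Qed.
Lemma kcB' c d : tofrac (cst n (c - d)) = tofrac (cst n c) - tofrac (cst n d).
Proof. exact: (etrans (congr1 (fun x => tofrac x) (rmorphB (@cst n) c d)) (tofracB _ _)). Qed.
Lemma kc_mulV c : c \is a GRing.unit -> tofrac (cst n c) * tofrac (cst n c^-1) = 1.
Proof. by move=> uc; rewrite -kcM' (divrr uc) kc1'. Qed.
Lemma kc_neq0 c : c \is a GRing.unit -> tofrac (cst n c) != 0.
Proof. by move=> uc; exact: mulr1_neq0 (kc_mulV uc). Qed.
Lemma kcV' c : c \is a GRing.unit -> tofrac (cst n c^-1) = (tofrac (cst n c))^-1.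
Proof.
by move=> uc; apply: (mulfI (kc_neq0 uc)); rewrite kc_mulV // divff // kc_neq0.
Qed.

(* e^(lam + k delta / 2) *)
Definition qhz k : baseF := pmon false (row6 k 0 0 0 0 0).
Definition hmon v : FTfrac n := tofrac (fmon (qhz v.2) v.1).

Lemma qhzD k l : qhz (k + l) = qhz k * qhz l.
Proof. by rewrite /qhz pmonM row6D; apply: pmon_row. Qed.
Lemma qhz_q k : qhz (k * 2) = q ^ k.
Proof. by rewrite q_pmon. Qed.

Lemma hmonD v w : hmon v * hmon w = hmon (v.1 + w.1, v.2 + w.2).
Proof.
rewrite -tofracM; apply: (congr1 (fun x => tofrac x)); apply: etrans (fmonM _ _ _ _) _.
by rewrite -qhzD.
Qed.
Lemma hmon0 : hmon (0, 0) = 1.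
Proof.
have e : fmon (qhz 0) 0 = 1 :> FT n by rewrite /qhz row60 pmon1 fmon1.
by rewrite /hmon e tofrac1.
Qed.
Lemma hmon_neq0 v : hmon v != 0.
Proof.
apply/eqP => e; have := hmonD v (- v.1, - v.2); rewrite e mul0r /= !subrr hmon0.
by move/esym/eqP; rewrite oner_eq0.
Qed.
Lemma hmonV v : hmon (- v.1, - v.2) = (hmon v)^-1.
Proof.
by apply: (mulfI (hmon_neq0 v)); rewrite hmonD /= !subrr hmon0 divff ?hmon_neq0.
Qed.

Lemma sr_hmon b v : isroot b.1 -> sr_K (arefl b) (hmon v) =
  hmon (v.1 - dot v.1 (coroot b.1) *: b.1, v.2 - dot v.1 (coroot b.1) * (b.2 * 2)).
Proof.
move=> rb; apply: etrans (sr_KE _ _) _; apply: (congr1 (fun x => tofrac x)).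
apply: etrans (sr_fmon _ _ _) _.
have := aact_arefl (v.1, 0) rb; rewrite /aact /apair => -[e1 e2].
rewrite add0r sub0r in e2; rewrite e1 -qhz_q -qhzD.
have -> : v.2 + dot (arefl b).1 (v.1 - dot v.1 (coroot b.1) *: b.1) * 2 =
   v.2 - dot v.1 (coroot b.1) * (b.2 * 2) by rewrite -e1 e2; ring.
by [].
Qed.

Lemma kc_fmon c a : tofrac (cst n c) * tofrac (fmon 1 a) = tofrac (fmon c a).
Proof.
rewrite -tofracM; apply: (congr1 (fun x => tofrac x)); apply: etrans (fmon_cst _ _ _) _.
by rewrite mulr1.
Qed.
Lemma kc_hmon c v : tofrac (cst n c) * hmon v = tofrac (fmon (c * qhz v.2) v.1).
Proof. by rewrite -tofracM; apply: (congr1 (fun x => tofrac x)); exact: fmon_cst. Qed.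

Lemma numer0 k : t0h * u0h * qhz k = pmon false (row6 k 0 1 0 1 0).
Proof. by rewrite pE2 pE4 pmonM row6D pmonM row6D; apply: pmon_row; lia. Qed.
Lemma numer0' k : - (t0h / u0h) * qhz k = pmon true (row6 k 0 1 0 (-1) 0).
Proof. by rewrite pE2 vE4 pmonM row6D pmonN pmonM row6D; apply: pmon_row; lia. Qed.
Lemma numerN k : tnh * unh * qhz k = pmon false (row6 k 0 0 1 0 1).
Proof. by rewrite pE3 pE5 pmonM row6D pmonM row6D; apply: pmon_row; lia. Qed.
Lemma numerN' k : - (tnh / unh) * qhz k = pmon true (row6 k 0 0 1 0 (-1)).
Proof. by rewrite pE3 vE5 pmonM row6D pmonN pmonM row6D; apply: pmon_row; lia. Qed.

Lemma tofrac_rfac b : tofrac (rfac b) = 1 - hmon (b.1, b.2 * 2).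
Proof. by rewrite /hmon qhz_q /= -tofrac1 -tofracB. Qed.

Lemma tofrac_nfac b c k : k = b.2 * (if dot b.1 b.1 == 2 then 2 else 1) ->
  tofrac (nfac b (c * qhz k)) = 1 - tofrac (cst n c) * hmon (coroot b.1, k).
Proof. by move=> _; rewrite kc_hmon -tofrac1 -tofracB. Qed.

Lemma sr_K_cst g c : sr_K g (tofrac (cst n c)) = tofrac (cst n c).
Proof. exact: (etrans (sr_KE _ _) (congr1 (fun x => tofrac x) (sr_act_cst g c))). Qed.
End HalfMonomials.

Section Explicit.
Variable m : nat.
Local Notation n := m.+1.
Implicit Types (D : DqW n) (g : shift_refl n) (b : lexp n * int) (i j : 'I_m.+2).

Definition is_long i := (i == 0 :> nat) || (i == n :> nat).
Definition upar i : baseF := if i == 0 :> nat then u0h else unh.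
Definition xr i : FTfrac n := hmon ((simple i).1, (simple i).2 * 2).
(** For a long root this is e^(alpha_i / 2). For i = 0 it is q^(1/2) X_1^-1, whence the half
    multiples of delta. *)
Definition yr i : FTfrac n := hmon (coroot (simple i).1, (simple i).2).

Lemma tparE i : tpar i = if i == 0 :> nat then t0h else if i == n :> nat then tnh else th.
Proof. by []. Qed.

Lemma tpar_unit i : tpar i \is a GRing.unit.
Proof. by rewrite /tpar; case: ifP => _; [|case: ifP => _]; exact: param_unit. Qed.
Lemma upar_unit i : upar i \is a GRing.unit.
Proof. by rewrite /upar; case: ifP => _; exact: param_unit. Qed.

Lemma simple_dot i : dot (simple i).1 (simple i).1 = if is_long i then 4 else 2.
Proof.
rewrite /is_long; case: simpleP => [->|->|p p' ep ep' hi] /=.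
- by rewrite dotNl dotNr opprK dotMnr dotC dotMnr eps_dot eqxx.
- by rewrite eqxx ?orbT dotMnr dotC dotMnr eps_dot eqxx.
rewrite ifF; last lia.
have pp' : p != p' by rewrite -val_eqE /= ep ep'; lia.
by have := dot_short false true pp'; rewrite /= expr0 expr1 scale1r scaleN1r.
Qed.

Lemma xr_long i : is_long i -> xr i = yr i ^+ 2.
Proof.
move=> li; have aa : dot (simple i).1 (simple i).1 != 2 by rewrite simple_dot li.
have e1 := coroot_mul2 (simple_root i) aa.
have e2 : (simple i).2 * 2 = (simple i).2 + (simple i).2 by lia.
apply: etrans _ (esym (expr2 _)); apply: etrans _ (esym (hmonD _ _)).
by apply: (congr1 (@hmon n)); rewrite e2 {1}e1 mulr2n.
Qed.
Lemma xr_short i : ~~ is_long i -> coroot (simple i).1 = (simple i).1.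
Proof. by move=> li; apply: coroot_short2 => //; rewrite simple_dot (negbTE li). Qed.

Lemma tofrac_rfac_simple i : tofrac (rfac (simple i)) = 1 - xr i.
Proof. exact: tofrac_rfac. Qed.

Lemma xr_neq1 i : 1 - xr i != 0.
Proof. by rewrite -tofrac_rfac_simple; exact: tofrac_rfac_neq0. Qed.

Lemma numer_split i : tofrac (numer i) =
  (kc m (tpar i))^-1 * tofrac (\prod_(p <- nums (simple i)) nfac (simple i) p).
Proof.
have e : tofrac (cst n (tpar i)^-1) = (kc m (tpar i))^-1 := kcV' _ (tpar_unit i).
by rewrite -e; exact: tofracM.
Qed.

Lemma ka_short i : ~~ is_long i -> ka i = short_a (kc m (tpar i)) (xr i).
Proof.
move=> li; have ti : tpar i = th.
  by move: li; rewrite tparE negb_or => /andP[/negbTE-> /negbTE->].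
have e : nums (simple i) = [:: th ^+ 2 * qhz ((simple i).2 * 2)].
  rewrite /nums simple_dot (negbTE li) eqxx; congr [:: _].
  by rewrite pE1 pmonX row6D /qhz pmonM row6D; apply: pmon_row; lia.
have pE : tofrac (\prod_(p <- nums (simple i)) nfac (simple i) p) =
    1 - kc m (tpar i) ^+ 2 * xr i.
  have e3 : tofrac (cst n (th ^+ 2)) = kc m (tpar i) ^+ 2.
    rewrite ti; apply: etrans (congr1 (fun c => tofrac (cst n c)) (expr2 th)) _.
    by apply: etrans (kcM' _ _ _) _; exact: esym (expr2 _).
  rewrite e big_seq1 (@tofrac_nfac n _ _ ((simple i).2 * 2)).
    by rewrite e3 (xr_short li).
  by rewrite simple_dot (negbTE li).
have nE := numer_split i; rewrite pE in nE.
rewrite /ka /kb nE tofrac_rfac_simple; apply: short_numer; last exact: xr_neq1.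
exact: kc_neq0 (tpar_unit i).
Qed.

Lemma ka_long i : is_long i -> ka i = long_a (kc m (tpar i)) (kc m (upar i)) (yr i).
Proof.
move=> li.
have e : nums (simple i) = [:: tpar i * upar i * qhz (simple i).2; - (tpar i / upar i) * qhz (simple i).2].
  rewrite /nums simple_dot li /= tparE /upar; move: li; rewrite /is_long.
  case: (simpleP i) => [ei|ei|p p' ep ep' hi].
  - by move=> _; rewrite ei /= numer0 numer0'.
  - by move=> _; rewrite ei /= eqxx numerN numerN'.
  - lia.
have pE : tofrac (\prod_(p <- nums (simple i)) nfac (simple i) p) =
   (1 - kc m (tpar i) * kc m (upar i) * yr i) * (1 + kc m (tpar i) / kc m (upar i) * yr i).
  have e2 : tofrac (cst n (tpar i * upar i)) = kc m (tpar i) * kc m (upar i) := kcM' _ _ _.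
  have e3 : tofrac (cst n (- (tpar i / upar i))) = - (kc m (tpar i) / kc m (upar i)).
    apply: etrans (kcN' _ _) _.
    have e4 : tofrac (cst n (upar i)^-1) = (kc m (upar i))^-1 := kcV' _ (upar_unit i).
    have e5 : tofrac (cst n (tpar i / upar i)) = kc m (tpar i) * tofrac (cst n (upar i)^-1) := kcM' _ _ _.
    by rewrite e5 e4.
  have ek : (simple i).2 = (simple i).2 * (if dot (simple i).1 (simple i).1 == 2 then 2 else 1).
    by rewrite simple_dot li mulr1.
  have f1 := tofrac_nfac (tpar i * upar i) ek; have f2 := tofrac_nfac (- (tpar i / upar i)) ek.
  rewrite e2 in f1; rewrite e3 in f2.
  have {}f2 := etrans f2 (subr_mulN1 _ _).
  rewrite e big_cons big_seq1; apply: etrans (tofracM _ _) _.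
  exact: (congr2 (fun x y => x * y) f1 f2).
have nE := numer_split i; rewrite pE in nE.
rewrite /ka /kb nE tofrac_rfac_simple xr_long //; apply: long_numer.
- exact: kc_neq0 (tpar_unit i).
- exact: kc_neq0 (upar_unit i).
by rewrite -xr_long //; exact: xr_neq1.
Qed.
End Explicit.

(** * Quadratic and braid relations for the T_i *)

Section TopRelations.
Variable m : nat.
Local Notation n := m.+1.
Implicit Types (D : DqW n) (g : shift_refl n) (b : lexp n * int) (i j : 'I_m.+2).

Local Notation S i := (sr_K (srefl_simple i)).

Lemma S2 i (x : FTfrac n) : S i (S i x) = x.
Proof.
rewrite -sr_KM.
have -> : (srefl_simple i * srefl_simple i)%g = 1%g.
  by have := areflK 1%g (simple_root i); rewrite mulg1.
exact: sr_K1.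
Qed.

Lemma srefl2 i g : (srefl_simple i * (srefl_simple i * g))%g = g.
Proof. exact: areflK. Qed.

Lemma S_hmon i v : S i (hmon v) =
  hmon (v.1 - dot v.1 (coroot (simple i).1) *: (simple i).1,
        v.2 - dot v.1 (coroot (simple i).1) * ((simple i).2 * 2)).
Proof. exact: sr_hmon. Qed.

Lemma S_kc i c : S i (kc m c) = kc m c.
Proof. exact: sr_K_cst. Qed.

Lemma hmon_eq v w : v.1 = w.1 -> v.2 = w.2 -> hmon v = hmon w :> FTfrac n.
Proof. by case: v w => [x y] [x' y'] /= -> ->. Qed.

Lemma S_xr i j : S i (xr j) = xr j * hmon (- apair (simple j) (simple i) *: (simple i).1,
   - apair (simple j) (simple i) * ((simple i).2 * 2)).
Proof.
rewrite S_hmon hmonD; apply: hmon_eq; rewrite /= -/(apair _ _) ?scaleNr //; ring.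
Qed.

Lemma apair_simple i : apair (simple i) (simple i) = 2.
Proof. by rewrite /apair; have [_ ->] := coroot_root (simple_root i). Qed.

Lemma xr_neq0 i : xr i != 0. Proof. exact: hmon_neq0. Qed.
Lemma yr_neq0 i : yr i != 0. Proof. exact: hmon_neq0. Qed.

Lemma S_xr_self i : S i (xr i) = (xr i)^-1.
Proof.
rewrite S_xr apair_simple; apply: (mulfI (xr_neq0 i)); rewrite divff ?xr_neq0 // !hmonD -hmon0.
apply: hmon_eq => /=; last by ring.
by move: (simple i).1 => u; apply/rowP => k; rewrite !mxE; ring.
Qed.

Lemma S_xr_adj i j : apair (simple j) (simple i) = -1 -> S i (xr j) = xr i * xr j.
Proof.
move=> e; rewrite S_xr e.
have -> : hmon (- -1 *: (simple i).1, - -1 * ((simple i).2 * 2)) = xr i.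
  by apply: hmon_eq; rewrite /= opprK ?scale1r ?mul1r.
exact: mulrC.
Qed.

Lemma S_xr_far i j : apair (simple j) (simple i) = 0 -> S i (xr j) = xr j.
Proof.
move=> e; rewrite S_xr e oppr0 scale0r mul0r hmon0 mulr1; by [].
Qed.

Lemma coroot_pair i j : is_long j ->
  apair (simple j) (simple i) = 2 * dot (coroot (simple j).1) (coroot (simple i).1).
Proof.
move=> lj; have aa : dot (simple j).1 (simple j).1 != 2 by rewrite simple_dot lj.
by rewrite /apair {1}(coroot_mul2 (simple_root j) aa) dotC dotMnr dotC; lia.
Qed.

Lemma S_yr i j (d : int) : is_long j -> apair (simple j) (simple i) = 2 * d ->
  S i (yr j) = yr j * hmon (- d *: (simple i).1, - d * ((simple i).2 * 2)).
Proof.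
move=> lj; rewrite coroot_pair // => e.
have {}e : dot (coroot (simple j).1) (coroot (simple i).1) = d by lia.
by rewrite S_hmon hmonD; apply: hmon_eq; rewrite /= e ?scaleNr //; ring.
Qed.

Lemma S_yr_self i : is_long i -> S i (yr i) = (yr i)^-1.
Proof.
move=> li; rewrite (@S_yr i i 1) ?apair_simple //.
apply: (mulfI (yr_neq0 i)); rewrite divff ?yr_neq0 // mulrA -expr2 -xr_long // hmonD -hmon0.
apply: hmon_eq => /=; last by ring.
by move: (simple i).1 => u; apply/rowP => k; rewrite !mxE; ring.
Qed.

Lemma S_yr_adj i j : is_long j -> apair (simple j) (simple i) = -2 -> S i (yr j) = xr i * yr j.
Proof.
move=> lj e; rewrite (@S_yr i j (-1) lj); last by rewrite e.
have -> : hmon (- -1 *: (simple i).1, - -1 * ((simple i).2 * 2)) = xr i.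
  by apply: hmon_eq; rewrite /= opprK ?scale1r ?mul1r.
exact: mulrC.
Qed.

Lemma S_yr_far i j : is_long j -> apair (simple j) (simple i) = 0 -> S i (yr j) = yr j.
Proof.
by move=> lj e; rewrite (@S_yr i j 0) // oppr0 scale0r mul0r hmon0 mulr1.
Qed.

Lemma S_short_a i t x : S i t = t -> S i (short_a t x) = short_a t (S i x).
Proof. exact: (@rmorph_short_a _ (sr_K (srefl_simple i))). Qed.
Lemma S_long_a i t u x : S i t = t -> S i u = u -> S i (long_a t u x) = long_a t u (S i x).
Proof. exact: (@rmorph_long_a _ (sr_K (srefl_simple i))). Qed.

Lemma S_ka_far i j : apair (simple j) (simple i) = 0 -> S i (ka j) = ka j.
Proof.
move=> e; have [lj|sj] := boolP (is_long j).
  by rewrite ka_long // (S_long_a _ (S_kc _ _) (S_kc _ _)) S_yr_far.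
by rewrite ka_short // (S_short_a _ (S_kc _ _)) S_xr_far.
Qed.

Lemma kct_neq0 i : kc m (tpar i) != 0. Proof. exact: kc_neq0 (tpar_unit i). Qed.
Lemma kcu_neq0 i : kc m (upar i) != 0. Proof. exact: kc_neq0 (upar_unit i). Qed.

Lemma ka_refl i : ka i + S i (ka i) = kc m (tpar i) - (kc m (tpar i))^-1.
Proof.
have [lj|sj] := boolP (is_long i).
  rewrite ka_long // (S_long_a _ (S_kc _ _) (S_kc _ _)) S_yr_self //; apply: long_a_refl.
  - exact: kct_neq0.
  - exact: kcu_neq0.
  - exact: yr_neq0.
  by rewrite -xr_long // xr_neq1.
rewrite ka_short // (S_short_a _ (S_kc _ _)) S_xr_self; apply: short_a_refl.
- exact: kct_neq0.
- exact: xr_neq0.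
- exact: xr_neq1.
Qed.

Definition opT i := demazure (S i) (fun g => srefl_simple i * g)%g (ka i) (kc m (tpar i) - ka i).

(** Since [cf D] determines D, each relation between the T_i becomes an identity of twisted Demazure
    operators, applied to the coefficient function of 1. *)
Lemma cf_TopE i D : cf (Top i * D) = opT i (cf D).
Proof.
apply: funext => g; rewrite cf_Top /opT /demazure.
by have -> : kc m (tpar i) - ka i = kb i by rewrite /ka subKr.
Qed.

Lemma cf_fun D D' : cf D = cf D' -> D = D'.
Proof. by move=> e; apply: cf_ext => g; rewrite e. Qed.

Lemma cf_scale (c : baseF) D g : cf (c *: D) g = kc m c * cf D g.
Proof. by rewrite dq_scaleE; exact: cf_fop. Qed.

Lemma tparV_kc i : kc m (tpar i - (tpar i)^-1) = kc m (tpar i) - (kc m (tpar i))^-1.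
Proof.
apply: etrans (kcB' _ _ _) _; apply: (congr1 (fun z => kc m (tpar i) - z)).
exact: kcV' (tpar_unit i).
Qed.

Lemma cf_Top1 i : cf (Top i) = opT i (cf 1).
Proof. by rewrite -cf_TopE mulr1. Qed.
Lemma cf_Top2 i j : cf (Top i * Top j) = opT i (opT j (cf 1)).
Proof. exact: (etrans (cf_TopE i (Top j)) (congr1 (opT i) (cf_Top1 j))). Qed.
Lemma cf_Top3 i j k : cf (Top i * Top j * Top k) = opT i (opT j (opT k (cf 1))).
Proof.
apply: etrans (congr1 (@cf n) (esym (mulrA _ _ _))) _.
exact: (etrans (cf_TopE i _) (congr1 (opT i) (cf_Top2 j k))).
Qed.
Lemma cf_Top4 i j k l :
  cf (Top i * Top j * Top k * Top l) = opT i (opT j (opT k (opT l (cf 1)))).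
Proof.
have e : Top i * Top j * Top k * Top l = Top i * (Top j * Top k * Top l) by rewrite !mulrA.
apply: etrans (congr1 (@cf n) e) _.
exact: (etrans (cf_TopE i _) (congr1 (opT i) (cf_Top3 j k l))).
Qed.

Lemma Top_quad i : Top i * Top i = (tpar i - (tpar i)^-1) *: Top i + 1.
Proof.
have e1 : cf (Top i) = opT i (cf 1) by rewrite -cf_TopE mulr1.
apply: cf_ext => g; rewrite cfD cf_scale (cf_TopE i (Top i)) e1 tparV_kc.
exact: (@demazure_quad _ _ _ (sr_K (srefl_simple i)) (@srefl2 i) (@S2 i) (ka i)
  (kc m (tpar i)) (cf 1) g (kct_neq0 i) (S_kc _ _) (ka_refl i)).
Qed.

Lemma Top_far i j : far i j -> Top i * Top j = Top j * Top i.
Proof.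
move=> f; have f' : far j i by move: f; rewrite /far; lia.
have gC g : (srefl_simple i * (srefl_simple j * g) = srefl_simple j * (srefl_simple i * g))%g.
  exact: srefl_far.
have SC (x : FTfrac n) : S i (S j x) = S j (S i x).
  by rewrite -!sr_KM; have := gC 1%g; rewrite !mulg1 => ->.
apply: cf_fun; apply: etrans (cf_Top2 i j) (etrans _ (esym (cf_Top2 j i))); apply: funext => g.
exact: (@demazure_far _ _ _ _ (sr_K (srefl_simple i)) (sr_K (srefl_simple j)) (ka i) (ka j)
  (cf 1) g gC SC (S_ka_far (simple_far f')) (S_ka_far (simple_far f)) _ _ (S_kc _ _) (S_kc _ _)).
Qed.

Lemma Top_braid3 i j : (1 <= i)%N -> (i.+2 <= n)%N -> j = i.+1 :> nat ->
  Top i * Top j * Top i = Top j * Top i * Top j.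
Proof.
move=> i1 iN eij; have [aij aji] := simple_adj3 i1 iN eij.
have gC g := srefl_braid3 g i1 iN eij.
have SC (x : FTfrac n) : S i (S j (S i x)) = S j (S i (S j x)).
  by rewrite -!sr_KM -!mulgA; have := gC 1%g; rewrite !mulg1 => ->.
have li : ~~ is_long i by rewrite /is_long; lia.
have lj : ~~ is_long j by rewrite /is_long; lia.
have et : tpar j = tpar i by rewrite !tparE !ifF //; lia.
have d3 : 1 - xr i * xr j != 0.
  rewrite -(S_xr_adj aji) -(rmorph1 (sr_K (srefl_simple i))) -rmorphB fmorph_eq0.
  exact: xr_neq1.
apply: cf_fun; apply: etrans (cf_Top3 i j i) (etrans _ (esym (cf_Top3 j i j))).
apply: funext => g; rewrite /opT (ka_short li) (ka_short lj) et.
exact: (@demazure_braid3 _ _ _ _ (sr_K (srefl_simple i)) (sr_K (srefl_simple j))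
  (@srefl2 i) (@srefl2 j) (@S2 i) (@S2 j) gC SC (kc m (tpar i)) (xr i) (xr j)
  (kct_neq0 i) (xr_neq0 i) (xr_neq0 j) (xr_neq1 i) (xr_neq1 j) d3 (S_kc _ _) (S_kc _ _)
  (S_xr_self i) (S_xr_adj aji) (S_xr_self j) (etrans (S_xr_adj aij) (mulrC _ _)) (cf 1) g).
Qed.

(** Both double bonds of the diagram are covered by one computation, with i short and j long. *)
Lemma Top_braid_short_long i j : ~~ is_long i -> is_long j ->
  apair (simple i) (simple j) = -1 -> apair (simple j) (simple i) = -2 ->
  (forall g, srefl_simple i * (srefl_simple j * (srefl_simple i * (srefl_simple j * g))) =
   srefl_simple j * (srefl_simple i * (srefl_simple j * (srefl_simple i * g))))%g ->
  Top i * Top j * Top i * Top j = Top j * Top i * Top j * Top i.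
Proof.
move=> li lj aij aji gC.
have SC (x : FTfrac n) : S i (S j (S i (S j x))) = S j (S i (S j (S i x))).
  by rewrite -!sr_KM -!mulgA; have := gC 1%g; rewrite !mulg1 => ->.
have Sjx : S j (xr i) = xr i * yr j ^+ 2.
  by apply: etrans (S_xr_adj aij) _; rewrite (xr_long lj); exact: mulrC.
have Siy := S_yr_adj lj aji.
have S0 k (z : FTfrac n) : 1 - z != 0 -> 1 - S k z != 0.
  by rewrite -{2}(rmorph1 (sr_K (srefl_simple k))) -rmorphB fmorph_eq0.
have d2 : 1 - xr i * yr j ^+ 2 != 0.
  exact: (eq_ind _ (fun z => 1 - z != 0) (S0 j _ (xr_neq1 i)) _ Sjx).
have d3 : 1 - yr j ^+ 2 != 0.
  exact: (eq_ind _ (fun z => 1 - z != 0) (xr_neq1 j) _ (xr_long lj)).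
have Siy2 : S i (yr j ^+ 2) = (xr i * yr j) ^+ 2.
  exact: (etrans (rmorphXn (sr_K (srefl_simple i)) 2 (yr j)) (congr1 (fun z => z ^+ 2) Siy)).
have d4 : 1 - (xr i * yr j) ^+ 2 != 0.
  exact: (eq_ind _ (fun z => 1 - z != 0) (S0 i _ d3) _ Siy2).
apply: cf_fun; apply: etrans (cf_Top4 i j i j) (etrans _ (esym (cf_Top4 j i j i))).
apply: funext => g; rewrite /opT (ka_short li) (ka_long lj).
exact: (@demazure_braid4 _ _ _ _ (sr_K (srefl_simple i)) (sr_K (srefl_simple j))
  (@srefl2 i) (@srefl2 j) (@S2 i) (@S2 j) gC SC (kc m (tpar i)) (kc m (tpar j))
  (kc m (upar j)) (xr i) (yr j)
  (kct_neq0 i) (kct_neq0 j) (kcu_neq0 j) (xr_neq0 i) (yr_neq0 j) (xr_neq1 i) d2 d3 d4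
  (S_kc _ _) (S_kc _ _) (S_kc _ _) (S_kc _ _) (S_kc _ _) (S_kc _ _)
  (S_xr_self i) Siy (S_yr_self lj) Sjx (cf 1) g).
Qed.

Lemma Top_braid4 i j : (1 < n)%N -> (i = 0 :> nat) \/ (i.+1 = n) -> j = i.+1 :> nat ->
  Top i * Top j * Top i * Top j = Top j * Top i * Top j * Top i.
Proof.
move=> n1 iN eij; have gC g := srefl_braid4 g n1 iN eij.
have [i0|i0] := eqVneq (i : nat) 0%N.
  have li : is_long i by rewrite /is_long i0.
  have lj : ~~ is_long j by rewrite /is_long; lia.
  have [[aij aji]|[aij aji]] := simple_adj4 n1 iN eij.
    exact: esym (Top_braid_short_long lj li aji aij gC).
  (* Pairings of a long simple root with coroots are even, so the value -1 is excluded. *)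
  have := coroot_pair j li; rewrite aij; lia.
have lj : is_long j by rewrite /is_long; lia.
have li : ~~ is_long i by rewrite /is_long; lia.
have [[aij aji]|[aij aji]] := simple_adj4 n1 iN eij.
  have := coroot_pair i lj; rewrite aji; lia.
exact: (Top_braid_short_long li lj aij aji (fun g => esym (gC g))).
Qed.
End TopRelations.

(** * Bernstein relations between T_i and F[T] *)

Lemma demazure_mul (K : fieldType) (G : Type) (S : {rmorphism K -> K}) (r : G -> G) (a b x : K)
    (h : G -> K) g :
  demazure S r a b (fun g => x * h g) g = S x * demazure S r a b h g + a * (x - S x) * h g.
Proof. by rewrite /demazure rmorphM; ring. Qed.

Section FunctionOperators.
Variable n : nat.
Implicit Types (x y : FT n) (D : DqW n) (c : baseF).

Lemma fopD x y : fop (x + y) = fop x + fop y.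
Proof.
rewrite /fop; have -> : toloc (x + y) = toloc x + toloc y by exact: rmorphD.
exact: smonD.
Qed.
Lemma fopM x y : fop (x * y) = fop x * fop y.
Proof.
apply/esym; apply: etrans (dmonM _ _ _ _) _; rewrite sr_loc1 mulg1 /fop.
by have -> : toloc (x * y) = toloc x * toloc y by exact: rmorphM.
Qed.
Lemma fop1 : fop 1 = 1 :> DqW n.
Proof. by rewrite /fop; have -> : toloc 1 = 1 :> floc n by exact: rmorph1. Qed.
Lemma fop_cst c D : fop (cst n c) * D = c *: D.
Proof. by rewrite dq_scaleE. Qed.
Lemma fop_cst1 c : fop (cst n c) = c *: 1.
Proof. by rewrite -fop_cst mulr1. Qed.
Lemma fop0 : fop 0 = 0 :> DqW n.
Proof.
rewrite /fop; have -> : toloc 0 = 0 :> floc n by exact: rmorph0.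
exact: smon0.
Qed.
Lemma fopN x : fop (- x) = - fop x.
Proof. by apply/eqP; rewrite -addr_eq0 -fopD addNr fop0. Qed.
Lemma cf_fop1 x g : cf (fop x) g = tofrac x * cf 1 g.
Proof. by have := cf_fop x 1 g; rewrite mulr1. Qed.
End FunctionOperators.

Section TopFunctions.
Variable m : nat.
Local Notation n := m.+1.
Implicit Types (D : DqW n) (g : shift_refl n) (i : 'I_m.+2) (j : 'I_n) (x y : FT n).

Local Notation s i := (srefl_simple i).

(** Bernstein's relation. The correction term is a_i (x - s_i x), and the hypothesis asks it to be a
    Laurent polynomial. *)
Lemma Top_fop i x y : ka i * (tofrac x - tofrac (sr_act (s i) x)) = tofrac y ->
  Top i * fop x = fop (sr_act (s i) x) * Top i + fop y.
Proof.
move=> e; apply: cf_ext => g.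
have cfx : cf (fop x) = fun g => tofrac x * cf 1 g := funext (cf_fop1 x).
apply: etrans (congr1 (fun f => f g) (cf_TopE i (fop x))) _.
apply: etrans (congr1 (fun f => opT i f g) cfx) _; apply/esym.
apply: etrans (cfD _ _ _) _.
have e1 : cf (fop (sr_act (s i) x) * Top i) g = tofrac (sr_act (s i) x) * opT i (cf 1) g.
  exact: (etrans (cf_fop _ _ _) (congr1 (fun f => _ * f g) (cf_Top1 i))).
apply: etrans (congr2 (fun u v => u + v) e1 (cf_fop1 y g)) _; apply/esym.
have sx : sr_K (s i) (tofrac x) = tofrac (sr_act (s i) x) := sr_KE _ _.
rewrite -sx -e -sx.
exact: (@demazure_mul _ _ (sr_K (s i)) (fun g => (s i * g)%g)).
Qed.

Lemma sr_simple_fmon i c a : sr_act (s i) (fmon c a) =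
  fmon (c * q ^ (- (dot a (coroot (simple i).1) * (simple i).2)))
       (a - dot a (coroot (simple i).1) *: (simple i).1).
Proof.
apply: etrans (sr_fmon _ _ _) _.
have := aact_arefl (a, 0) (simple_root i); rewrite /aact /apair => -[e1 e2].
by rewrite add0r sub0r in e2; rewrite e1 -e2 e1.
Qed.

Definition X j : FT n := fmon 1 (eps j).
Definition XV j : FT n := fmon 1 (- eps j).

Lemma XXV j : X j * XV j = 1.
Proof. by rewrite fmonM mulr1 subrr fmon1. Qed.
Lemma XVX j : XV j * X j = 1.
Proof. by rewrite fmonM mulr1 addNr fmon1. Qed.

Lemma sX_fix i j : j.+1 != i -> j != i :> nat -> sr_act (s i) (X j) = X j.
Proof.
move=> /eqP ji1 /eqP ji; rewrite /X sr_simple_fmon.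
have -> : dot (eps j) (coroot (simple i).1) = 0.
  case: (simple_coP i) => [ei|ei|p p' ep ep' hi];
  rewrite ?dotNr ?dotBr !eps_dot -!val_eqE /=.
  - by rewrite (_ : (j == 0 :> nat) = false) ?oppr0 //; lia.
  - by rewrite (_ : (j == m :> nat) = false) //; lia.
  rewrite ep ep' (_ : (j == i.-1 :> nat) = false); last by lia.
  by rewrite (_ : (j == i :> nat) = false) ?subr0 //; lia.
by rewrite mul0r oppr0 expr0z mulr1 scale0r subr0.
Qed.

Lemma sX_adj i j (k : 'I_n) : j.+1 = i -> k.+1 = i.+1 -> sr_act (s i) (X j) = X k.
Proof.
move=> eji eki; have ltk := ltn_ord k; rewrite /X sr_simple_fmon.
case: (simple_coP i) => [ei|ei|p p' ep ep' hi] /=; try lia.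
have -> : p = j by apply: val_inj => /=; lia.
have -> : p' = k by apply: val_inj => /=; lia.
have jk : (j == k) = false by apply/eqP => /(congr1 val) /=; lia.
rewrite dotBr !eps_dot eqxx jk subr0 mulr0 oppr0 expr0z mulr1 scale1r.
by rewrite opprB addrC subrK.
Qed.

Lemma sX_last i j : i = n :> nat -> j.+1 = n -> sr_act (s i) (X j) = XV j.
Proof.
move=> ein ej; rewrite /X sr_simple_fmon.
case: (simple_coP i) => [ei|ei|p p' ep ep' hi] /=; try lia.
have -> : ord_max = j by apply: val_inj => /=; lia.
rewrite eps_dot eqxx mulr0 oppr0 expr0z mulr1 scale1r mulr2n opprD addrA subrr add0r.
by [].
Qed.

Lemma sX_first i j : i = 0 :> nat -> j = 0 :> nat -> sr_act (s i) (X j) = cst n q * XV j.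
Proof.
move=> ein ej; rewrite /X sr_simple_fmon.
case: (simple_coP i) => [ei|ei|p p' ep ep' hi] /=; try lia.
have -> : ord0 = j by apply: val_inj.
rewrite dotNr eps_dot eqxx mulN1r opprK mul1r scaleN1r opprK.
have -> : eps j + - (eps j *+ 2) = - eps j by rewrite mulr2n opprD addrA subrr add0r.
by apply/esym; apply: etrans (fmon_cst _ _ _) _; rewrite mulr1.
Qed.
End TopFunctions.

Section BernsteinField.
Variable K : fieldType.
Lemma short_a_diff (t u v : K) : v != 0 -> 1 - u / v != 0 ->
  short_a t (u / v) * (u - v) = - ((t - t^-1) * v).
Proof.
move=> v0 d; rewrite /short_a.
have -> : u - v = - (1 - u / v) * v by field.
by rewrite mulrA mulrN divfK // mulNr.
Qed.
Lemma long_a_diff (t u y : K) : y != 0 -> 1 - y ^+ 2 != 0 ->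
  long_a t u y * (y - y^-1) = - ((t - t^-1) * y^-1 + (u - u^-1)).
Proof.
move=> y0 d; rewrite /long_a.
have -> : y - y^-1 = - (1 - y ^+ 2) * y^-1 by field.
rewrite mulrA mulrN divfK // mulNr mulrDl; congr (- (_ + _)).
by rewrite mulfK.
Qed.
Lemma long_a_diff_first (t u k y x sx : K) : y != 0 -> 1 - y ^+ 2 != 0 ->
  x = k / y -> sx = k * y ->
  long_a t u y * (x - sx) = (t - t^-1) * x + k * (u - u^-1).
Proof.
move=> y0 d -> ->; have -> : k / y - k * y = - k * (y - y^-1) by ring.
by rewrite mulrCA long_a_diff //; ring.
Qed.
Lemma div_flip (k x y : K) : k != 0 -> x != 0 -> y = k * x^-1 -> x = k / y.
Proof. by move=> k0 x0 ->; rewrite invfM invrK mulrA divff // mul1r. Qed.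
End BernsteinField.

Section Bernstein.
Variable m : nat.
Local Notation n := m.+1.
Implicit Types (D : DqW n) (g : shift_refl n) (i : 'I_m.+2) (j k : 'I_n) (x y : FT n).

Lemma fop_affine c x d : fop (cst n c * x + cst n d) = c *: fop x + d *: 1.
Proof.
apply: etrans (fopD _ _) _; rewrite fop_cst1; apply: (congr1 (fun z => z + d *: 1)).
exact: etrans (fopM _ _) (fop_cst _ _).
Qed.
Lemma tofrac_affine c x d : tofrac (cst n c * x + cst n d) =
  tofrac (cst n c) * tofrac x + tofrac (cst n d).
Proof. by rewrite tofracD tofracM. Qed.

Definition ctau i : baseF := tpar i - (tpar i)^-1.

Lemma kc_ctau i : tofrac (cst n (ctau i)) = kc m (tpar i) - (kc m (tpar i))^-1.
Proof. exact: tparV_kc. Qed.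

Lemma hX j : tofrac (X j) = hmon (eps j, 0).
Proof. by rewrite /hmon /qhz row60 pmon1. Qed.
Lemma hXV j : tofrac (XV j) = hmon (- eps j, 0).
Proof. by rewrite /hmon /qhz row60 pmon1. Qed.
Lemma hXVE j : tofrac (XV j) = (tofrac (X j))^-1.
Proof.
apply: etrans (hXV j) (etrans _ (congr1 (fun z => z^-1) (esym (hX j)))).
exact: hmonV (eps j, 0).
Qed.
Lemma hX_neq0 j : tofrac (X j) != 0.
Proof. by rewrite hX hmon_neq0. Qed.

Lemma Top_X_adj i j k : j.+1 = i -> k.+1 = i.+1 ->
  Top i * fop (X j) = fop (X k) * Top i - ctau i *: fop (X k).
Proof.
move=> eji eki; have sx := sX_adj eji eki; have ltk := ltn_ord k.
have li : ~~ is_long i by rewrite /is_long; lia.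
have ex : xr i = tofrac (X j) / tofrac (X k).
  apply: etrans _ (congr2 (fun a b => a * b) (esym (hX j)) (etrans (esym (hXV k)) (hXVE k))).
  rewrite hmonD /xr; apply: hmon_eq.
    case: simpleP => [ei|ei|p p' ep ep' hi] /=; try lia.
    have -> : p = j by apply: val_inj => /=; lia.
    by have -> : p' = k by apply: val_inj => /=; lia.
  by case: simpleP => [ei|ei|p p' ep ep' hi] /=; try lia.
have d := xr_neq1 i; rewrite ex in d.
have e : ka i * (tofrac (X j) - tofrac (sr_act (srefl_simple i) (X j))) =
    tofrac (- (cst n (ctau i) * X k)).
  rewrite sx (ka_short li) ex; apply: etrans (short_a_diff _ (hX_neq0 k) d) _.
  by rewrite -kc_ctau -tofracM -tofracN.
have T := Top_fop e; rewrite sx in T; apply: etrans T _.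
have E : fop (- (cst n (ctau i) * X k)) = - (ctau i *: fop (X k)).
  exact: etrans (fopN _) (congr1 (fun z => - z) (etrans (fopM _ _) (fop_cst _ _))).
exact: (congr2 (fun a b : DqW n => a + b) (erefl (fop (X k) * Top i)) E).
Qed.

Lemma Top_X_last i j : i = n :> nat -> j.+1 = n ->
  Top i * fop (X j) = fop (XV j) * Top i - (ctau i *: fop (XV j) + (unh - unh^-1) *: 1).
Proof.
move=> ein ej; have sx := sX_last ein ej.
have li : is_long i by rewrite /is_long ein eqxx orbT.
have ey : yr i = tofrac (X j).
  rewrite hX /yr; apply: hmon_eq => /=.
    case: (simple_coP i) => [ei|ei|p p' ep ep' hi] /=; try lia.
    by have -> : ord_max = j by apply: val_inj => /=; lia.
  by case: simpleP => [ei|ei|p p' ep ep' hi] /=; try lia.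
have d := xr_neq1 i; rewrite (xr_long li) ey in d.
have eu : upar i = unh by rewrite /upar ein.
have kaE : ka i = long_a (kc m (tpar i)) (kc m unh) (tofrac (X j)).
  exact: (etrans (ka_long li) (congr2 (long_a (kc m (tpar i))) (congr1 (kc m) eu) ey)).
have sxE : tofrac (X j) - tofrac (sr_act (srefl_simple i) (X j)) = tofrac (X j) - (tofrac (X j))^-1.
  apply: (congr1 (fun z => tofrac (X j) - z)).
  exact: (etrans (congr1 (fun z => tofrac z) sx) (hXVE j)).
have e : ka i * (tofrac (X j) - tofrac (sr_act (srefl_simple i) (X j))) =
    tofrac (- (cst n (ctau i) * XV j + cst n (unh - unh^-1))).
  apply: etrans _ (esym (etrans (tofracN _) (congr1 (fun z => - z) (tofrac_affine _ _ _)))).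
  apply: etrans (congr2 (fun a b => a * b) kaE sxE) _.
  apply: etrans (long_a_diff _ _ (hX_neq0 j) d) _.
  have eun : kc m unh - (kc m unh)^-1 = tofrac (cst n (unh - unh^-1)).
    apply/esym; apply: etrans (kcB' _ _ _) _; apply: (congr1 (fun z => kc m unh - z)).
    exact: kcV' (param_unit _).
  apply: etrans (congr2 (fun a b => - (a * (tofrac (X j))^-1 + b)) (esym (kc_ctau i)) eun) _.
  exact: (congr1 (fun a => - (tofrac (cst n (ctau i)) * a + _)) (esym (hXVE j))).
have T := Top_fop e; rewrite sx in T; apply: etrans T _.
have E : fop (- (cst n (ctau i) * XV j + cst n (unh - unh^-1))) =
    - (ctau i *: fop (XV j) + (unh - unh^-1) *: 1).
  exact: etrans (fopN _) (congr1 (fun z => - z) (fop_affine _ _ _)).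
exact: (congr2 (fun a b : DqW n => a + b) (erefl (fop (XV j) * Top i)) E).
Qed.

(** With y = e^(alpha_0 / 2) one has X_1 = q^(1/2) / y and s_0 X_1 = q^(1/2) y; the powers of
    q^(1/2) come from here. *)
Lemma Top_X_first i j : i = 0 :> nat -> j = 0 :> nat ->
  Top i * fop (X j) = q *: (fop (XV j) * Top i) + (ctau i *: fop (X j) + (qh * (u0h - u0h^-1)) *: 1).
Proof.
move=> ei0 ej0; have sx := sX_first ei0 ej0.
have li : is_long i by rewrite /is_long ei0.
have qu : qh \is a GRing.unit by exact: param_unit.
have q0 : kc m qh != 0 by exact: kc_neq0.
have qE : tofrac (cst n q) = kc m qh * kc m qh.
  apply: etrans (congr1 (fun c => tofrac (cst n c)) (expr2 qh)) _; exact: kcM'.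
have ey : yr i = kc m qh * (tofrac (X j))^-1.
  have e0 : qhz 1 = qh by rewrite pE0.
  have e1 : kc m qh * tofrac (XV j) = hmon (- eps j, 1).
    apply: etrans (kc_fmon qh (- eps j)) _.
    exact: (congr1 (fun c => tofrac (fmon c (- eps j))) (esym e0)).
  apply: etrans _ (congr1 (fun z => kc m qh * z) (hXVE j)); apply: etrans _ (esym e1).
  rewrite /yr; apply: hmon_eq; case: (simple_coP i) => [ei|ei|p p' ep ep' hi] /=; try lia.
  by have -> : ord0 = j by apply: val_inj.
have eX : tofrac (X j) = kc m qh / yr i := div_flip q0 (hX_neq0 j) ey.
have d := xr_neq1 i; rewrite (xr_long li) in d.
have eu : upar i = u0h by rewrite /upar ei0.
have eq1 : tofrac (sr_act (srefl_simple i) (X j)) = kc m qh * yr i.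
  apply: etrans (congr1 (fun z => tofrac z) sx) _.
  apply: etrans (tofracM _ _) _; apply: etrans (congr2 (fun a b => a * b) qE (hXVE j)) _.
  by apply: etrans (esym (mulrA _ _ _)) _; apply: congr1; exact: esym ey.
have eun : kc m u0h - (kc m u0h)^-1 = tofrac (cst n (u0h - u0h^-1)).
  apply/esym; apply: etrans (kcB' _ _ _) _; apply: (congr1 (fun z => kc m u0h - z)).
  exact: kcV' (param_unit _).
have kaE : ka i = long_a (kc m (tpar i)) (kc m u0h) (yr i).
  exact: (etrans (ka_long li) (congr1 (fun c => long_a (kc m (tpar i)) (kc m c) (yr i)) eu)).
have e : ka i * (tofrac (X j) - tofrac (sr_act (srefl_simple i) (X j))) =
    tofrac (cst n (ctau i) * X j + cst n (qh * (u0h - u0h^-1))).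
  apply: etrans (congr1 (fun z => z * _) kaE) _.
  apply: etrans (long_a_diff_first _ _ (yr_neq0 i) d eX eq1) _; apply/esym.
  apply: etrans (tofrac_affine _ _ _) _.
  apply: (congr2 (fun a b => a * tofrac (X j) + b) (kc_ctau i)).
  exact: (etrans (kcM' _ _ _) (congr1 (fun z => kc m qh * z) (esym eun))).
have T := Top_fop e; rewrite sx in T; apply: etrans T _.
have E1 : fop (cst n q * XV j) * Top i = q *: (fop (XV j) * Top i).
  apply: etrans (congr1 (fun z => z * Top i) (fopM _ _)) _.
  by apply: etrans (esym (mulrA _ _ _)) _; exact: fop_cst.
have E2 : fop (cst n (ctau i) * X j + cst n (qh * (u0h - u0h^-1))) =
    ctau i *: fop (X j) + (qh * (u0h - u0h^-1)) *: 1.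
  exact: fop_affine.
exact: (congr2 (fun a b : DqW n => a + b) E1 E2).
Qed.
End Bernstein.

(** * The presented algebra and its representation by operators *)

Section PresentedAlgebras.
Variables (R : comNzRingType) (I : Type) (A : algType R) (v : I -> A).

Fixpoint aeval (x : aterm R I) : A :=
  match x with
  | AGen i => v i
  | ACst c => c *: 1
  | AAdd x y => aeval x + aeval y
  | AMul x y => aeval x * aeval y
  end.

Variable rels : aterm R I -> aterm R I -> Prop.
Hypothesis relsP : forall x y, rels x y -> aeval x = aeval y.

Lemma aeval_cong x y : acong rels x y -> aeval x = aeval y.
Proof.
elim=> /= {x y}.
- exact: relsP.
- by [].
- by move=> x y _ ->.
- by move=> x y z _ -> _ ->.
- by move=> x x' y y' _ -> _ ->.
- by move=> x x' y y' _ -> _ ->.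
- by move=> x y z; rewrite addrA.
- by move=> x y; rewrite addrC.
- by move=> x; rewrite scale0r add0r.
- by move=> x; rewrite -scalerAl mul1r scaleN1r addNr scale0r.
- by move=> x y z; rewrite mulrA.
- by move=> x; rewrite scale1r mul1r.
- by move=> x y z; rewrite mulrDl.
- by move=> x y z; rewrite mulrDr.
- by move=> c d; rewrite scalerDl.
- by move=> c d; rewrite -scalerAl mul1r scalerA.
- by move=> c x; rewrite -scalerAl mul1r -scalerAr mulr1.
Qed.

Definition presalg_eval (x : presalg rels) : A := aeval (generic_quotient.repr x).

Lemma presalg_evalE x : presalg_eval (pcls rels x) = aeval x.
Proof. exact: aeval_cong (repr_cong rels x). Qed.

Lemma presalg_evalD x y : presalg_eval (padd x y) = presalg_eval x + presalg_eval y.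
Proof. exact: presalg_evalE. Qed.
Lemma presalg_evalM x y : presalg_eval (pmul x y) = presalg_eval x * presalg_eval y.
Proof. exact: presalg_evalE. Qed.
Lemma presalg_eval1 : presalg_eval (pcst rels 1) = 1.
Proof. by apply: etrans (presalg_evalE _) _; rewrite /= scale1r. Qed.
Lemma presalg_evalZ c x : presalg_eval (pscale c x) = c *: presalg_eval x.
Proof.
apply: etrans (presalg_evalM _ _) _.
by apply: etrans (congr1 (fun z => z * _) (presalg_evalE _)) _; rewrite /= -scalerAl mul1r.
Qed.
End PresentedAlgebras.

Section RelationsInAlgebras.
Variables (R : comUnitRingType) (A : algType R).
Implicit Types (T x y : A) (c d h : R).

Lemma heckeP T c : T * T = c *: T + 1 -> T * (T - c *: 1) = 1 /\ (T - c *: 1) * T = 1.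
Proof.
by move=> e; split; rewrite ?mulrBr ?mulrBl -?scalerAr -?scalerAl ?mulr1 ?mul1r e addrC addKr.
Qed.
Lemma rel_quadP T c : T + ((-1) *: 1) * (T - c *: 1) = c *: 1.
Proof. by rewrite -scalerAl mul1r scaleN1r opprB addrCA subrr addr0. Qed.
Lemma rel_TXP T x y c : T * x = y * T - c *: y -> T * x = y * (T - c *: 1).
Proof. by move=> ->; rewrite mulrBr -scalerAr mulr1. Qed.
Lemma rel_unP T x y c d : T * x = y * T - (c *: y + d *: 1) ->
  y * (T - c *: 1) + ((-1) *: 1) * (T * x) = d *: 1.
Proof.
move=> ->; rewrite mulrBr -scalerAr mulr1 -scalerAl mul1r scaleN1r opprB.
by rewrite !addrA subrK addrAC subrr add0r.
Qed.
Lemma rel_u0P T x y c d h : h \is a GRing.unit ->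
  T * x = h ^+ 2 *: (y * T) + (c *: x + (h * d) *: 1) ->
  ((h^-1 *: 1) * (T - c *: 1)) * x + ((-1) *: 1) * (((h *: 1) * y) * T) = d *: 1.
Proof.
move=> hu e; rewrite -!scalerAl !mul1r mulrBl -!scalerAl mul1r e scaleN1r.
rewrite [c *: x + _]addrC addrA addrK scalerDr !scalerA expr2 !mulKr //.
by rewrite addrC addKr.
Qed.
End RelationsInAlgebras.

Section Representation.
Variable m : nat.
Local Notation n := m.+1.
Implicit Types (i : 'I_m.+2) (j k : 'I_n) (x : FT n).

Lemma Top_X_far i j : far i j.+1 \/ (i = n :> nat /\ j.+2 = n) ->
  Top i * fop (X j) = fop (X j) * Top i.
Proof.
move=> f; have ltj := ltn_ord j.
have sx : sr_act (srefl_simple i) (X j) = X j by apply: sX_fix; move: f; rewrite /far; lia.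
have e : ka i * (tofrac (X j) - tofrac (sr_act (srefl_simple i) (X j))) = tofrac 0.
  have e0 : tofrac (X j) - tofrac (sr_act (srefl_simple i) (X j)) = 0.
    apply: etrans (congr1 (fun z => tofrac (X j) - tofrac z) sx) _; exact: subrr.
  apply: etrans (congr1 (fun z => ka i * z) e0) _.
  by apply: etrans (mulr0 _) _; exact: esym (tofrac0 _).
apply: etrans (Top_fop e) _; apply: etrans (congr1 (fun z => _ + z) (fop0 n)) _.
by apply: etrans (addr0 _) _; exact: (congr1 (fun z => fop z * Top i) sx).
Qed.

Definition TVop i : DqW n := Top i - ctau i *: 1.

Definition gen_op (g : daha_gen n) : DqW n :=
  match g with
  | GT i => Top i
  | GTV i => TVop i
  | GX j => fop (X j)
  | GXV j => fop (XV j)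
  end.

Lemma fopC x y : fop x * fop y = fop y * fop x.
Proof. by apply: etrans (esym (fopM _ _)) _; rewrite mulrC; exact: fopM. Qed.

Lemma gen_op_rel (x y : aterm baseF (daha_gen n)) : daha_rel x y -> aeval gen_op x = aeval gen_op y.
Proof.
case.
- by move=> i; have [e _] := heckeP (Top_quad i); rewrite /= scale1r.
- by move=> i; have [_ e] := heckeP (Top_quad i); rewrite /= scale1r.
- move=> j; rewrite /= scale1r; apply: etrans (esym (fopM _ _)) _.
  exact: (etrans (congr1 (@fop n) (XXV j)) (fop1 n)).
- move=> j; rewrite /= scale1r; apply: etrans (esym (fopM _ _)) _.
  exact: (etrans (congr1 (@fop n) (XVX j)) (fop1 n)).
- move=> j k; exact: fopC.
- move=> i; exact: rel_quadP.
- move=> i j; exact: Top_far.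
- move=> i j; exact: Top_braid3.
- move=> i j; exact: Top_braid4.
- move=> i j; exact: Top_X_far.
- move=> i j k e1 e2; exact: (rel_TXP (Top_X_adj e1 e2)).
- move=> j ej; exact: (rel_unP (@Top_X_last _ ord_max j erefl ej)).
- move=> j ej; exact: (rel_u0P (param_unit 0) (@Top_X_first _ ord0 j erefl ej)).
Qed.

Definition daha_op : daha n -> DqW n := @presalg_eval _ _ _ gen_op (@daha_rel n).

Lemma daha_opE (x : aterm baseF (daha_gen n)) : daha_op (pcls (@daha_rel n) x) = aeval gen_op x.
Proof. exact: presalg_evalE gen_op_rel _. Qed.

Lemma daha_op_zmod : zmod_morphism daha_op.
Proof.
have eD := presalg_evalD gen_op_rel.
move=> x y; apply: etrans (eD _ _) _; apply: (congr1 (fun z => daha_op x + z)).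
by apply/eqP; rewrite -addr_eq0; apply/eqP; apply: etrans (esym (eD _ _)) _; apply: etrans
  (congr1 daha_op (addNr y)) _; rewrite /daha_op (presalg_evalE gen_op_rel) /= scale0r.
Qed.
Lemma daha_op_monoid : monoid_morphism daha_op.
Proof.
split; first exact: presalg_eval1 gen_op_rel.
move=> x y; exact: presalg_evalM gen_op_rel _ _.
Qed.
Lemma daha_op_scalable : scalable daha_op.
Proof. move=> c x; exact: presalg_evalZ gen_op_rel _ _. Qed.

HB.instance Definition _ := GRing.isZmodMorphism.Build (daha n) (DqW n) daha_op daha_op_zmod.
HB.instance Definition _ := GRing.isMonoidMorphism.Build (daha n) (DqW n) daha_op daha_op_monoid.
HB.instance Definition _ := GRing.isScalable.Build baseF (daha n) (DqW n) *:%R daha_op daha_op_scalable.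
Definition daha_rep : {lrmorphism daha n -> DqW n} := daha_op.
End Representation.

(** * Leading coefficients *)

Lemma div_div_swap (K : fieldType) (h x y : K) : h / (x / y) = y * h / x.
Proof. by rewrite invfM invrK mulrA mulrC mulrA. Qed.

Section LeadingCoefficients.
Variable m : nat.
Local Notation n := m.+1.
Implicit Types (D : DqW n) (g w v : shift_refl n) (b : lexp n * int) (i : 'I_m.+2).
Implicit Types (h : FTfrac n) (x : FT n).

(** The conditions that remain for the coefficient at an element w of maximal [dist] in the support.
    The third clause is the residue condition with a partner coefficient equal to 0. *)
Definition lead_conditions w h : Prop :=
  [/\ h \in @in_loc n,
      forall b, apos b -> regular_along (rfac b) (tofrac (rfac b) * h),
      forall b, apos b -> 0 < hgt w b -> regular_along (rfac b) h &
      forall b p, apos b -> hgt w b < 0 -> p \in nums b -> vanishes_on (nfac b p) h].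

Lemma nums_uniq b : uniq (nums b).
Proof.
have ne (x1 x2 : bool) (e e' : lexp 6) : x1 != x2 -> pmon x1 e != pmon x2 e'.
  by apply: contraNneq => /pmon_inj[->].
by rewrite /nums; case: ifP => // _; case: ifP => _; rewrite /= inE andbT ne.
Qed.

(** Distinct numerator factors are coprime, so after division by one of them h still vanishes on the
    others. *)
Lemma loc_div_nums b s h : isroot b.1 -> uniq s -> {subset s <= nums b} ->
  h \in @in_loc n -> (forall p, p \in s -> vanishes_on (nfac b p) h) ->
  h / tofrac (\prod_(p <- s) nfac b p) \in @in_loc n.
Proof.
move=> rb; elim: s h => [|p s IH] h.
  by move=> _ _ lh _; rewrite big_nil tofrac1 divr1.
move=> /andP[ps us] sub lh van; have pb := sub _ (mem_head _ _).
have p0 : nfac b p != 0 by exact: nfac_neq0.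
have -> : h / tofrac (\prod_(r <- p :: s) nfac b r) =
    h / tofrac (nfac b p) / tofrac (\prod_(r <- s) nfac b r).
  by rewrite big_cons tofracM invfM mulrA.
apply: IH => // [r rs||r rs].
- by apply: sub; rewrite inE rs orbT.
- by apply: loc_div => //; apply: van; exact: mem_head.
apply: vanM; first by apply: van; rewrite inE rs orbT.
apply: reg_inv => //; apply: nfac_nzd => //; first by apply: sub; rewrite inE rs orbT.
by case=> e; rewrite -e rs in ps.
Qed.

Lemma nzd_numer f i : (forall p, p \in nums (simple i) -> nzd f (nfac (simple i) p)) ->
  nzd f (numer i).
Proof.
move=> nf; apply: nzd_unitr; first by rewrite rmorph_unit // unitrV tpar_unit.
rewrite big_seq; apply: (big_ind (nzd f)) => //; first exact: nzd1.
exact: nzdM.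
Qed.

Lemma numer_neq0 i : numer i != 0.
Proof.
have ri := simple_root i; apply: mulf_neq0.
  have u : (tpar i)^-1 \is a GRing.unit by rewrite unitrV tpar_unit.
  by have := @kc_neq0 n _ u; rewrite tofrac_eq0.
rewrite prodf_seq_neq0; apply/allP => p _; exact: nfac_neq0.
Qed.

Lemma kb_neq0 i : kb i != 0.
Proof.
by apply: mulf_neq0; rewrite ?invr_eq0 tofrac_eq0 ?numer_neq0 // rfac_neq0 ?simple_root.
Qed.

Lemma div_kb h i : h / kb i = tofrac (rfac (simple i)) * h / tofrac (numer i).
Proof. exact: div_div_swap. Qed.

Lemma div_numer_loc h i : h \in @in_loc n ->
  (forall p, p \in nums (simple i) -> vanishes_on (nfac (simple i) p) h) ->
  h / tofrac (numer i) \in @in_loc n.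
Proof.
move=> lh van.
have u : (tpar i)^-1 \is a GRing.unit by rewrite unitrV tpar_unit.
have e : h / tofrac (numer i) =
    tofrac (cst n (tpar i)) * (h / tofrac (\prod_(p <- nums (simple i)) nfac (simple i) p)).
  rewrite numer_split invfM invrK; exact: mulrCA.
rewrite e; apply: rpredM; first exact: tofrac_loc.
apply: loc_div_nums => //; exact: nums_uniq.
Qed.

(** Here h / b_i is (1 - e^(alpha_i)) h divided by the numerator. The zeros of h absorb the
    numerator, and the first factor removes the simple pole along alpha_i, as it must because s_i
    lengthens s_i w. The conditions at any other b are transported to s_i b. *)
Lemma lead_conditions_step i w h : hgt w (simple i) < 0 -> lead_conditions w h ->
  lead_conditions (srefl_simple i * w)%g (sr_K (srefl_simple i) (h / kb i)).
Proof.
move=> hw [lh P G Z]; set s := srefl_simple i.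
have ri := simple_root i; have pi := simple_pos i; have r0 := rfac_neq0 ri.
have n0 := numer_neq0 i.
have rn b : isroot b.1 -> nzd (rfac b) (numer i).
  by move=> rb; apply: nzd_numer => p pn; exact: rfac_nfac_nzd.
have regV b : isroot b.1 -> regular_along (rfac b) (tofrac (numer i))^-1.
  by move=> rb; apply: reg_inv => //; exact: rn.
have Sfac b : isroot b.1 -> sr_K s (tofrac (rfac (aact s b))) = tofrac (rfac b).
  move=> rb; apply: etrans (sr_KE _ _) _; apply: (congr1 (fun x => tofrac x)).
  by apply: etrans (sr_rfac _ _) _; rewrite /s aact_areflK.
have Sact b : isroot b.1 -> sr_act s (rfac (aact s b)) = rfac b.
  by move=> rb; apply: etrans (sr_rfac _ _) _; rewrite /s aact_areflK.
have sp b : apos b -> b <> simple i -> apos (aact s b) by exact: simple_permP.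
have hs b : hgt (s * w)%g b = hgt w (aact s b) by exact: hgt_arefl_aact.
have reg_s : regular_along (rfac (simple i)) (sr_K s (h / kb i)).
  apply: sr_reg_simple; rewrite div_kb; apply: regM; first exact: P.
  exact: regV.
rewrite /lead_conditions; split=> [|b pb|b pb|b p pb].
- apply: sr_K_loc; rewrite div_kb; apply: div_numer_loc.
    by apply: rpredM => //; exact: tofrac_loc.
  move=> p pn; apply: vanMl; first exact: reg_tofrac.
  exact: Z.
- have rb : isroot b.1 by case/andP: pb.
  have [->|/eqP nb] := eqVneq b (simple i).
    by apply: regM; first exact: reg_tofrac.
  rewrite -(Sfac b rb) -rmorphM /= -(Sact b rb); apply: reg_sr.
  rewrite div_kb mulrA mulrCA -mulrA; apply: regM; first exact: reg_tofrac.
  apply: regM; first by apply: P; exact: sp.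
  exact: regV (aact_root _ _).
- have rb : isroot b.1 by case/andP: pb.
  rewrite hs; have [->|/eqP nb] := eqVneq b (simple i); first by move=> _; exact: reg_s.
  move=> hb; rewrite -(Sact b rb); apply: reg_sr; rewrite div_kb.
  apply: regM; last exact: regV (aact_root _ _).
  by apply: regM; [exact: reg_tofrac|apply: G => //; exact: sp].
have rb : isroot b.1 by case/andP: pb.
have rb' := aact_root s rb.
rewrite hs; have [->|/eqP nb] := eqVneq b (simple i).
  by rewrite /s arefl_inv // hgtN oppr_lt0 => /(lt_trans hw); rewrite ltxx.
move=> hb pn; have pn' : p \in nums (aact s (aact s b)) by rewrite /s aact_areflK.
have [p' pp' ep] := nums_srV rb' pn'.
rewrite {2}/s aact_areflK // -/s in ep; rewrite ep; apply: van_sr.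
rewrite div_kb; apply: vanM; last first.
  apply: reg_inv => //; apply: nzd_numer => r rr; apply: nfac_nzd => //.
  case=> e _; apply: (apos_neg pb pi).
  by rewrite -[b](aact_areflK b ri) -/(srefl_simple i) -/s e /s arefl_inv.
by apply: vanMl; [exact: reg_tofrac|apply: Z => //; exact: sp].
Qed.
End LeadingCoefficients.

(** * The conditions characterise the F[T]-span of the T_w *)

Section Span.
Variable m : nat.
Local Notation n := m.+1.
Implicit Types (D : DqW n) (g w v : shift_refl n) (b : lexp n * int) (i : 'I_m.+2).
Implicit Types (h : FTfrac n) (x : FT n) (ws : seq 'I_m.+2).

Lemma cf1E g : cf 1 g = if 1%g == g then 1 else 0.
Proof. exact: (cf_dmon 1 1%g g). Qed.

Lemma residue_conditions_wprod ws : residue_conditions (wprod (@Top m) ws).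
Proof.
elim: ws => [|i ws IH]; first by rewrite /wprod big_nil; exact: residue_conditions1.
by rewrite wprod_cons; exact: residue_conditions_Top.
Qed.

(** The support of T_i D lies in the union of that of D and its image under s_i; by the lifting
    property both stay below w. *)
Lemma wprod_support ws w v : red ws w -> cf (wprod (@Top m) ws) v != 0 -> bruhat v w.
Proof.
elim: ws w v => [|i ws IH] w v.
  move=> /eqP ->; rewrite /wprod big_nil cf1E.
  by case: ifP => [/eqP <- _|_]; [exact: bruhat_refl|rewrite eqxx].
move=> rw; have /andP[hw rws] := rw; rewrite wprod_cons cf_Top => nz.
have sw u : bruhat u (srefl_simple i * w)%g -> bruhat (srefl_simple i * u)%g w.
  exact: red_bruhat rw _.
have lw : bruhat (srefl_simple i * w)%g w.
  apply: (@bruhat_step _ (simple i)); first exact: simple_pos.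
    by rewrite hgt_arefl_aact ?arefl_inv ?simple_root // hgtN oppr_gt0.
  by rewrite areflK ?simple_root //; exact: bruhat_refl.
have [e|ne] := eqVneq (cf (wprod (@Top m) ws) v) 0; last first.
  by apply: bruhat_trans lw; exact: IH.
have [e'|ne'] := eqVneq (cf (wprod (@Top m) ws) (srefl_simple i * v)%g) 0.
  by move: nz; rewrite e e' rmorph0 !mulr0 addr0 eqxx.
have := sw _ (IH _ _ rws ne'); rewrite areflK ?simple_root //.
Qed.

(** The other summand of T_i contributes nothing at w, since w lies farther from rho than the
    support of the shorter product. *)
Lemma wprod_lead i ws w : red (i :: ws) w ->
  cf (wprod (@Top m) (i :: ws)) w =
  kb i * sr_K (srefl_simple i) (cf (wprod (@Top m) ws) (srefl_simple i * w)%g).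
Proof.
move=> /andP[hw rws]; rewrite wprod_cons cf_Top.
have -> : cf (wprod (@Top m) ws) w = 0.
  apply/eqP; apply: contraT => /(wprod_support rws)/bruhat_dist lt.
  have lt' := dist_descent hw; case: lt => [e|lt].
    by rewrite -e ltnn in lt'.
  by have := ltn_trans lt lt'; rewrite ltnn.
by rewrite mulr0 add0r.
Qed.

Lemma wprod_lead_neq0 ws w : red ws w -> cf (wprod (@Top m) ws) w != 0.
Proof.
elim: ws w => [|i ws IH] w.
  by move=> /eqP ->; rewrite /wprod big_nil cf1E eqxx oner_eq0.
move=> rw; rewrite wprod_lead //; have /andP[hw rws] := rw.
apply: mulf_neq0; first exact: kb_neq0.
by rewrite fmorph_eq0; exact: IH.
Qed.

Lemma lead_factor ws w h : red ws w -> lead_conditions w h ->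
  exists x, h = tofrac x * cf (wprod (@Top m) ws) w.
Proof.
elim: ws w h => [|i ws IH] w h.
  (* At the identity every positive root has positive height, so h is regular along all root
     divisors. *)
  move=> /eqP -> [lh P G Z]; have [b pb|x ->] := loc_int lh.
    by apply: G => //; case/andP: pb.
  by exists x; rewrite /wprod big_nil cf1E eqxx mulr1.
move=> rw lc; have /andP[hw rws] := rw.
have [x ex] := IH _ _ rws (lead_conditions_step hw lc).
exists (sr_act (srefl_simple i) x); rewrite wprod_lead //.
have e1 : sr_K (srefl_simple i) (tofrac x * cf (wprod (@Top m) ws) (srefl_simple i * w)%g) = h / kb i.
  exact: (etrans (congr1 (sr_K (srefl_simple i)) (esym ex)) (S2 _ _)).
have e2 := rmorphM (sr_K (srefl_simple i)) (tofrac x)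
  (cf (wprod (@Top m) ws) (srefl_simple i * w)%g).
have e3 := sr_KE (srefl_simple i) x.
rewrite /= e3 e1 in e2.
by rewrite mulrCA -e2 mulrC divfK // kb_neq0.
Qed.

(** The outer induction bounds [dist] on the support; the inner one runs through a list [s]
    containing the support elements at the top value k. Subtracting a multiple of T_w removes w and
    otherwise changes only coefficients at smaller [dist], so the list shrinks. *)
Lemma residue_conditions_ind (P : DqW n -> Prop) :
  P 0 -> (forall D D', P D -> P D' -> P (D + D')) ->
  (forall x w, P (fop x * wprod (@Top m) (word w))) ->
  forall D, residue_conditions D -> P D.
Proof.
move=> P0 PD PT.
have main k D : residue_conditions D -> (forall v, cf D v != 0 -> (dist v < k)%N) -> P D.
  elim: k D => [|k IH] D rD hD.
    have -> : D = 0 by apply: cf_ext => v; rewrite cf0; apply/eqP; apply: contraT => /hD.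
    exact: P0.
  have inner (s : seq (shift_refl n)) : forall D, residue_conditions D ->
      (forall v, cf D v != 0 -> (dist v < k)%N \/ dist v = k /\ v \in s) -> P D.
    elim: s => [|w s IHs] {rD hD}D rD hD.
      by apply: IH => // v /hD[//|[]].
    have [w0|w0] := eqVneq (cf D w) 0.
      apply: IHs => // v v0; case: (hD v v0); first by left.
      rewrite inE => -[dv /orP[/eqP e|vs]]; last by right.
      by rewrite e w0 eqxx in v0.
    have [dw|[dw _]] := hD w w0.
      apply: IHs => // v v0; case: (hD v v0); first by left.
      rewrite inE => -[dv /orP[/eqP e|vs]]; last by right.
      by rewrite e; left.
    have [Pl R Z] := rD.
    have lc : lead_conditions w (cf D w).
      split=> [|b pb|b pb hb|b p pb hb pn].
      - exact: cf_loc.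
      - exact: Pl.
      - have := R w b pb.
        have -> : cf D (arefl b * w)%g = 0.
          apply/eqP; apply: contraT => nz; have := dist_arefl w pb; rewrite hb.
          by case: (hD _ nz) => [lt|[-> _]]; rewrite dw ?ltnn // ltnNge ltnW.
        rewrite addr0; apply: reg_van; apply: rfac_neq0; by case/andP: pb.
      - exact: Z pn.
    have [x ex] := lead_factor (wordP w) lc.
    have rx : residue_conditions (D + fop (- x) * wprod (@Top m) (word w)).
      apply: residue_conditionsD => //; apply: residue_conditions_fop.
      exact: residue_conditions_wprod.
    have -> : D = (D + fop (- x) * wprod (@Top m) (word w)) + fop x * wprod (@Top m) (word w).
      by rewrite fopN mulNr subrK.
    apply: PD; last exact: PT.
    apply: (IHs _ rx) => v; rewrite cfD cf_fop tofracN => nz.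
    have [ev|nv] := eqVneq v w.
      by move: nz; rewrite ev ex mulNr subrr eqxx.
    have [t0|t0] := eqVneq (cf (wprod (@Top m) (word w)) v) 0.
      rewrite t0 mulr0 addr0 in nz; case: (hD v nz); first by left.
      by rewrite inE (negbTE nv); right.
    left; rewrite -dw; have [e|//] := bruhat_dist (wprod_support (wordP w) t0).
    by rewrite e eqxx in nv.
  have sup v : cf D v != 0 -> v \in enum_fset (msupp (D : {malg floc n[shift_refl n]})).
    apply: contraNT => /mcoeff_outdom e; rewrite /cf e; exact/eqP.
  apply: (inner _ D rD) => v v0; have := hD v v0; rewrite ltnS leq_eqVlt.
  by case/orP=> [/eqP|]; [right; split=> //; exact: sup|left].
move=> D rD.
apply: (main (\max_(v <- enum_fset (msupp (D : {malg floc n[shift_refl n]}))) dist v).+1) => // v v0.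
rewrite ltnS; apply: (@leq_bigmax_seq _ _ xpredT) => //.
by apply: contraNT v0 => /mcoeff_outdom e; rewrite /cf e.
Qed.

Lemma daha_op_residue_conditions (x : daha n) : residue_conditions (daha_op x).
Proof.
have sc c D : residue_conditions D -> residue_conditions (c *: D).
  by rewrite -fop_cst; exact: residue_conditions_fop.
have T D i : residue_conditions D -> residue_conditions (TVop i * D).
  move=> rD; rewrite mulrBl -scalerAl mul1r -scaleNr; apply: residue_conditionsD.
    exact: residue_conditions_Top.
  exact: sc.
have main t : forall D, residue_conditions D -> residue_conditions (aeval (@gen_op m) t * D).
  elim: t => [[i|i|j|j]|c|x1 IH1 x2 IH2|x1 IH1 x2 IH2] D rD /=.
  - exact: residue_conditions_Top.
  - exact: T.
  - exact: residue_conditions_fop.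
  - exact: residue_conditions_fop.
  - by rewrite -scalerAl mul1r; exact: sc.
  - by rewrite mulrDl; apply: residue_conditionsD; [exact: IH1|exact: IH2].
  - by rewrite -mulrA; apply: IH1; exact: IH2.
by have := main (generic_quotient.repr x) 1 (residue_conditions1 n); rewrite mulr1.
Qed.
End Span.

(** * Commutation lemmas in a noncommutative algebra *)

Section LaurentMonomials.
Variables (A : nzRingType) (n : nat) (x y : 'I_n -> A).
Hypothesis xy1 : forall j, x j * y j = 1.
Hypothesis yx1 : forall j, y j * x j = 1.
Hypothesis xC : forall j k, x j * x k = x k * x j.
Implicit Types (j : 'I_n) (k l : int) (a b : lexp n).

(** Negative powers are powers of the given inverse [y j], since A carries no inversion. *)
Definition zpow j k : A := match k with Posz p => x j ^+ p | Negz p => y j ^+ p.+1 end.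

Lemma zpowS j k : zpow j (k + 1) = zpow j k * x j.
Proof.
case: k => [p|[|p]].
- have -> : Posz p + 1 = Posz p.+1 by lia.
  exact: exprSr.
- by rewrite /= expr1 yx1.
have -> : Negz p.+1 + 1 = Negz p by rewrite !NegzE; lia.
by rewrite /= (exprSr _ p.+1) -mulrA yx1 mulr1.
Qed.

Lemma zpow_pred j k : zpow j (k - 1) = zpow j k * y j.
Proof. by rewrite -{2}[k](subrK 1) zpowS -mulrA xy1 mulr1. Qed.

Lemma zpowD j k l : zpow j (k + l) = zpow j k * zpow j l.
Proof.
elim/int_rect: l => [|p IH|p IH]; first by rewrite addr0 /= expr0 mulr1.
  by rewrite -addn1 PoszD addrA !zpowS IH mulrA.
by rewrite -addn1 PoszD opprD addrA !zpow_pred IH mulrA.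
Qed.

Lemma zpow_comm j j' k l : zpow j k * zpow j' l = zpow j' l * zpow j k.
Proof.
have inv (u v z : A) : u * v = 1 -> v * u = 1 -> GRing.comm z u -> GRing.comm z v.
  move=> uv vu zu; rewrite /GRing.comm -[z * v]mul1r -vu -!mulrA [u * (z * v)]mulrA.
  by rewrite -zu -mulrA uv mulr1.
have c1 : GRing.comm (x j) (x j') by exact: xC.
have c2 : GRing.comm (x j) (y j') by exact: inv (xy1 _) (yx1 _) c1.
have c3 : GRing.comm (y j) (x j').
  by apply/commr_sym; apply: inv (xy1 _) (yx1 _) _; exact/commr_sym.
have c4 : GRing.comm (y j) (y j') by exact: inv (xy1 _) (yx1 _) c3.
have px (z : A) : GRing.comm z (x j') -> GRing.comm z (y j') -> GRing.comm z (zpow j' l).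
  by case: l => p cx cy; exact: commrX.
apply/commr_sym; case: k => p; apply/commrX/commr_sym; exact: px.
Qed.

Definition lpow a : A := \prod_j zpow j (a 0 j).

Lemma prod_commM (I : Type) (s : seq I) (f g : I -> A) :
  (forall i i', f i * g i' = g i' * f i) ->
  \prod_(i <- s) (f i * g i) = (\prod_(i <- s) f i) * \prod_(i <- s) g i.
Proof.
move=> fg; elim: s => [|i s IH]; first by rewrite !big_nil mulr1.
have c : g i * \prod_(i' <- s) f i' = (\prod_(i' <- s) f i') * g i.
  by apply: commr_prod => i' _; exact/esym/fg.
by rewrite !big_cons IH !mulrA -[_ * g i * _]mulrA c !mulrA.
Qed.

Lemma lpowD a b : lpow (a + b) = lpow a * lpow b.
Proof.
rewrite -prod_commM => [|i j]; last exact: zpow_comm.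
by apply: eq_bigr => j _; rewrite mxE zpowD.
Qed.
Lemma lpow0 : lpow 0 = 1.
Proof. by rewrite /lpow big1 // => j _; rewrite mxE. Qed.

Lemma lpow_eps j (e : int) : lpow (e *: eps j) = zpow j e.
Proof.
have -> : lpow (e *: eps j) = \prod_k (if k == j then zpow j e else 1).
  apply: eq_bigr => k _; rewrite !mxE eqxx.
  by case: eqP => [->|_]; rewrite ?mulr1 ?mulr0.
by rewrite -big_mkcond big_pred1_eq.
Qed.
End LaurentMonomials.

Lemma addr_sub2_cancel (V : zmodType) (u v w : V) : u = v + (w + (u - w - v)).
Proof. by rewrite -[u - w - v]addrA -opprD addrA [v + w]addrC addrC subrK. Qed.

Section HeckeRelations.
Variables (R : comUnitRingType) (A : algType R).
Implicit Types (T x y : A) (c d h : R).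

Lemma hecke_inv T TV c : T + ((-1) *: 1) * TV = c *: 1 -> TV = T - c *: 1.
Proof. by rewrite -scalerAl mul1r scaleN1r => <-; rewrite opprB addrC subrK. Qed.
Lemma hecke_sqr T TV c : T * TV = 1 -> TV = T - c *: 1 -> T * T = c *: T + 1.
Proof. by move=> e eV; rewrite -e eV mulrBr -scalerAr mulr1 addrC subrK. Qed.

Lemma cross_same T TV x y c : TV = T - c *: 1 -> T * x = y * TV ->
  T * x = y * T - c *: y.
Proof. by move=> -> ->; rewrite mulrBr -scalerAr mulr1. Qed.
Lemma cross_inverse T TV x y c : TV * T = 1 -> T * T = c *: T + 1 -> T * x = y * TV ->
  T * y = x * T + c *: y.
Proof.
move=> VT TT e; have ey : y = T * x * T by rewrite e -mulrA VT mulr1.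
by rewrite {1}ey !mulrA TT !mulrDl mul1r -!scalerAl -ey addrC.
Qed.
Lemma cross_last T TV x y c d : TV = T - c *: 1 ->
  y * TV + ((-1) *: 1) * (T * x) = d *: 1 ->
  T * x = y * T - (c *: y + d *: 1).
Proof.
move=> -> <-; rewrite mulrBr -scalerAr mulr1 -scalerAl mul1r scaleN1r.
by rewrite addrA [c *: y + _]addrC subrK opprB addrC subrK.
Qed.
Lemma cross_first T TV x y c d h : h \is a GRing.unit -> TV = T - c *: 1 ->
  ((h^-1 *: 1) * TV) * x + ((-1) *: 1) * (((h *: 1) * y) * T) = d *: 1 ->
  T * x = h ^+ 2 *: (y * T) + (c *: x + (h * d) *: 1).
Proof.
move=> hu -> e; have {}e : d *: 1 = h^-1 *: (T * x - c *: x) - h *: (y * T).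
  by rewrite -e -!scalerAl !mul1r mulrBl -!scalerAl mul1r scaleN1r.
have -> : (h * d) *: 1 = T * x - c *: x - h ^+ 2 *: (y * T) :> A.
  by rewrite -scalerA e scalerBr !scalerA mulrV // scale1r expr2.
exact: addr_sub2_cancel.
Qed.

(** With z = T S x S T, the braid relation gives S z = T S (T x) S T and z S = T S (x T) S T; the
    outer factors are then cancelled. *)
Lemma cross_far S SV T TV x y z : S * SV = 1 -> SV * S = 1 -> T * TV = 1 -> TV * T = 1 ->
  S * T * S = T * S * T -> y = S * x * S -> z = T * y * T -> S * z = z * S ->
  T * x = x * T.
Proof.
move=> SSV SVS TTV TVT br ey ez; rewrite ez ey => e.
have e1 : T * S * (T * x) * (S * T) = T * S * (x * T) * (S * T).
  transitivity (S * T * S * x * S * T); first by rewrite br !mulrA.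
  have -> : T * S * (x * T) * (S * T) = T * S * x * (T * S * T) by rewrite !mulrA.
  by rewrite -br; move: e; rewrite !mulrA.
have cl (u v : A) : T * S * u * (S * T) = T * S * v * (S * T) -> u = v.
  have K w : SV * TV * (T * S * w * (S * T)) * (TV * SV) = w.
    have -> : SV * TV * (T * S * w * (S * T)) * (TV * SV) =
      SV * (TV * T) * S * w * (S * (T * TV) * SV) by rewrite !mulrA.
    by rewrite TVT TTV !mulr1 SVS SSV mul1r mulr1.
  by move=> h; rewrite -[u]K h K.
exact: cl e1.
Qed.
End HeckeRelations.

Section CrossRelations.
Variable A : pzRingType.
Implicit Types T a b : A.
Lemma cross_mul T a b sa sb a' b' : T * a = sa * T + a' -> T * b = sb * T + b' ->
  T * (a * b) = (sa * sb) * T + (sa * b' + a' * b).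
Proof. by move=> ea eb; rewrite mulrA ea mulrDl -[sa * T * b]mulrA eb mulrDr !mulrA addrA. Qed.
Lemma cross_add T a b sa sb a' b' : T * a = sa * T + a' -> T * b = sb * T + b' ->
  T * (a + b) = (sa + sb) * T + (a' + b').
Proof. by move=> ea eb; rewrite mulrDr ea eb mulrDl addrACA. Qed.
Lemma cross_inv T a b sa sb a' : a * b = 1 -> sb * sa = 1 -> T * a = sa * T + a' ->
  T * b = sb * T + - (sb * (a' * b)).
Proof.
move=> ab sba e; have e1 : T = sa * (T * b) + a' * b.
  by rewrite mulrA -mulrDl -e -mulrA ab mulr1.
have -> : sb * T = T * b + sb * (a' * b) by rewrite {1}e1 mulrDr !mulrA sba mul1r.
by rewrite addrK.
Qed.
End CrossRelations.

(** * The copy of F[T] in the Hecke algebra and Bernstein relations there *)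

Section LaurentGenerators.
Variable m : nat.
Local Notation n := m.+1.
Implicit Types (x y : FT n) (j k : 'I_n).

Lemma FT_gen_ind (P : FT n -> Prop) :
  (forall x y, P x -> P y -> P (x + y)) -> (forall x y, P x -> P y -> P (x * y)) ->
  (forall c, P (cst n c)) -> (forall j, P (X j)) -> (forall j, P (XV j)) ->
  forall x, P x.
Proof.
move=> PD PM Pc PX PXV.
have P1 : P (fmon 1 0) by exact: Pc.
have Pa (a b : lexp n) : P (fmon 1 a) -> P (fmon 1 b) -> P (fmon 1 (a + b)).
  move=> pa pb.
  exact: (eq_ind _ P (PM _ _ pa pb) _ (etrans (fmonM 1 1 a b) (congr1 (fun c => fmon c (a + b)) (mulr1 1)))).
have Pe j (e : int) : P (fmon 1 (e *: eps j)).
  elim/int_rect: e => [|e IH|e IH]; first by rewrite scale0r.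
    have -> : Posz e.+1 = Posz e + 1 by lia.
    rewrite scalerDl scale1r; exact: (Pa _ _ IH (PX j)).
  have -> : - Posz e.+1 = - Posz e - 1 by lia.
  rewrite scalerDl scaleN1r; exact: (Pa _ _ IH (PXV j)).
have Pm (a : lexp n) : P (fmon 1 a).
  rewrite [a]row_sum_delta; apply: (big_ind (fun a => P (fmon 1 a))) => [|a1 a2|j _].
  - exact: P1.
  - exact: Pa.
  exact: Pe.
elim/FT_ind => [|//|c a]; first by have := Pc 0; rewrite rmorph0.
apply: (eq_ind _ P (PM _ _ (Pc c) (Pm a))).
exact: (etrans (fmon_cst _ _ _) (congr1 (fun d => fmon d a) (mulr1 c))).
Qed.
End LaurentGenerators.

Section DahaLaurent.
Variable m : nat.
Local Notation n := m.+1.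
Implicit Types (x y : FT n) (j k : 'I_n) (i : 'I_m.+2) (a b : lexp n) (c : baseF).

Definition dgen (g : daha_gen n) : daha n := pcls (@daha_rel n) (AGen baseF g).
Local Notation dT i := (dgen (GT i)).
Local Notation dTV i := (dgen (GTV i)).
Local Notation dX j := (dgen (GX j)).
Local Notation dXV j := (dgen (GXV j)).

Lemma pclsE (u : aterm baseF (daha_gen n)) : pcls (@daha_rel n) u = aeval dgen u.
Proof.
elim: u => [g|c|u IHu v IHv|u IHu v IHv] //=.
- have : pcst (@daha_rel n) c = c *: (1 : daha n).
    exact: esym (pmul1r (pcst (@daha_rel n) c)).
  exact.
- by rewrite -IHu -IHv; exact: esym (pcls_add _ _ _).
- by rewrite -IHu -IHv; exact: esym (pcls_mul _ _ _).
Qed.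

Lemma daha_relP (u v : aterm baseF (daha_gen n)) : daha_rel u v -> aeval dgen u = aeval dgen v.
Proof. by move=> r; rewrite -!pclsE; apply/pclsP; exact: acong_rels. Qed.

Lemma dXXV j : dX j * dXV j = 1.
Proof. by have := daha_relP (rel_XV j); rewrite /= scale1r. Qed.
Lemma dXVX j : dXV j * dX j = 1.
Proof. by have := daha_relP (rel_VX j); rewrite /= scale1r. Qed.
Lemma dXX j k : dX j * dX k = dX k * dX j.
Proof. exact: (daha_relP (rel_XX j k)). Qed.
Lemma dTTV i : dT i * dTV i = 1.
Proof. by have := daha_relP (rel_TV i); rewrite /= scale1r. Qed.
Lemma dTVT i : dTV i * dT i = 1.
Proof. by have := daha_relP (rel_VT i); rewrite /= scale1r. Qed.
Lemma dTVE i : dTV i = dT i - ctau i *: 1.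
Proof. exact: hecke_inv (daha_relP (rel_quad i)). Qed.
Lemma dTT i : dT i * dT i = ctau i *: dT i + 1.
Proof. exact: hecke_sqr (dTTV i) (dTVE i). Qed.

Definition dmonomial a c : daha n := c *: lpow (fun j => dX j) (fun j => dXV j) a.
Lemma dmonomial_zmod a : zmod_morphism (dmonomial a).
Proof. by move=> c d; exact: scalerBl. Qed.
HB.instance Definition _ a :=
  GRing.isZmodMorphism.Build baseF (daha n) (dmonomial a) (dmonomial_zmod a).

Definition laurent_elt : FT n -> daha n :=
  @skew_sum baseF (lexp n) _ (daha n) (fun a => dmonomial a : {additive baseF -> daha n}).
HB.instance Definition _ := GRing.Additive.on laurent_elt.

Lemma laurent_elt_monoid : monoid_morphism laurent_elt.
Proof.
apply: skew_sum_multiplicative => [|a b c d] /=.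
  rewrite /dmonomial scale1r; exact: lpow0.
rewrite /dmonomial lexpM (lpowD dXXV dXVX dXX) -scalerAl -scalerAr scalerA; by [].
Qed.
HB.instance Definition _ :=
  GRing.isMonoidMorphism.Build (FT n) (daha n) laurent_elt laurent_elt_monoid.

Lemma laurent_eltU c a : laurent_elt (fmon c a) = c *: lpow (fun j => dX j) (fun j => dXV j) a.
Proof. exact: skew_sumU. Qed.
Lemma laurent_elt_cst c : laurent_elt (cst n c) = c *: 1.
Proof.
apply: etrans (laurent_eltU c 0) _; apply: (congr1 (fun z => c *: z)); exact: lpow0.
Qed.
Lemma laurent_elt_X j : laurent_elt (X j) = dX j.
Proof.
apply: etrans (laurent_eltU 1 (eps j)) _; rewrite scale1r -[eps j]scale1r.
by rewrite lpow_eps.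
Qed.
Lemma laurent_elt_XV j : laurent_elt (XV j) = dXV j.
Proof.
apply: etrans (laurent_eltU 1 (- eps j)) _; rewrite scale1r -scaleN1r.
by rewrite lpow_eps.
Qed.

Lemma daha_op_gen g : daha_op (dgen g) = gen_op g.
Proof. exact: daha_opE. Qed.

Lemma daha_op_laurent x : daha_op (laurent_elt x) = fop x.
Proof.
elim/FT_gen_ind: x => [x y IHx IHy|x y IHx IHy|c|j|j].
- apply: etrans (congr1 (@daha_op m) (rmorphD laurent_elt x y)) _.
  apply: etrans (rmorphD (@daha_op m) _ _) _.
  by apply: etrans (congr2 (fun u v => u + v) IHx IHy) _; exact: esym (fopD _ _).
- apply: etrans (congr1 (@daha_op m) (rmorphM laurent_elt x y)) _.
  apply: etrans (rmorphM (@daha_op m) _ _) _.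
  by apply: etrans (congr2 (fun u v => u * v) IHx IHy) _; exact: esym (fopM _ _).
- apply: etrans (congr1 (@daha_op m) (laurent_elt_cst c)) _.
  apply: etrans (daha_op_scalable _ _) _.
  apply: etrans (congr1 (fun z => c *: z) (rmorph1 (@daha_op m))) _.
  exact: (esym (@fop_cst1 n c)).
- exact: etrans (congr1 (@daha_op m) (laurent_elt_X j)) (daha_op_gen (GX j)).
- exact: etrans (congr1 (@daha_op m) (laurent_elt_XV j)) (daha_op_gen (GXV j)).
Qed.
End DahaLaurent.

Section Skew.
Variables (A : nzRingType) (G : monoidType) (s : ring_action A G).
Lemma skew_ind (P : Defs.skew s -> Prop) : P 0 -> (forall x y, P x -> P y -> P (x + y)) ->
  (forall a g, P (smon s a g)) -> forall x, P x.
Proof. by move=> P0 PD Pm x; rewrite [x]skewE; apply: (big_ind P) => // g _; exact: Pm. Qed.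
End Skew.

Section DahaBasis.
Variable m : nat.
Local Notation n := m.+1.
Implicit Types (x y : FT n) (j k : 'I_n) (i : 'I_m.+2) (a b : lexp n) (c : baseF).
Implicit Types (w g : shift_refl n) (z : daha n).
Local Notation dT i := (dgen (GT i)).
Local Notation dTV i := (dgen (GTV i)).
Local Notation dX j := (dgen (GX j)).
Local Notation dXV j := (dgen (GXV j)).
Local Notation s i := (srefl_simple i).

Lemma sr_act2 i x : sr_act (s i) (sr_act (s i) x) = x.
Proof.
rewrite -sr_actM; have -> : (s i * s i)%g = 1%g.
  by have := areflK 1%g (simple_root i); rewrite mulg1.
exact: sr_act1.
Qed.

Lemma dT_X_down i j k : j.+1 = i -> k.+1 = i.+1 -> dT i * dX j = dX k * dTV i.
Proof. by move=> e1 e2; exact: (daha_relP (rel_TX e1 e2)). Qed.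

Lemma dT_X_far i j : far i j.+1 \/ (i = n :> nat /\ j.+2 = n) -> dT i * dX j = dX j * dT i.
Proof. by move=> f; exact: (daha_relP (rel_TXfar f)). Qed.

Lemma dT_braid3 i (i' : 'I_m.+2) : (1 <= i)%N -> (i.+2 <= n)%N -> i' = i.+1 :> nat ->
  dT i * dT i' * dT i = dT i' * dT i * dT i'.
Proof. by move=> h1 h2 h3; exact: (daha_relP (rel_braid3 h1 h2 h3)). Qed.

(* Not among the defining relations: with p = i - 1 one has X_(i+1) = T_i T_p X_p T_p T_i,
   and this commutes with T_p. *)
Lemma dT_X_prev i j : (i < n)%N -> j.+2 = i -> dT i * dX j = dX j * dT i.
Proof.
move=> ltin ej; have lti := ltn_ord i.
have hp : (i.-1 < n.+1)%N by lia.
have hk : (i.-1 < n)%N by lia.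
have hl : (i < n)%N by lia.
set p : 'I_n.+1 := Ordinal hp; set k : 'I_n := Ordinal hk; set l : 'I_n := Ordinal hl.
have e1 : dT p * dX j = dX k * dTV p by apply: dT_X_down => /=; lia.
have e2 : dT i * dX k = dX l * dTV i by apply: dT_X_down => /=; lia.
apply: (@cross_far _ _ (dT p) (dTV p) (dT i) (dTV i) (dX j) (dX k) (dX l)).
- exact: dTTV.
- exact: dTVT.
- exact: dTTV.
- exact: dTVT.
- by apply: dT_braid3 => /=; lia.
- by rewrite e1 -mulrA dTVT mulr1.
- by rewrite e2 -mulrA dTVT mulr1.
by apply: dT_X_far; left; rewrite /far /=; lia.
Qed.

Lemma laurent_eltN x : laurent_elt (- x) = - laurent_elt x.
Proof. by rewrite rmorphN. Qed.
Lemma laurent_eltM x y : laurent_elt (x * y) = laurent_elt x * laurent_elt y.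
Proof. exact: (rmorphM (@laurent_elt m) x y). Qed.
Lemma laurent_eltD x y : laurent_elt (x + y) = laurent_elt x + laurent_elt y.
Proof. exact: (rmorphD (@laurent_elt m) x y). Qed.
Lemma laurent_elt1 : laurent_elt (1 : FT n) = 1.
Proof. exact: (rmorph1 (@laurent_elt m)). Qed.
Lemma laurent_eltZ c x : laurent_elt (cst n c * x) = c *: laurent_elt x.
Proof.
apply: etrans (@laurent_eltM _ _) _.
apply: etrans (congr1 (fun z : daha n => z * laurent_elt x) (@laurent_elt_cst m c)) _.
by apply: etrans (esym (scalerAl _ _ _)) _; rewrite mul1r.
Qed.
Lemma laurent_elt_affine c d x :
  laurent_elt (cst n c * x + cst n d) = c *: laurent_elt x + d *: 1.
Proof.
apply: etrans (laurent_eltD _ _) _.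
exact: (congr2 (fun u v : daha n => u + v) (laurent_eltZ c x) (@laurent_elt_cst m d)).
Qed.

Lemma cross_laurent i x sx y (u v w : daha n) : laurent_elt x = u -> laurent_elt sx = v ->
  laurent_elt y = w -> sr_act (s i) x = sx -> dT i * u = v * dT i + w ->
  dT i * laurent_elt x = laurent_elt (sr_act (s i) x) * dT i + laurent_elt y.
Proof. by move=> <- <- <- ->. Qed.

(** For the spanning argument only the existence of a Laurent remainder y is needed. As j counts
    from 0, [dX j] is X_(j+1): relations (iv), (v), (vi) apply when j + 1 = i < n, when j + 1 = i =
    n, and when i = j = 0. *)
Lemma cross_X i j : exists y, dT i * laurent_elt (X j) =
  laurent_elt (sr_act (s i) (X j)) * dT i + laurent_elt y.
Proof.
have ltj := ltn_ord j; have lti := ltn_ord i.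
have lX := @laurent_elt_X m; have lXV := @laurent_elt_XV m.
have [eji|nji] := eqVneq j.+1 (i : nat).
  have [ein|nin] := eqVneq (i : nat) n.
    have ejn : j.+1 = n by rewrite eji ein.
    have ei : ord_max = i by apply: val_inj.
    have r := daha_relP (rel_un ejn); rewrite /= ei in r.
    have e := cross_last (dTVE i) r.
    exists (- (cst n (ctau i) * XV j + cst n (unh - unh^-1))).
    apply: (cross_laurent (lX j) (lXV j) _ (sX_last ein ejn) e).
    apply: etrans (laurent_eltN _) _; apply: (congr1 (fun z : daha n => - z)).
    apply: etrans (laurent_elt_affine _ _ _) _.
    exact: (congr1 (fun z : daha n => ctau i *: z + _) (lXV j)).
  have hi : (i < n)%N by lia.
  pose k : 'I_n := Ordinal hi.
  have ek : k.+1 = i.+1 by [].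
  have e := cross_same (dTVE i) (dT_X_down eji ek).
  exists (- (cst n (ctau i) * X k)).
  apply: (cross_laurent (lX j) (lX k) _ (sX_adj eji ek) e).
  apply: etrans (laurent_eltN _) _; apply: (congr1 (fun z : daha n => - z)).
  by apply: etrans (laurent_eltZ _ _) _; exact: (congr1 (fun z : daha n => ctau i *: z) (lX k)).
have [eij|nij] := eqVneq (j : nat) i.
  have [i0|ni0] := eqVneq (i : nat) 0%N.
    have j0 : j = 0 :> nat by rewrite eij.
    have ei : ord0 = i by apply: val_inj.
    have r := daha_relP (rel_u0 j0); rewrite /= ei in r.
    have e := cross_first (param_unit 0) (dTVE i) r.
    exists (cst n (ctau i) * X j + cst n (qh * (u0h - u0h^-1))).
    have lq : laurent_elt (cst n q * XV j) = q *: dXV j.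
      by apply: etrans (laurent_eltZ _ _) _; exact: (congr1 (fun z : daha n => q *: z) (lXV j)).
    apply: (cross_laurent (lX j) lq _ (sX_first i0 j0)).
      apply: etrans (laurent_elt_affine _ _ _) _.
      exact: (congr1 (fun z : daha n => ctau i *: z + _) (lX j)).
    by apply: etrans e _; rewrite -scalerAl.
  (* This is X_(i+1) with 0 < i < n: relation (iv) and the quadratic relation together give T_i
     X_(i+1) = X_i T_i + (t_i^(1/2) - t_i^(-1/2)) X_(i+1). *)
  have hk : (i.-1 < n)%N by lia.
  pose k : 'I_n := Ordinal hk.
  have e1 : k.+1 = i by rewrite /k /=; lia.
  have e2 : j.+1 = i.+1 by rewrite eij.
  have e := cross_inverse (dTVT i) (dTT i) (dT_X_down e1 e2).
  exists (cst n (ctau i) * X j).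
  have es : sr_act (s i) (X j) = X k.
    by rewrite -(sX_adj e1 e2); exact: sr_act2.
  apply: (cross_laurent (lX j) (lX k) _ es e).
  by apply: etrans (laurent_eltZ _ _) _; exact: (congr1 (fun z : daha n => ctau i *: z) (lX j)).
exists 0; apply: (cross_laurent (lX j) (lX j) (rmorph0 (@laurent_elt m)) (sX_fix nji nij)).
apply: etrans _ (esym (addr0 _)).
have [e2|ne2] := eqVneq j.+2 (i : nat).
  have [ein|nin] := eqVneq (i : nat) n.
    by apply: dT_X_far; right; split=> //; rewrite e2.
  by apply: dT_X_prev => //; lia.
by apply: dT_X_far; left; rewrite /far; lia.
Qed.

(** The property passes to sums and products, and from X_j to its inverse because s_i X_j is
    invertible; so the generators suffice. *)
Lemma bernstein i x : exists y, dT i * laurent_elt x =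
  laurent_elt (sr_act (s i) x) * dT i + laurent_elt y.
Proof.
elim/FT_gen_ind: x => [x1 x2 [y1 e1] [y2 e2]|x1 x2 [y1 e1] [y2 e2]|c|j|j].
- exists (y1 + y2).
  exact: (cross_laurent (laurent_eltD _ _) (laurent_eltD _ _) (laurent_eltD _ _)
    (rmorphD (sr_act (s i)) x1 x2) (cross_add e1 e2)).
- exists (sr_act (s i) x1 * y2 + y1 * x2).
  exact: (cross_laurent (@laurent_eltM _ _) (@laurent_eltM _ _)
    (etrans (laurent_eltD _ _) (congr2 (fun u v : daha n => u + v) (@laurent_eltM _ _) (@laurent_eltM _ _)))
    (rmorphM (sr_act (s i)) x1 x2) (cross_mul e1 e2)).
- exists 0.
  apply: (cross_laurent (@laurent_elt_cst m c) (@laurent_elt_cst m c) (rmorph0 (@laurent_elt m))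
    (sr_act_cst (s i) c)).
  by rewrite addr0 -scalerAl -scalerAr mul1r mulr1.
- exact: cross_X.
have [y e] := cross_X i j.
exists (- (sr_act (s i) (XV j) * (y * XV j))).
have e1 : laurent_elt (X j) * laurent_elt (XV j) = 1.
  apply: etrans (esym (@laurent_eltM _ _)) _.
  exact: (etrans (congr1 (@laurent_elt m) (XXV j)) laurent_elt1).
have e2 : laurent_elt (sr_act (s i) (XV j)) * laurent_elt (sr_act (s i) (X j)) = 1.
  apply: etrans (esym (@laurent_eltM _ _)) _.
  apply: etrans (congr1 (@laurent_elt m) _) laurent_elt1.
  apply: etrans (esym (rmorphM (sr_act (s i)) _ _)) _.
  exact: (etrans (congr1 (sr_act (s i)) (XVX j)) (rmorph1 _)).
apply: etrans (cross_inv e1 e2 e) _; apply: congr1.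
apply/esym; apply: etrans (laurent_eltN _) _; apply: (congr1 (fun z : daha n => - z)).
apply: etrans (@laurent_eltM _ _) _; apply: congr1; exact: laurent_eltM.
Qed.
End DahaBasis.

(** * Normal form in the Hecke algebra and the isomorphism *)

Section DahaNormalForm.
Variable m : nat.
Local Notation n := m.+1.
Implicit Types (x y : FT n) (i : 'I_m.+2) (c : baseF) (w g : shift_refl n) (z : daha n).
Local Notation dT i := (dgen (GT i)).
Local Notation dword := (wprod (fun i : 'I_m.+2 => dT i)).

Lemma dword_uniq ws ws' g : red ws g -> red ws' g -> dword ws = dword ws'.
Proof.
apply: red_uniq => [i j f|i j|i j h1 h2 h3].
- exact: (daha_relP (rel_far f)).
- exact: dT_braid3.
- exact: (daha_relP (rel_braid4 h1 h2 h3)).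
Qed.

(** If s_i lengthens w, prefixing i gives a reduced word and c = 0. Otherwise w has a reduced word
    beginning with i, and the quadratic relation gives c = t_i^(1/2) - t_i^(-1/2). *)
Lemma dT_dword i w : exists c,
  dT i * dword (word w) = c *: dword (word w) + dword (word (srefl_simple i * w)%g).
Proof.
have ri := simple_root i.
have hs : hgt (srefl_simple i * w)%g (simple i) = - hgt w (simple i).
  by rewrite hgt_arefl_aact // arefl_inv // hgtN.
have ss : (srefl_simple i * (srefl_simple i * w))%g = w by exact: areflK.
have := hgt_neq0 w ri; rewrite neq_lt => /orP[hw|hw]; last first.
  have r : red (i :: word w) (srefl_simple i * w)%g.
    by rewrite /= hs oppr_lt0 hw ss wordP.
  exists 0; rewrite scale0r add0r -wprod_cons.
  exact: dword_uniq r (wordP _).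
have r : red (i :: word (srefl_simple i * w)%g) w by rewrite /= hw wordP.
exists (ctau i); rewrite (dword_uniq (wordP w) r) wprod_cons mulrA dTT.
by rewrite mulrDl mul1r -scalerAl.
Qed.

Lemma word1 : dword (word 1%g) = 1.
Proof.
have r : red [::] (1%g : shift_refl n) by rewrite /= eqxx.
by rewrite (dword_uniq (wordP _) r) /wprod big_nil.
Qed.

Definition nterm g x : daha n := laurent_elt x * dword (word g).
Lemma nterm_zmod g : zmod_morphism (nterm g).
Proof.
move=> x y; rewrite /nterm; apply: etrans _ (mulrBl _ _ _).
exact: (congr1 (fun z => z * _) (rmorphB (@laurent_elt m) x y)).
Qed.
HB.instance Definition _ g :=
  GRing.isZmodMorphism.Build (FT n) (daha n) (nterm g) (nterm_zmod g).

Local Notation coefs := (Defs.skew (trivial_action (FT n) (shift_refl n))).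

(** The skew ring with trivial action serves here only as the group of finitely supported functions
    from the affine Weyl group to F[T]. *)
Definition nform : coefs -> daha n :=
  @skew_sum (FT n) (shift_refl n) _ (daha n) (fun g => nterm g : {additive FT n -> daha n}).
HB.instance Definition _ := GRing.Additive.on nform.

Lemma nformU x g : nform (smon _ x g) = laurent_elt x * dword (word g).
Proof. exact: skew_sumU. Qed.

Definition in_nform z := exists f, z = nform f.

Lemma in_nform0 : in_nform 0.
Proof. by exists 0; rewrite raddf0. Qed.
Lemma in_nformD z1 z2 : in_nform z1 -> in_nform z2 -> in_nform (z1 + z2).
Proof. by move=> [f1 ->] [f2 ->]; exists (f1 + f2); rewrite raddfD. Qed.
Lemma in_nformU x g : in_nform (laurent_elt x * dword (word g)).
Proof. by exists (smon _ x g); rewrite nformU. Qed.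

Lemma in_nform_ind (P : daha n -> Prop) : P 0 ->
  (forall z1 z2, P z1 -> P z2 -> P (z1 + z2)) ->
  (forall x g, P (laurent_elt x * dword (word g))) -> forall z, in_nform z -> P z.
Proof.
move=> P0 PD PU z [f ->]; elim/skew_ind: f => [|f1 f2 h1 h2|x g].
- by rewrite raddf0.
- by rewrite raddfD; exact: PD.
by rewrite nformU.
Qed.

Lemma in_nform_laurent y z : in_nform z -> in_nform (laurent_elt y * z).
Proof.
elim/in_nform_ind=> [|z1 z2 h1 h2|x g].
- by rewrite mulr0; exact: in_nform0.
- by rewrite mulrDr; exact: in_nformD.
have := in_nformU (y * x) g; rewrite laurent_eltM -mulrA; exact.
Qed.

Lemma in_nformZ c z : in_nform z -> in_nform (c *: z).
Proof.
move=> /(in_nform_laurent (cst n c)); rewrite laurent_elt_cst -scalerAl mul1r; exact.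
Qed.

Lemma in_nform_T i z : in_nform z -> in_nform (dT i * z).
Proof.
elim/in_nform_ind=> [|z1 z2 h1 h2|x g].
- by rewrite mulr0; exact: in_nform0.
- by rewrite mulrDr; exact: in_nformD.
have [y e] := bernstein i x; have [c e'] := dT_dword i g.
rewrite mulrA e mulrDl -mulrA e'; apply: in_nformD; last exact: in_nformU.
apply: in_nform_laurent; apply: in_nformD.
  apply: in_nformZ; have := in_nformU 1 g; rewrite laurent_elt1 mul1r; exact.
have := in_nformU 1 (srefl_simple i * g)%g; rewrite laurent_elt1 mul1r; exact.
Qed.

Lemma in_nform_mul (u : aterm baseF (daha_gen n)) z : in_nform z -> in_nform (aeval (@dgen m) u * z).
Proof.
elim: u z => [[i|i|j|j]|c|u IHu v IHv|u IHu v IHv] z hz /=.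
- exact: in_nform_T.
- rewrite dTVE mulrBl -scalerAl mul1r -scaleNr; apply: in_nformD.
    exact: in_nform_T.
  exact: in_nformZ.
- rewrite -laurent_elt_X; exact: in_nform_laurent.
- rewrite -laurent_elt_XV; exact: in_nform_laurent.
- rewrite -scalerAl mul1r; exact: in_nformZ.
- rewrite mulrDl; apply: in_nformD; [exact: IHu|exact: IHv].
- rewrite -mulrA; apply: IHu; exact: IHv.
Qed.

(** The normal forms contain 1 and are stable under addition and under left multiplication by every
    generator. *)
Lemma daha_nform z : in_nform z.
Proof.
have h1 : in_nform 1.
  have := in_nformU 1 1%g; rewrite laurent_elt1 mul1r word1; exact.
elim/pclsW: z => u; rewrite pclsE.
have := in_nform_mul u h1; rewrite mulr1; exact.
Qed.

Lemma daha_op_dword ws : daha_op (dword ws) = wprod (@Top m) ws.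
Proof.
elim: ws => [|i ws IH]; first by rewrite /wprod !big_nil rmorph1.
rewrite !wprod_cons; apply: etrans (rmorphM (@daha_op m) _ _) _.
exact: (congr2 (fun u v : DqW n => u * v) (daha_op_gen (GT i)) IH).
Qed.

Lemma daha_op_nterm x g :
  daha_op (laurent_elt x * dword (word g)) = fop x * wprod (@Top m) (word g).
Proof.
apply: etrans (rmorphM (@daha_op m) _ _) _.
exact: (congr2 (fun u v : DqW n => u * v) (daha_op_laurent x) (daha_op_dword _)).
Qed.

Lemma cf_sum (I : Type) (r : seq I) (F : I -> DqW n) g :
  cf (\sum_(i <- r) F i) g = \sum_(i <- r) cf (F i) g.
Proof. apply: (big_morph (fun D => cf D g)); [move=> *; exact: cfD|exact: cf0]. Qed.

(** For w of largest [dist] in the support of f, no other T_g of the sum has a coefficient at w,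
    since Bruhat steps strictly raise [dist]. The coefficient there is f_w times the nonzero leading
    coefficient of T_w. *)
Lemma nform_inj (f : coefs) : daha_op (nform f) = 0 -> f = 0.
Proof.
move=> e0; apply/eqP; apply: contraT => f0.
pose S := enum_fset (msupp (f : {malg FT n[shift_refl n]})).
have S0 : S != [::].
  apply: contra f0 => /eqP e; apply/eqP/malgP => g; rewrite mcoeff0.
  have gS : g \notin S by rewrite e.
  exact: (mcoeff_outdom gS).
have [w wS wmax] : exists2 w, w \in S & forall g, g \in S -> (dist g <= dist w)%N.
  elim: {e0} S S0 => // a r IH _; have [->|/IH[w wr wm]] := eqVneq r [::].
    by exists a; rewrite ?mem_head // => g; rewrite inE => /eqP ->.
  have [aw|aw] := leqP (dist a) (dist w).
    by exists w; rewrite ?inE ?wr ?orbT // => g; rewrite inE => /orP[/eqP ->|/wm].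
  exists a; rewrite ?mem_head // => g; rewrite inE => /orP[/eqP -> //|/wm gw].
  exact: leq_trans gw (ltnW aw).
have e : cf (daha_op (nform f)) w = tofrac (f@_w) * cf (wprod (@Top m) (word w)) w.
  rewrite /nform skew_sumE raddf_sum cf_sum.
  rewrite (bigD1_seq w) ?fset_uniq //= big_seq_cond big1 ?addr0 => [|g /andP[gS gw]].
    by rewrite daha_op_nterm cf_fop.
  rewrite daha_op_nterm cf_fop.
  have [->|nz] := eqVneq (cf (wprod (@Top m) (word g)) w) 0; first exact: mulr0.
  have [ew|lt] := bruhat_dist (wprod_support (wordP g) nz); first by rewrite ew eqxx in gw.
  by have := leq_trans lt (wmax _ gS); rewrite ltnn.
move: e; rewrite e0 cf0 => /esym/eqP; rewrite mulf_eq0 (negbTE (wprod_lead_neq0 (wordP w))) orbF.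
by rewrite tofrac_eq0 mcoeff_eq0 => /negP; case.
Qed.

Lemma daha_op_inj : injective (@daha_op m).
Proof.
move=> z z' e; have [f ef] := daha_nform (z - z').
have f0 : f = 0.
  by apply: nform_inj; rewrite -ef rmorphB; apply/eqP; rewrite subr_eq0; apply/eqP.
by apply/eqP; rewrite -subr_eq0 ef f0 raddf0.
Qed.

Lemma daha_op_image (D : DqW n) : D \in @Hqk n <-> exists z, daha_op z = D.
Proof.
split=> [/HqkP|[z <-]]; last by apply/HqkP; exact: daha_op_residue_conditions.
apply: (@residue_conditions_ind m (fun D => exists z, daha_op z = D)) => [|D1 D2 [z1 e1] [z2 e2]|x w].
- by exists 0; rewrite rmorph0.
- by exists (z1 + z2); rewrite rmorphD -e1 -e2.
by exists (laurent_elt x * dword (word w)); exact: daha_op_nterm.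
Qed.
End DahaNormalForm.

Theorem theorem2p4p3 (n : nat) (hn : (0 < n)%N) :
  GRing.subalg_closed (@Hqk n) /\
  exists phi : {lrmorphism daha n -> DqW n},
    injective phi /\ (forall D : DqW n, D \in @Hqk n <-> exists x, phi x = D).
Proof.
case: n hn => // m _; split; last first.
  by exists (@daha_rep m); split; [exact: daha_op_inj|exact: daha_op_image].
(* Closure is inherited from the image of an algebra morphism. *)
split=> [|c D D' /daha_op_image[z <-] /daha_op_image[z' <-]|D D' /daha_op_image[z <-] /daha_op_image[z' <-]]; apply/daha_op_image.
- by exists 1; rewrite rmorph1.
- by exists (c *: z + z'); rewrite rmorphD; apply: (congr1 (fun D => D + _)); exact: daha_op_scalable.
- by exists (z * z'); rewrite rmorphM.
Qed.
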